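(* Let $F$ be a Banach space that fails the Radon-Nikodym property. Then for any Banach space $E$ there is a bounded linear operator $T: C([0,1],E)\to F$ which is not nuclear, but whose representing measure $G$ takes its values in the space $\mathcal N(E,F)$ of nuclear operators from $E$ to $F$ and is of bounded variation as a countably additive vector measure taking its values in $\mathcal N(E,F)$ equipped with the nuclear norm.
   Context: Banach spaces are over $\mathbb R$ or $\mathbb C$. $C(\Omega,E)$ is the Banach space of continuous $E$-valued functions on a compact Hausdorff space $\Omega$ with the supremum norm (here $\Omega=[0,1]$). $\mathcal L(X,Y)$ is the space of bounded linear operators from $X$ to $Y$. Radon-Nikodym property (RNP): a Banach space $X$ has RNP if for every finite measure space $(S,\Sigma,\mu)$ and every countably additive vector measure $m:\Sigma\to X$ of bounded variation that is absolutely continuous with respect to $\mu$, there is a strongly measurable Bochner integrable function $g:S\to X$ with $m(A)=\int_A g\,d\mu$ for each $A\in\Sigma$. Nuclear operators: $S\in\mathcal L(X,Y)$ is nuclear if there are sequences $(x_n^* )$ in $X^*$ and $(y_n)$ in $Y$ with $\sum_{n=1}^\infty \|x_n^*\|\,\|y_n\|<\infty$ and $S(x)=\sum_{n=1}^\infty x_n^*(x)y_n$ for all $x\in X$. The nuclear norm $\|S\|_{\mathrm{nuc}}$ is the infimum of $\sum_n\|x_n^*\|\,\|y_n\|$ over all such pairs of sequences representing $S$. $\mathcal N(X,Y)$ is the space of nuclear operators from $X$ to $Y$ with the nuclear norm. Representing measure: let $\Sigma$ be the Borel $\sigma$-field of $\Omega$. $M(\Omega,E^* )$ is the space of regular countably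 additive $E^*$-valued measures on $\Sigma$ of bounded variation, with the variation norm; it is identified isometrically with $C(\Omega,E)^*$ by integration. For $B\in\Sigma$ and $e\in E$ let $\phi_{B,e}\in M(\Omega,E^* )^*=C(\Omega,E)^{**}$ be given by $\phi_{B,e}(\lambda)=\lambda(B)(e)$. The representing measure of a bounded linear operator $T: C(\Omega,E)\to F$ is the finitely additive set function $G:\Sigma\to\mathcal L(E,F^{**})$ given by $G(B)e=T^{**}(\phi_{B,e})$, where $T^{**}$ is the second adjoint of $T$; $F$ is regarded as a subspace of $F^{**}$ via the canonical embedding. Bounded variation in $\mathcal N(E,F)$ means $|G|_{\mathrm{nuc}}(\Omega)=\sup_\pi\sum_{B_i\in\pi}\|G(B_i)\|_{\mathrm{nuc}}<\infty$, the supremum being over all finite partitions $\pi$ of $\Omega$ into Borel sets.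
   Formalization: The Banach space E is assumed nonzero: for E = {0} the space C([0,1],E) is {0}, so the only operator T is 0, which is nuclear, and the claim fails. *)

(* Defs.v *)
(* MathComp-Analysis. *)
From HB Require Import structures.
From mathcomp Require Import all_boot all_order all_algebra.
From mathcomp Require Import all_classical all_reals all_analysis.
From mathcomp Require Import complex.

Set Implicit Arguments.
Unset Strict Implicit.
Unset Printing Implicit Defensive.

Import Order.TTheory GRing.Theory Num.Theory.
Import numFieldNormedType.Exports.

Local Open Scope classical_set_scope.
Local Open Scope ring_scope.

Variant scalars := RealScalars | ComplexScalars.

Definition field_of (R : realType) (s : scalars) : numFieldType :=
  match s with
  | RealScalars => R
  | ComplexScalars => R[i]
  end.

Section scalars.
Context {R : realType} {s : scalars}.
Local Notation K := (field_of R s).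

Definition of_real : R -> K :=
  match s return R -> field_of R s with
  | RealScalars => id
  | ComplexScalars => fun x => Complex x 0
  end.

Definition to_real : K -> R :=
  match s return field_of R s -> R with
  | RealScalars => id
  | ComplexScalars => fun z => complex.Re z
  end.

Lemma of_realK : cancel of_real to_real.
Proof. by rewrite /of_real /to_real; case: s. Qed.

Lemma to_realK (x : K) : 0 <= x -> of_real (to_real x) = x.
Proof.
rewrite /of_real /to_real; case: s x => //= -[a b].
by rewrite lecE /= => /andP[/eqP <-].
Qed.

Lemma ler_of_real x y : (of_real x <= of_real y) = (x <= y).
Proof. by rewrite /of_real; case: s => //; rewrite lecE /= eqxx. Qed.

Lemma of_realD x y : of_real (x + y) = of_real x + of_real y.
Proof.
rewrite /of_real; case: s => //.
by apply/eqP; rewrite eq_complex /= addr0 !eqxx.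
Qed.

Lemma of_realM x y : of_real (x * y) = of_real x * of_real y.
Proof.
rewrite /of_real; case: s => //.
by apply/eqP; rewrite eq_complex /= !mulr0 !mul0r subr0 addr0 !eqxx.
Qed.

Lemma of_real0 : of_real 0 = 0.
Proof. by rewrite /of_real; case: s. Qed.

(* Norms over a numFieldType take their values in the scalar field; rnorm is the
   same norm, as a real number. *)
Definition rnorm {V : normedZmodType K} (x : V) : R := to_real `|x|.

Lemma of_real_rnorm {V : normedZmodType K} (x : V) : of_real (rnorm x) = `|x|.
Proof. exact/to_realK. Qed.

Lemma rnorm_ge0 {V : normedZmodType K} (x : V) : 0 <= rnorm x.
Proof. by rewrite -ler_of_real of_real0 of_real_rnorm. Qed.

Lemma rnorm0 {V : normedZmodType K} : rnorm (0 : V) = 0.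
Proof. by rewrite /rnorm normr0 -of_real0 of_realK. Qed.

Lemma rnorm_eq0 {V : normedZmodType K} (x : V) : rnorm x = 0 -> x = 0.
Proof.
by move=> x0; apply/eqP; rewrite -normr_eq0 -of_real_rnorm x0 of_real0.
Qed.

Lemma ler_rnormD {V : normedZmodType K} (x y : V) :
  rnorm (x + y) <= rnorm x + rnorm y.
Proof. by rewrite -ler_of_real of_realD !of_real_rnorm ler_normD. Qed.

Lemma rnormZ {V : normedModType K} (k : K) (x : V) :
  rnorm (k *: x) = rnorm k * rnorm x.
Proof.
by apply: (can_inj of_realK); rewrite of_realM !of_real_rnorm normrZ.
Qed.

Lemma rnorm_continuous {V : normedModType K} : continuous (@rnorm V).
Proof.
move=> x; apply/cvgrPdist_le => e e0; near=> y.
have yx : rnorm (x - y) <= e.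
  rewrite -ler_of_real of_real_rnorm; near: y.
  apply: cvgr_dist_le; first exact: cvg_id.
  by rewrite lt_def -[X in _ != X]of_real0 (inj_eq (can_inj of_realK)) gt_eqF//=
    -[X in X <= _]of_real0 ler_of_real ltW.
have H (a b : V) : rnorm a - rnorm b <= rnorm (a - b).
  by rewrite lerBlDr -{1}(subrK b a) ler_rnormD.
rewrite ler_norml lerNl opprB; apply/andP; split; last exact: le_trans yx.
by apply: (le_trans (H _ _)); rewrite /rnorm distrC.
Unshelve. all: by end_near. Qed.

End scalars.

Section bounded_operators.
Context {K : numFieldType} {X Y : normedModType K}.

Definition is_bounded_op : {pred X -> Y} :=
  fun f => `[< linear f /\ continuous f >].

Lemma is_bounded_op_submod : submod_closed is_bounded_op.
Proof.
split=> [|a f g /asboolP[lf cf] /asboolP[lg cg]]; apply/asboolP; split.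
- by move=> k x y; rewrite scaler0 addr0.
- exact: cst_continuous.
- move=> k x y; rewrite !fctE lf lg !scalerDr !scalerA (mulrC a k).
  by rewrite -!addrA; congr (_ + _); rewrite addrCA.
- by move=> x; apply: cvgD; [apply: cvgZr; exact: cf|exact: cg].
Qed.

HB.instance Definition _ :=
  GRing.isSubmodClosed.Build K (X -> Y) is_bounded_op is_bounded_op_submod.

(* A linear operator between normed spaces is bounded iff it is continuous. *)
Record bounded_op := BoundedOp {
  bounded_op_fun :> X -> Y ;
  _ : bounded_op_fun \in is_bounded_op }.

HB.instance Definition _ := [isSub for bounded_op_fun].
HB.instance Definition _ := [Choice of bounded_op by <:].
HB.instance Definition _ := [SubChoice_isSubLmodule of bounded_op by <:].

Lemma bounded_op_linear (f : bounded_op) : linear f.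
Proof. by case: f => f /= /asboolP[]. Qed.

Lemma bounded_op_continuous (f : bounded_op) : continuous f.
Proof. by case: f => f /= /asboolP[]. Qed.

End bounded_operators.
Arguments bounded_op {K} X Y.


Definition dual_space {K : numFieldType} (X : normedModType K) := bounded_op X K^o.

HB.instance Definition _ (K : numFieldType) (X : normedModType K) :=
  GRing.Lmodule.on (dual_space X).

Definition adjoint_fun {K : numFieldType} {X Y : normedModType K}
  (T : bounded_op X Y) (u : dual_space Y) : X -> K^o := u \o T.

Lemma adjoint_subproof {K : numFieldType} {X Y : normedModType K}
  (T : bounded_op X Y) (u : dual_space Y) : adjoint_fun T u \in is_bounded_op.
Proof.
apply/asboolP; split.
  by move=> k x y; rewrite /adjoint_fun /= !bounded_op_linear.
move=> x; apply: (@continuous_comp _ _ _ T u).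
  exact: bounded_op_continuous.
exact: (@bounded_op_continuous _ _ _ u).
Qed.

Definition adjoint {K : numFieldType} {X Y : normedModType K}
  (T : bounded_op X Y) (u : dual_space Y) : dual_space X :=
  BoundedOp (adjoint_subproof T u).

Definition unit_interval (R : realType) : Type := (`[0%R, 1%R]%classic : set R).

HB.instance Definition _ (R : realType) :=
  PseudoMetric.copy (unit_interval R) (`[0%R, 1%R]%classic : set R).

Lemma unit_interval_compact (R : realType) : compact [set: unit_interval R].
Proof.
move=> F FF FT.
have G01 : (set_val @ F) (`[0%R, 1%R]%classic : set R).
  by apply: (@filterS _ F FF setT) => // x _; exact: set_valP x.
have [p [p01 clp]] := @segment_compact R 0 1 (set_val @ F) _ G01.
exists (exist _ p (mem_set p01)); split=> // A B FA [_ [[W oW <-] /= Wp WB]].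
have /(_ _ _)[] := clp (set_val @` A) W.
- by apply: (@filterS _ F FF A) => // x Ax; exists x.
- exact: open_nbhs_nbhs.
by move=> _ [[x Ax <-] Wx]; exists x; split => //; exact: WB.
Qed.

Section continuous_predicate.
Context {K : numFieldType} {T : topologicalType} {E : normedModType K}.

Definition is_continuous : {pred T -> E} := fun f => `[< continuous f >].

Lemma is_continuous_submod : submod_closed is_continuous.
Proof.
split=> [|a f g /asboolP cf /asboolP cg]; apply/asboolP.
- exact: cst_continuous.
- by move=> x; apply: cvgD; [apply: cvgZr; exact: cf|exact: cg].
Qed.

HB.instance Definition _ :=
  GRing.isSubmodClosed.Build K (T -> E) is_continuous is_continuous_submod.

End continuous_predicate.

Section continuous_functions.
Context {R : realType} {s : scalars} {E : normedModType (field_of R s)}.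
Local Notation K := (field_of R s).
Local Notation Omega := (unit_interval R).

Record C01 := MkC01 { C01_fun :> Omega -> E ; _ : C01_fun \in is_continuous }.

HB.instance Definition _ := [isSub for C01_fun].
HB.instance Definition _ := [Choice of C01 by <:].
HB.instance Definition _ := [SubChoice_isSubLmodule of C01 by <:].

Lemma C01_continuous (f : C01) : continuous f.
Proof. by case: f => f /= /asboolP. Qed.

Definition sup_norm (f : C01) : R := sup (range (fun t => rnorm (f t))).

Lemma C01_has_sup (f : C01) : has_sup (range (fun t => rnorm (f t))).
Proof.
split.
  have z01 : (0 : R) \in `[0%R, 1%R]%classic by rewrite inE /= bound_itvE ler01.
  by exists (rnorm (f (exist _ 0 z01 : Omega))); eexists.
have /compact_bounded[M [_ /(_ (M + 1))]] :
    compact (range (fun t => rnorm (f t))).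
  apply: continuous_compact; last exact: unit_interval_compact.
  apply: continuous_subspaceT => t.
  by apply: continuous_comp; [exact: C01_continuous|exact: rnorm_continuous].
have M1 : M < M + 1 by rewrite ltrDl.
move=> /(_ M1) fM; exists (M + 1) => _ [t _ <-].
by apply: (le_trans (ler_norm _)); apply: fM; exists t.
Qed.

Lemma le_sup_norm (f : C01) t : rnorm (f t) <= sup_norm f.
Proof. by apply: sup_upper_bound; [exact: C01_has_sup|exists t]. Qed.

Lemma sup_norm_le (f : C01) c : (forall t, rnorm (f t) <= c) -> sup_norm f <= c.
Proof.
by move=> fc; apply: ge_sup; [case: (C01_has_sup f)|move=> _ [t _ <-]].
Qed.

Definition C01_norm (f : C01) : K := of_real (sup_norm f).

Lemma ler_C01_normD f g : C01_norm (f + g) <= C01_norm f + C01_norm g.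
Proof.
rewrite -of_realD ler_of_real; apply: sup_norm_le => t.
by apply: (le_trans (ler_rnormD _ _)); apply: lerD; exact: le_sup_norm.
Qed.

Lemma C01_normZ (k : K) f : C01_norm (k *: f) = `|k| * C01_norm f.
Proof.
have H (l : K) g : sup_norm (l *: g) <= rnorm l * sup_norm g.
  apply: sup_norm_le => t; rewrite [X in rnorm X](_ : _ = l *: g t)// rnormZ.
  by apply: ler_wpM2l; [exact: rnorm_ge0|exact: le_sup_norm].
rewrite -of_real_rnorm -of_realM; congr of_real; apply/eqP; rewrite eq_le H /=.
have [->|k0] := eqVneq k 0.
  rewrite rnorm0 mul0r.
  have [[_ [t _ _]] _] := C01_has_sup f.
  exact: le_trans (rnorm_ge0 _) (le_sup_norm (0 *: f) t).
have r0 : 0 < rnorm k.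
  rewrite lt_def rnorm_ge0 andbT; apply: contra k0 => /eqP/rnorm_eq0 ->.
  by rewrite eqxx.
rewrite mulrC -ler_pdivlMr// mulrC.
have -> : (rnorm k)^-1 = rnorm k^-1.
  apply: (mulfI (lt0r_neq0 r0)); rewrite divff ?lt0r_neq0//.
  apply: (can_inj (@of_realK R s)); rewrite of_realM !of_real_rnorm -normrM.
  by rewrite divff// normr1 /of_real; case: (s).
by rewrite -[X in sup_norm X <= _](scalerK k0); exact: H.
Qed.

Lemma C01_norm_eq0 f : C01_norm f = 0 -> f = 0.
Proof.
rewrite -of_real0 => /(can_inj of_realK) f0; apply/val_inj/funext => t /=.
by apply/rnorm_eq0/eqP; rewrite eq_le rnorm_ge0 andbT -f0 le_sup_norm.
Qed.

HB.instance Definition _ := Lmodule_isNormed.Build K C01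
  ler_C01_normD C01_normZ C01_norm_eq0.

End continuous_functions.
Arguments C01 {R s} E.

Section norms.
Context {R : realType} {s : scalars}.
Local Notation K := (field_of R s).
Local Open Scope ereal_scope.

Definition enorm {V : normedZmodType K} (x : V) : \bar R := (rnorm x)%:E.

Definition opnorm {X Y : normedModType K} (f : bounded_op X Y) : \bar R :=
  ereal_sup [set enorm (f x) | x in [set x : X | (rnorm x <= 1)%R]].

Definition nuclear_representation {X Y : normedModType K}
    (f : bounded_op X Y) (u : nat -> dual_space X) (y : nat -> Y) : Prop :=
  \sum_(0 <= n <oo) opnorm (u n) * enorm (y n) < +oo /\
  forall x : X, [series u n x *: y n]_n%R @ \oo --> f x.

Definition nuclear {X Y : normedModType K} (f : bounded_op X Y) : Prop :=
  exists u y, nuclear_representation f u y.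

(* Equal to +oo on the operators that are not nuclear. *)
Definition nuclear_norm {X Y : normedModType K} (f : bounded_op X Y) : \bar R :=
  ereal_inf [set \sum_(0 <= n <oo) opnorm (uy.1 n) * enorm (uy.2 n)
            | uy in [set uy | nuclear_representation f uy.1 uy.2]].

End norms.

(* Vector measures on the sigma-algebra Sigma with values in an additive group
   V. The norm N on V is a parameter: V is in turn a Banach space, a dual space
   and a space of operators with the nuclear norm. *)
Section vector_measures.
Context {R : realType} {S : Type} (Sigma : set (set S)).
Context {V : zmodType} (N : V -> \bar R).
Local Open Scope ereal_scope.

Definition countably_additive (m : set S -> V) : Prop :=
  forall B : nat -> set S, (forall n, Sigma (B n)) -> trivIset setT B ->
  (fun n => N (m (\bigcup_k B k) - \sum_(k < n) m (B k))%R) @ \oo --> 0.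

Definition vector_variation (m : set S -> V) (A : set S) : \bar R :=
  ereal_sup [set v | exists n (B : 'I_n -> set S),
    [/\ forall i, Sigma (B i), trivIset setT B, \bigcup_i B i = A
      & v = \sum_(i < n) N (m (B i))]].

Definition has_bounded_variation (m : set S -> V) : Prop :=
  vector_variation m setT < +oo.

End vector_measures.

Section simple_functions.
Context {S : Type} (Sigma : set (set S)).

(* The function \sum_i 1_(B i) x_i; the sets B i need not be disjoint. *)
Record simple_function (X : Type) := Simple {
  simple_size : nat ;
  simple_set : 'I_simple_size -> set S ;
  simple_val : 'I_simple_size -> X ;
  simple_setP : forall i, Sigma (simple_set i) }.

Arguments simple_size {X} _.
Arguments simple_set {X} _ _.
Arguments simple_val {X} _ _.

Definition simple_fun {X : zmodType} (f : simple_function X) (t : S) : X :=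
  \sum_(i | t \in simple_set f i) simple_val f i.

(* \sum_i m (B i) x_i, where m (B i) acts on X. *)
Definition simple_integral {X : Type} {Y : zmodType} (m : set S -> X -> Y)
  (f : simple_function X) : Y := \sum_i m (simple_set f i) (simple_val f i).

End simple_functions.
Arguments simple_size {S Sigma X} _.
Arguments simple_set {S Sigma X} _ _.
Arguments simple_val {S Sigma X} _ _.

Section bochner.
Context {R : realType} {s : scalars} {X : normedModType (field_of R s)}.
Context {d : measure_display} {S : measurableType d}.
Variable mu : {finite_measure set S -> \bar R}.
Local Notation simple := (simple_function (@measurable d S) X).
Local Open Scope ereal_scope.

Definition strongly_measurable (g : S -> X) : Prop :=
  exists f : nat -> simple,
    {ae mu, forall t, simple_fun (f n) t @[n --> \oo] --> g t}.

Definition bochner_approximation (f : nat -> simple) (g : S -> X) : Prop :=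
  {ae mu, forall t, simple_fun (f n) t @[n --> \oo] --> g t} /\
  \int[mu]_t enorm (g t - simple_fun (f n) t)%R @[n --> \oo] --> 0.

Definition bochner_integrable (g : S -> X) : Prop :=
  exists f, bochner_approximation f g.

(* \int_A g d mu = x *)
Definition is_bochner_integral (A : set S) (g : S -> X) (x : X) : Prop :=
  exists f, bochner_approximation f g /\
  simple_integral (fun B (y : X) => of_real (fine (mu (A `&` B))) *: y) (f n)
    @[n --> \oo] --> x.

End bochner.

Definition RNP {R : realType} {s : scalars} (X : normedModType (field_of R s)) :
    Prop :=
  forall (d : measure_display) (S : measurableType d)
    (mu : {finite_measure set S -> \bar R}) (m : set S -> X),
  countably_additive (@measurable d S) enorm m ->
  has_bounded_variation (@measurable d S) enorm m ->
  (* absolute continuity of m with respect to mu *)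
  (forall A, measurable A -> mu A = 0%E -> m A = 0) ->
  exists g : S -> X, [/\ strongly_measurable mu g, bochner_integrable mu g
    & forall A, measurable A -> is_bochner_integral mu A g (m A)].

Definition borel (T : topologicalType) : set (set T) := <<s [set U | open U] >>.

Section representing_measure.
Context {R : realType} {s : scalars} {E F : normedModType (field_of R s)}.
Local Notation K := (field_of R s).
Local Notation Omega := (unit_interval R).

Definition regular_measure (l : set Omega -> dual_space E) : Prop :=
  forall B (e : R), borel B -> 0 < e ->
  exists C U, [/\ compact C, open U, C `<=` B, B `<=` U
    & (vector_variation (@borel Omega) opnorm l (U `\` C) < e%:E)%E].

(* Membership in M(Omega, E^* ). *)
Definition dual_measure (l : set Omega -> dual_space E) : Prop :=
  [/\ countably_additive (@borel Omega) opnorm l,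
      has_bounded_variation (@borel Omega) opnorm l & regular_measure l].

(* The integral of a uniform limit of simple functions; it does not depend on
   the approximating sequence when l is of bounded variation. *)
Definition is_integral (l : set Omega -> dual_space E) (f : Omega -> E) (c : K) :
    Prop :=
  exists g : nat -> simple_function (@borel Omega) E,
    {uniform, (fun n => simple_fun (g n)) @ \oo --> f} /\
    simple_integral (fun B e => l B e : K^o) (g n) @[n --> \oo] --> c.

(* The measure in M(Omega, E^* ) corresponding to a functional on C(Omega, E);
   by the Riesz-Singer theorem it exists, and it is unique on Borel sets. *)
Definition measure_of (psi : dual_space (C01 E)) : set Omega -> dual_space E :=
  xget (fun=> 0) [set l | dual_measure l /\
                          forall f : C01 E, is_integral l f (psi f)].

Definition phi (B : set Omega) (e : E) : dual_space (C01 E) -> K :=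
  fun psi => measure_of psi B e.

(* phi B e is a function on C(Omega, E)^*, which by the Riesz-Singer theorem is
   an element of C(Omega, E)^**. Elements of a bidual are represented as
   functions on the dual, and second_adjoint T is u |-> Phi (T^* u), which is
   T^** Phi when Phi is in the bidual. *)
Definition second_adjoint {X Y : normedModType K} (T : bounded_op X Y)
  (Phi : dual_space X -> K) : dual_space Y -> K := fun u => Phi (adjoint T u).

Definition representing_measure (T : bounded_op (C01 E) F) (B : set Omega)
  (e : E) : dual_space F -> K := second_adjoint T (phi B e).

Definition canonical_embedding (y : F) : dual_space F -> K := fun u => u y.

End representing_measure.

(* Main.v *)
Require Import Defs.
From HB Require Import structures.
From mathcomp Require Import all_boot all_order all_algebra.
From mathcomp Require Import all_classical all_reals all_analysis.
From mathcomp Require Import measurable_realfun measurable_fun_approximation.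
From mathcomp Require Import complex ring lra.

Set Implicit Arguments.
Unset Strict Implicit.
Unset Printing Implicit Defensive.

Import Order.TTheory GRing.Theory Num.Theory.
Import numFieldNormedType.Exports.

Local Open Scope classical_set_scope.
Local Open Scope ring_scope.

(** The operator is [T f = \int h (f) d m'] and its representing measure is
    [G B = m' B . h], where [h] is a non-zero functional on [E] and [m'] is an
    [F]-valued measure on the unit interval that is far from having a density.

    Let [m] be a vector measure on a space [S] without density with respect to
    [mu].  If, for every [e > 0], some finite partition [r] had averages
    [\sum_x (m x / mu x) 1_x] within [e] of [m] in variation, these averages
    would converge almost everywhere and in mean to a density
    ([density_of_approximations]).  So for some [e > 0] every finite partition has
    a refinement along which [m] oscillates by more than [e]
    ([no_density_oscillation]).  Iterating gives a sequence of sets [A k] whose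
    finite Boolean combinations, indexed by the nodes of the binary tree, carry a
    martingale with oscillation more than [e] at infinitely many generations
    ([oscillating_sequence]).  The base-4 number with digits [2 * 1_(A k) x] is a
    measurable map from [S] to the unit interval, and [m'] is the image of [m].
    Since the digits avoid [1] and [3], every digit extends to a continuous
    function: each generation of the tree is the pull-back of a continuous
    partition of unity ([pou_coding]), and [T] recovers [m] on the nodes
    ([integral_pou]).

    The values of [G] have rank one, so the nuclear norm of [G B] is at most
    [2 * rnorm (m' B)]; countable additivity and bounded variation of [G] are
    inherited from [m].  The scalar measures [u (G B e)] are regular and represent
    the adjoint of [T]; a Urysohn function shows that a regular measure is
    determined by its integrals ([dual_measure_unique]), so [G] is the
    representing measure.

    Suppose that [T = \sum_n u_n (.) y_n] were nuclear.  Then on the tree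
    [m = \sum_n c_n y_n], where the total mass of [c_n] over each generation is at
    most a constant times the norm of [u_n] ([sum_level_le]).  The tail of the
    series contributes little to the oscillation.  The head lives in a
    finite-dimensional space, where finitely many Hahn-Banach functionals [v] compute the norm
    ([finite_norming]); and each scalar martingale [v (m x) / mu x] has vanishing
    oscillation, by orthogonality of martingale increments after discarding a set
    on which the density of the variation of [m] is large ([weak_oscillation]).
    Hence the oscillation of [m] tends to [0] ([nuclear_oscillation]), a
    contradiction. *)

(** * Real scalars inside the scalar field *)

Section real_scalars.
Context {R : realType} {s : scalars}.
Local Notation K := (field_of R s).
Implicit Types (a b : R).

Lemma of_real1 : of_real 1 = 1 :> K.
Proof. by rewrite /of_real; case: s. Qed.

Lemma of_realN a : of_real (- a) = - of_real a :> K.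
Proof. by apply/eqP; rewrite -subr_eq0 opprK -of_realD addNr of_real0. Qed.

Lemma of_realB a b : of_real (a - b) = of_real a - of_real b :> K.
Proof. by rewrite of_realD of_realN. Qed.

Lemma rnorm_of_real a : rnorm (of_real a : K) = `|a|.
Proof.
apply: (can_inj (@of_realK R s)); rewrite of_real_rnorm.
rewrite /of_real; case: (s) => //=; apply/eqP; rewrite eq_complex /=.
by rewrite expr0n /= addr0 sqrtr_sqr !eqxx.
Qed.

Lemma of_real_gt0 a : (0 < (of_real a : K)) = (0 < a).
Proof.
by rewrite !lt_def -!(@of_real0 R s) ler_of_real (inj_eq (can_inj (@of_realK R s))).
Qed.

Lemma to_real_gt0 (x : K) : 0 < x -> 0 < to_real x.
Proof. by move=> x0; rewrite -of_real_gt0 to_realK// ltW. Qed.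

Lemma rnormN (V : normedZmodType K) (x : V) : rnorm (- x) = rnorm x.
Proof. by rewrite /rnorm normrN. Qed.

Lemma rnormB (V : normedZmodType K) (x y : V) : rnorm (x - y) = rnorm (y - x).
Proof. by rewrite -rnormN opprB. Qed.

Lemma ler_rnormB (V : normedZmodType K) (x y : V) :
  rnorm (x - y) <= rnorm x + rnorm y.
Proof. by rewrite -(rnormN y) ler_rnormD. Qed.

Lemma ler_rnorm_sum (V : normedZmodType K) (I : Type) (r : seq I) (P : pred I)
    (x : I -> V) :
  rnorm (\sum_(i <- r | P i) x i) <= \sum_(i <- r | P i) rnorm (x i).
Proof.
elim/big_ind2 : _ => [|u a v b ua vb|//]; first by rewrite rnorm0.
exact: le_trans (ler_rnormD _ _) (lerD ua vb).
Qed.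

Lemma rnormM (x y : K) : rnorm (x * y) = rnorm x * rnorm y.
Proof. exact: (@rnormZ R s K^o x y). Qed.

Lemma rnormZ_real (V : normedModType K) a (x : V) :
  rnorm (of_real a *: x) = `|a| * rnorm x.
Proof. by rewrite rnormZ rnorm_of_real. Qed.

End real_scalars.

(** * The Hahn-Banach theorem *)

Section hahn_banach.
Context {R : realType} {s : scalars} {F : normedModType (field_of R s)}.
Local Notation K := (field_of R s).

Definition real_contraction (v : F -> R) : Prop :=
  [/\ forall x y, v (x + y) = v x + v y,
      forall (a : R) x, v (of_real a *: x) = a * v x
    & forall x, `|v x| <= rnorm x].

(** A functional is encoded by its graph, a real subspace of [F * R]; lying under
    the norm already forces the graph to be single-valued. *)
Definition dominated_graph (g : set (F * R)) : Prop :=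
  (forall (a : R) p q, g p -> g q ->
     g (of_real a *: p.1 + q.1, a * p.2 + q.2)) /\
  (forall p, g p -> p.2 <= rnorm p.1).

(** The admissible values at [x1] lie between the supremum of
    [r - rnorm (x - x1)] and the infimum of [rnorm (x + x1) - r] over the graph;
    the triangle inequality makes this interval non-empty. *)
Lemma dominated_graph_extend (g : set (F * R)) (x1 : F) :
  g !=set0 -> dominated_graph g ->
  exists c, dominated_graph
    [set (p.1 + of_real t *: x1, p.2 + t * c) | p in g & t in [set: R]].
Proof.
move=> [p0 gp0] [glin gle].
have key p q : g p -> g q ->
    p.2 - rnorm (p.1 - x1) <= rnorm (q.1 + x1) - q.2.
  move=> gp gq; rewrite lerBrDr addrAC lerBlDr.
  have := gle _ (glin 1 _ _ gp gq); rewrite of_real1 scale1r mul1r => /= h.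
  apply: (le_trans h); apply: le_trans (ler_rnormD _ _).
  by rewrite [q.1 + x1 + _]addrC addrACA addNr addr0.
pose A := [set p.2 - rnorm (p.1 - x1) | p in g].
have supA : has_sup A.
  split; first by exists (p0.2 - rnorm (p0.1 - x1)); exists p0.
  by exists (rnorm (p0.1 + x1) - p0.2) => _ [p gp <-]; exact: key.
have lo p : g p -> p.2 - rnorm (p.1 - x1) <= sup A.
  by move=> gp; apply: sup_upper_bound => //; exists p.
have hi q : g q -> sup A <= rnorm (q.1 + x1) - q.2.
  move=> gq; apply: ge_sup; first by case: supA.
  by move=> _ [p gp <-]; exact: key.
have g0 : g (0, 0).
  have := glin (-1) _ _ gp0 gp0.
  by rewrite of_realN of_real1 scaleN1r mulN1r !addNr.
have gZ (a : R) p : g p -> g (of_real a *: p.1, a * p.2).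
  by move=> gp; have := glin a _ _ gp g0; rewrite !addr0.
exists (sup A); split.
  move=> a _ _ [p gp [t _ <-]] [q gq [u _ <-]] /=.
  exists (of_real a *: p.1 + q.1, a * p.2 + q.2); first exact: glin.
  exists (a * t + u) => //=; congr pair; last by ring.
  by rewrite of_realD of_realM scalerDl scalerDr scalerA addrACA.
move=> _ [p gp [t _ <-]] /=.
have [t0|t0|->] := ltgtP t 0; last by rewrite of_real0 scale0r mul0r !addr0 gle.
- have nt : 0 < - t by rewrite oppr_gt0.
  have := lo _ (gZ (- t)^-1 _ gp) => /=.
  rewrite lerBlDr => h.
  have e : p.1 + of_real t *: x1 = of_real (- t) *: (of_real (- t)^-1 *: p.1 - x1).
    rewrite scalerBr scalerA -of_realM divff ?gt_eqF// of_real1 scale1r.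
    by rewrite of_realN scaleNr opprK.
  rewrite e rnormZ_real gtr0_norm//.
  have : (- t) * ((- t)^-1 * p.2) <= (- t) * (sup A + rnorm (of_real (- t)^-1 *: p.1 - x1)).
    by rewrite ler_pM2l.
  by rewrite mulrA divff ?gt_eqF// mul1r; lra.
- have := hi _ (gZ t^-1 _ gp) => /=.
  rewrite lerBrDr => h.
  have e : p.1 + of_real t *: x1 = of_real t *: (of_real t^-1 *: p.1 + x1).
    by rewrite scalerDr scalerA -of_realM divff ?gt_eqF// of_real1 scale1r.
  rewrite e rnormZ_real gtr0_norm//.
  have : t * (sup A + t^-1 * p.2) <= t * rnorm (of_real t^-1 *: p.1 + x1).
    by rewrite ler_pM2l.
  by rewrite mulrDr mulrA divff ?gt_eqF// mul1r; lra.
Qed.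

(** By the one-step extension, a graph given by Zorn's lemma is total.  The
    functional is linear over the reals only, which is enough to compute norms
    over both fields. *)
Theorem hahn_banach (x0 : F) :
  exists v, real_contraction v /\ v x0 = rnorm x0.
Proof.
pose P (g : set (F * R)) :=
  g = set0 \/ dominated_graph g /\ g (x0, rnorm x0).
have [|g [Pg gmax]] := @Zorn_bigcup _ P.
  move=> C CP Ctot.
  have [[g [Cg g0]]|noC] := pselect (exists g, C g /\ g !=set0); last first.
    left; apply/seteqP; split => // p [g Cg gp]; apply: noC.
    by exists g; split => //; exists p.
  right; split; last first.
    exists g => //; have [ge|[]//] := CP _ Cg.
    by move: g0; rewrite ge => -[].
  have good h p : C h -> h p -> dominated_graph h.
    by move=> Ch hp; have [he|[]//] := CP _ Ch; rewrite he in hp.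
  split=> [a p q [h Ch hp] [k Ck kq]|p [h Ch hp]]; last first.
    by have [_] := good _ _ Ch hp; exact.
  have [hk|kh] := Ctot _ _ Ch Ck.
  - by exists k => //; apply: (good _ _ Ck kq).1 => //; exact: hk.
  - by exists h => //; apply: (good _ _ Ch hp).1 => //; exact: kh.
have {Pg} [gd gx0] : dominated_graph g /\ g (x0, rnorm x0).
  case: Pg => [g0|//]; exfalso.
  pose h := [set (of_real a *: x0, a * rnorm x0) | a in [set: R]].
  have hx0 : h (x0, rnorm x0).
    by exists 1 => //; rewrite of_real1 scale1r mul1r.
  apply: (gmax h).
    by rewrite g0; split; [exact: sub0set|move=> /(_ _ hx0)].
  right; split => //; split.
    move=> a _ _ [b _ <-] [c _ <-] /=; exists (a * b + c) => //.
    by rewrite of_realD of_realM scalerDl scalerA mulrDl mulrA.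
  move=> _ [a _ <-] /=; rewrite rnormZ_real.
  by apply: ler_wpM2r; [exact: rnorm_ge0|exact: ler_norm].
have [glin gle] := gd.
have g0 : g (0, 0).
  have := glin (-1) _ _ gx0 gx0.
  by rewrite of_realN of_real1 scaleN1r mulN1r !addNr.
have gZ (a : R) p : g p -> g (of_real a *: p.1, a * p.2).
  by move=> gp; have := glin a _ _ gp g0; rewrite !addr0.
have gtot x : exists r, g (x, r).
  have [c hd] := @dominated_graph_extend g x (ex_intro _ _ g0) gd.
  set h := (X in dominated_graph X) in hd.
  have gh : g `<=` h.
    move=> [p r] gp; exists (p, r) => //; exists 0 => //=.
    by rewrite of_real0 scale0r mul0r !addr0.
  have hx : h (x, c).
    by exists (0, 0) => //; exists 1 => //=; rewrite of_real1 scale1r mul1r !add0r.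
  have [hg|nhg] := pselect (h `<=` g); first by exists c; exact: hg.
  by exfalso; apply: (gmax h); [split|right; split => //; exact: gh].
have guniq x r r' : g (x, r) -> g (x, r') -> r = r'.
  move=> gr gr'.
  have := glin (-1) _ _ gr gr'; have := glin (-1) _ _ gr' gr.
  rewrite !of_realN !of_real1 !scaleN1r !mulN1r /= !addNr => h1 h2.
  have := gle _ h1; have := gle _ h2; rewrite /= rnorm0.
  by move=> ? ?; apply/eqP; rewrite eq_le; apply/andP; split; lra.
pose v x := projT1 (cid (gtot x)).
have gv x : g (x, v x) by rewrite /v; case: cid.
have vE x r : g (x, r) -> v x = r by move=> gr; exact: guniq (gv x) gr.
exists v; split; last exact: vE.
split=> [x y|a x|x].
- apply: vE; have := glin 1 _ _ (gv x) (gv y).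
  by rewrite of_real1 scale1r mul1r.
- by apply: vE; exact: (gZ a _ (gv x)).
- rewrite ler_norml; apply/andP; split; last exact: (gle _ (gv x)).
  have := gle _ (gZ (-1) _ (gv x)) => /=.
  by rewrite of_realN of_real1 scaleN1r mulN1r rnormN; lra.
Qed.

Lemma real_contractionN v x : real_contraction v -> v (- x) = - v x.
Proof.
by move=> [_ vZ _]; have := vZ (-1) x; rewrite of_realN of_real1 scaleN1r mulN1r.
Qed.

Lemma real_contractionB v x y : real_contraction v -> v (x - y) = v x - v y.
Proof. by move=> rv; case: (rv) => vD _ _; rewrite vD real_contractionN. Qed.

End hahn_banach.

Section continuous_functional.
Context {R : realType} {s : scalars}.
Local Notation K := (field_of R s).

Lemma lipschitz_continuous (V W : normedModType K) (f : V -> W) (c : R) :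
  (forall x y, rnorm (f x - f y) <= c * rnorm (x - y)) -> continuous f.
Proof.
move=> fc x; apply/cvgrPdist_le => e e0.
have c0 : 0 < Num.max c 1 by rewrite lt_max ltr01 orbT.
near=> y.
rewrite -of_real_rnorm -(to_realK (ltW e0)) ler_of_real.
apply: (le_trans (fc _ _)); apply: (@le_trans _ _ (Num.max c 1 * rnorm (x - y))).
  by rewrite ler_wpM2r ?rnorm_ge0// le_max lexx.
rewrite mulrC -ler_pdivlMr// -(@ler_of_real R s) of_real_rnorm.
near: y; apply: cvgr_dist_le; first exact: cvg_id.
rewrite of_real_gt0; apply: divr_gt0; [by apply: to_real_gt0|exact: c0].
Unshelve. all: by end_near. Qed.

Lemma linear_lipschitz_continuous (V W : normedModType K) (f : V -> W) (c : R) :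
  linear f -> (forall x, rnorm (f x) <= c * rnorm x) -> continuous f.
Proof.
move=> flin fc; apply: (@lipschitz_continuous _ _ _ c) => x y.
suff -> : f x - f y = f (x - y) by [].
by have := flin (-1) y x; rewrite !scaleN1r [- y + x]addrC [- f y + f x]addrC.
Qed.

Lemma cvgn_rnormP (V : normedModType K) (u : nat -> V) (l : V) :
  (u @ \oo --> l) <->
  forall e : R, 0 < e -> exists N, forall n, (N <= n)%N -> rnorm (l - u n) <= e.
Proof.
split=> [ul e e0|h].
  have e0' : 0 < (of_real e : K) by rewrite of_real_gt0.
  move/cvgrPdist_le : ul => /(_ _ e0')[N _ uN]; exists N => n Nn.
  by have := uN n Nn; rewrite -of_real_rnorm ler_of_real.
apply/cvgrPdist_le => e e0; have [N uN] := h _ (to_real_gt0 e0).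
exists N => // n /= Nn.
by rewrite -of_real_rnorm -(to_realK (ltW e0)) ler_of_real; exact: uN.
Qed.

Lemma rnorm_cauchy_cvgn (V : completeNormedModType K) (u : nat -> V) :
  (forall e : R, 0 < e -> exists N, forall n, (N <= n)%N -> rnorm (u n - u N) <= e) ->
  cvgn u.
Proof.
move=> h; apply/cauchy_cvgP/cauchy_exP => e e0.
have e20 : 0 < to_real e / 2 by rewrite divr_gt0// to_real_gt0.
have [N uN] := h _ e20; exists (u N); exists N => // n /= Nn.
rewrite -ball_normE /= -of_real_rnorm rnormB -(to_realK (ltW e0)).
rewrite lt_neqAle ler_of_real (inj_eq (can_inj (@of_realK R s))) -lt_neqAle.
apply: le_lt_trans (uN n Nn) _; rewrite ltr_pdivrMr// ltr_pMr ?to_real_gt0//.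
by rewrite ltr1n.
Qed.

End continuous_functional.

(** The functional is [v x - i * v (i x)] for a real functional [v] norming [e];
    over the reals it is [v] itself. *)
Lemma exists_bounded_functional (R : realType) (s : scalars)
    (E : normedModType (field_of R s)) (e : E) : e <> 0 ->
  exists h : dual_space E,
    (forall x, rnorm (h x : field_of R s) <= 2 * rnorm x) /\ h e <> 0.
Proof.
move=> e0; have [v [rv ve]] := hahn_banach e.
have ve0 : v e <> 0 by rewrite ve => /rnorm_eq0.
suff [h [hlin hle he]] : exists h : E -> (field_of R s)^o,
    [/\ linear h, forall x, rnorm (h x : field_of R s) <= 2 * rnorm x & h e <> 0].
  have hb : h \in is_bounded_op.
    by apply/asboolP; split => //; exact: linear_lipschitz_continuous hle.
  by exists (BoundedOp hb).
case: rv ve0 => vD vZ vle ve0 {ve}; case: s E e v vD vZ vle ve0 {e0} => E e v vD vZ vle ve0.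
  exists v; split => //; first by move=> a x y; rewrite vD vZ.
  move=> x; apply: (le_trans (vle x)); have := rnorm_ge0 x; lra.
pose ii : R[i] := Complex 0 1.
exists (fun x => Complex (v x) (- v (ii *: x))); split.
- move=> [a b] x y.
  have kE (u : E) : Complex a b *: u = of_real (s := ComplexScalars) a *: u +
      of_real (s := ComplexScalars) b *: (ii *: u).
    rewrite scalerA -scalerDl; congr (_ *: _); apply/eqP.
    by rewrite eq_complex /= !mul0r !mulr0 !mulr1 !(subr0, addr0, add0r) !eqxx.
  have iiE (u : E) : ii *: (ii *: u) = - u.
    rewrite scalerA -scaleN1r; congr (_ *: _); apply/eqP.
    by rewrite eq_complex /= !mul0r !mulr0 !mulr1 !(subr0, addr0, add0r, oppr0) !eqxx.
  have vN u : v (- u) = - v u.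
    by have := vZ (-1) u; rewrite of_realN of_real1 scaleN1r mulN1r.
  rewrite scalerDr scalerA mulrC -scalerA !kE iiE scalerN !vD !vN !vZ.
  by apply/eqP; rewrite eq_complex /=; apply/andP; split; apply/eqP; ring.
- move=> x.
  have -> : Complex (v x) (- v (ii *: x)) = of_real (s := ComplexScalars) (v x) -
      ii * of_real (s := ComplexScalars) (v (ii *: x)) :> R[i].
    by apply/eqP; rewrite eq_complex /=; apply/andP; split; apply/eqP; ring.
  apply: (le_trans (@ler_rnormB R ComplexScalars _ _ _)).
  rewrite (@rnormM R ComplexScalars) !rnorm_of_real.
  have ii1 : @rnorm R ComplexScalars (R[i]) ii = 1.
    by rewrite /rnorm /= expr0n expr1n /= add0r sqrtr1.
  have := vle (ii *: x); rewrite (@rnormZ R ComplexScalars) ii1 !mul1r.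
  by have := vle x; lra.
- by move=> /eqP; rewrite eq_complex /= => /andP[/eqP].
Qed.

(** * Martingales on the binary tree *)

(** The descendants of the node [b] of the binary tree, [j] generations below;
    the latest branching is the head of the list. *)
Fixpoint words (j : nat) (b : seq bool) : seq (seq bool) :=
  if j is j'.+1 then words j' (true :: b) ++ words j' (false :: b) else [:: b].

Definition splits (V : nmodType) (G : seq bool -> V) :=
  forall b, G b = G (true :: b) + G (false :: b).

Lemma sum_words (V : nmodType) (G : seq bool -> V) j b : splits G ->
  \sum_(y <- words j b) G y = G b.
Proof.
move=> Gs; elim: j b => [|j IH] b /=; first by rewrite big_seq1.
by rewrite big_cat /= !IH -Gs.
Qed.

Lemma sum_wordsD (V : nmodType) (G : seq bool -> V) i j b :
  \sum_(x <- words i b) \sum_(y <- words j x) G y = \sum_(y <- words (i + j) b) G y.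
Proof.
elim: i b => [|i IH] b /=; first by rewrite big_seq1.
by rewrite !big_cat /= !IH.
Qed.


Section scalar_martingale.
Context {R : realType}.
Variables (L P : seq bool -> R) (c : R).
Hypotheses (Ls : splits L) (Ps : splits P) (P0 : forall b, 0 <= P b).
Hypothesis LP : forall b, `|L b| <= c * P b.

Let L0 b : P b = 0 -> L b = 0.
Proof.
by move=> Pb; apply/eqP; rewrite -normr_le0; have := LP b; rewrite Pb mulr0.
Qed.

(** Orthogonality of martingale increments. *)
Lemma energy_increment j x :
  \sum_(y <- words j x) (L y - P y / P x * L x) ^+ 2 / P y =
  \sum_(y <- words j x) L y ^+ 2 / P y - L x ^+ 2 / P x.
Proof.
pose r := L x / P x.
have e y : (L y - P y / P x * L x) ^+ 2 / P y =
    L y ^+ 2 / P y - (2 * r * L y - r ^+ 2 * P y).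
  have [Py0|Py0] := eqVneq (P y) 0.
    by rewrite Py0 (L0 Py0) !mul0r !mulr0 subrr expr0n /= !mul0r subr0.
  have -> : P y / P x * L x = P y * r by rewrite /r; ring.
  by rewrite -[in LHS]/r; field.
under eq_bigr do rewrite e.
rewrite sumrB sumrB -!mulr_sumr (sum_words _ _ Ls) (sum_words _ _ Ps); congr (_ - _).
have [Px0|Px0] := eqVneq (P x) 0; first by rewrite /r Px0 (L0 Px0) !mulr0 expr0n /= mul0r subr0.
by rewrite /r; field.
Qed.

(** The energies [\sum_x L x ^+ 2 / P x] increase with the generation and are
    bounded by [c ^+ 2 * P [::]], so their increments tend to [0]; the inequality
    [|w| <= w ^+ 2 / (4 * a * P) + a * P] turns the energy increments into a bound in
    mean. *)
Lemma scalar_oscillation (e : R) : 0 < e ->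
  exists k0, forall k j, (k0 <= k)%N ->
  \sum_(x <- words k [::]) \sum_(y <- words j x) `|L y - P y / P x * L x| <= e.
Proof.
move=> e0; pose Q k := \sum_(x <- words k [::]) L x ^+ 2 / P x.
have c0P b : 0 <= c * P b by apply: le_trans (LP b).
have QB k : Q k <= c ^+ 2 * P [::].
  rewrite /Q -(sum_words k [::] Ps) mulr_sumr; apply: ler_sum => b _.
  have [Pb0|Pb0] := eqVneq (P b) 0; first by rewrite Pb0 (L0 Pb0) expr0n /= mul0r mulr0.
  have Pb : 0 < P b by rewrite lt_def Pb0 P0.
  rewrite ler_pdivrMr// -mulrA -expr2 -exprMn -real_normK ?num_real//.
  by rewrite ler_sqr ?nnegrE.
have Qinc i j : Q (i + j)%N - Q i =
    \sum_(x <- words i [::]) \sum_(y <- words j x) (L y - P y / P x * L x) ^+ 2 / P y.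
  rewrite /Q -sum_wordsD -sumrB; apply: eq_bigr => x _.
  by rewrite energy_increment.
pose a := e / (2 * (P [::] + 1)); pose th := 2 * a * e.
have P1 : 0 < P [::] + 1 by rewrite ltr_wpDl.
have a0 : 0 < a by rewrite /a divr_gt0// mulr_gt0// ltr0n.
have th0 : 0 < th by rewrite /th mulr_gt0// mulr_gt0.
have supQ : has_sup (range Q).
  by split; [exists (Q 0%N); exists 0%N|exists (c ^+ 2 * P [::]) => _ [k _ <-]].
have [_ [k0 _ <-] Qk0] := sup_adherent th0 supQ.
exists k0 => k j k0k.
have Qmon : Q k0 <= Q k.
  rewrite -(subnKC k0k) -subr_ge0 Qinc.
  by do 2![apply: sumr_ge0 => ? _]; rewrite divr_ge0// sqr_ge0.
have Qth : Q (k + j)%N - Q k <= th.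
  have : Q (k + j)%N <= sup (range Q) by apply: sup_upper_bound => //; exists (k + j)%N.
  by lra.
rewrite Qinc in Qth.
apply: (@le_trans _ _ (\sum_(x <- words k [::]) \sum_(y <- words j x)
    ((4 * a)^-1 * ((L y - P y / P x * L x) ^+ 2 / P y) + a * P y))).
  do 2![apply: ler_sum => ? _].
  set y := (X in P X); set w := (X in `|X|).
  have [Py0|Py0] := eqVneq (P y) 0.
    by rewrite /w Py0 (L0 Py0) !mul0r subrr normr0 expr0n /= !mul0r !mulr0 addr0.
  have Py : 0 < P y by rewrite lt_def Py0 P0.
  have -> : (4 * a)^-1 * (w ^+ 2 / P y) + a * P y =
      (`|w| ^+ 2 + (2 * a * P y) ^+ 2) / (4 * a * P y).
    by rewrite real_normK ?num_real//; field; rewrite Py0 gt_eqF.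
  rewrite ler_pdivlMr; last by rewrite mulr_gt0// mulr_gt0.
  by rewrite -subr_ge0 [X in 0 <= X](_ : _ = (`|w| - 2 * a * P y) ^+ 2) ?sqr_ge0//; ring.
under eq_bigr do rewrite big_split /= -!mulr_sumr.
rewrite big_split /= -!mulr_sumr.
under [X in _ + _ * X]eq_bigr do rewrite (sum_words _ _ Ps).
rewrite (sum_words _ _ Ps).
apply: (@le_trans _ _ ((4 * a)^-1 * th + a * P [::])).
  by rewrite lerD2r ler_wpM2l// invr_ge0 mulr_ge0// ltW.
have -> : (4 * a)^-1 * th = e / 2 by rewrite /th; field; rewrite gt_eqF.
have : a * P [::] <= e / 2.
  have -> : a * P [::] = e / 2 * (P [::] / (P [::] + 1)).
    by rewrite /a; field; rewrite gt_eqF.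
  have q1 : P [::] / (P [::] + 1) <= 1 by rewrite ler_pdivrMr// mul1r lerDl.
  have e2 : 0 <= e / 2 by rewrite divr_ge0// ltW.
  by rewrite -[leRHS]mulr1 ler_wpM2l.
by lra.
Qed.

End scalar_martingale.

Section norming_net.
Context {R : realType} {s : scalars} {F : normedModType (field_of R s)}.
Local Notation K := (field_of R s).

(** Coefficients normalised by their l1 norm are rounded to a grid of step
    [1 / q], and each grid point is given a functional that norms it. *)
Lemma finite_norming_real (J : finType) (y : J -> F) (d : R) : 0 < d ->
  exists (I : finType) (v : I -> F -> R), (forall i, real_contraction (v i)) /\
  forall a : J -> R, exists i,
    rnorm (\sum_j of_real (a j) *: y j) <=
    `|v i (\sum_j of_real (a j) *: y j)| + d * \sum_j `|a j|.
Proof.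
move=> d0; pose Y := \sum_j rnorm (y j).
have Y0 : 0 <= Y by apply: sumr_ge0 => j _; exact: rnorm_ge0.
(* Rounding to step [1 / q] moves a normalised combination by at most [d / 2],
   once in the combination and once in the value of the functional. *)
pose q := (Num.truncn (2 * Y / d)).+1.
have q0 : 0 < q%:R :> R by rewrite ltr0n.
have qd : 2 * Y < d * q%:R by rewrite [d * _]mulrC -ltr_pdivrMr// real_truncnS_gt ?num_real.
pose z (a : J -> R) := \sum_j of_real (a j) *: y j.
pose I : finType := {ffun J -> 'I_(2 * q).+1}.
pose g (i : I) j : R := (i j)%:R / q%:R - 1.
have zB a b : rnorm (z a - z b) <= \sum_j `|a j - b j| * rnorm (y j).
  rewrite /z -sumrB; apply: le_trans (ler_rnorm_sum _ _ _) _.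
  by apply: ler_sum => j _; rewrite -scalerBl -of_realB rnormZ_real.
have /choice[v vP] : forall i : I, exists v, real_contraction v /\ v (z (g i)) = rnorm (z (g i)).
  by move=> i; exact: hahn_banach.
exists I, v; split=> [i|a]; first by case: (vP i).
rewrite -/(z a); pose M := \sum_j `|a j|.
have M0 : 0 <= M by apply: sumr_ge0.
have aM j : `|a j| <= M.
  by rewrite /M (bigD1 j)//= lerDl sumr_ge0.
have [Me|MN] := eqVneq M 0.
  exists [ffun=> ord0]; suff -> : z a = 0.
    by rewrite rnorm0 -/M Me mulr0 addr0.
  apply: big1 => j _; have := aM j; rewrite Me normr_le0 => /eqP ->.
  by rewrite of_real0 scale0r.
have Mp : 0 < M by rewrite lt_def MN.
pose t j := (a j / M + 1) * q%:R.
have at1 j : `|a j / M| <= 1.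
  by rewrite normrM normfV (gtr0_norm Mp) ler_pdivrMr// mul1r.
have t0 j : 0 <= t j.
  apply: mulr_ge0; last exact: ltW.
  by have := at1 j; rewrite ler_norml => /andP[]; lra.
have t2 j : (Num.truncn (t j) < (2 * q).+1)%N.
  rewrite ltnS real_truncn_le_nat ?num_real//; apply: le_lt_trans (_ : 2 * q%:R < _); last first.
    by rewrite -natrM ltr_nat.
  by rewrite ler_pM2r//; have := at1 j; rewrite ler_norml => /andP[]; lra.
pose i : I := [ffun j => Ordinal (t2 j)].
exists i.
have close j : `|a j - M * g i j| <= M / q%:R.
  have -> : a j - M * g i j = M / q%:R * (t j - (Num.truncn (t j))%:R).
    by rewrite /g ffunE /= /t; field; rewrite MN gt_eqF.
  have tr : 0 <= t j - (Num.truncn (t j))%:R <= 1.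
    have := truncn_itv (t0 j) => /andP[]; rewrite -natr1; lra.
  case/andP: tr => tr0 tr1.
  have Mq : 0 <= M / q%:R by apply: divr_ge0 => //; exact: ltW.
  by rewrite normrM (ger0_norm tr0) (ger0_norm Mq) -[leRHS]mulr1 ler_wpM2l.
have zg : z (fun j => M * g i j) = of_real M *: z (g i).
  by rewrite /z scaler_sumr; apply: eq_bigr => j _; rewrite of_realM scalerA.
have far : rnorm (z a - of_real M *: z (g i)) <= M * (d / 2).
  rewrite -zg; apply: le_trans (zB _ _) _.
  apply: (@le_trans _ _ (\sum_j M / q%:R * rnorm (y j))).
    by apply: ler_sum => j _; rewrite ler_wpM2r ?rnorm_ge0.
  rewrite -mulr_sumr -/Y -mulrA ler_wpM2l// mulrC ler_pdivrMr//.
  by have := qd; lra.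
have [rv vz] := vP i.
have [vD vZ vle] := rv.
have h1 : rnorm (z a) <= M * rnorm (z (g i)) + M * (d / 2).
  rewrite -[z a](subrK (of_real M *: z (g i))) addrC.
  apply: le_trans (ler_rnormD _ _) _.
  by rewrite rnormZ_real (gtr0_norm Mp) lerD2l.
have h2 : M * rnorm (z (g i)) = v i (of_real M *: z (g i)) by rewrite vZ vz.
have h3 : v i (of_real M *: z (g i)) <= `|v i (z a)| + M * (d / 2).
  have -> : v i (of_real M *: z (g i)) =
      v i (z a) - v i (z a - of_real M *: z (g i)).
    by rewrite (real_contractionB _ _ rv); ring.
  have := vle (z a - of_real M *: z (g i)).
  have := ler_norm (v i (z a)).
  have := ler_norm (- v i (z a - of_real M *: z (g i))); rewrite normrN.
  by move: far; lra.
by rewrite -/M; lra.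
Qed.

End norming_net.

(** Real and imaginary parts, with [ii = 0] over the reals, so that a vector with
    scalar coefficients is a real combination of twice as many vectors. *)
Lemma scalar_coordinates (R : realType) (s : scalars) :
  exists ii : field_of R s, rnorm ii <= 1 /\ forall c : field_of R s, exists a b : R,
    [/\ c = of_real a + of_real b * ii, `|a| <= rnorm c & `|b| <= rnorm c].
Proof.
case: s.
  exists 0; split; first by rewrite rnorm0 ler01.
  move=> c; exists c, 0; split => //; first by rewrite /of_real mul0r addr0.
  by rewrite normr0 rnorm_ge0.
exists (Complex 0 1); split.
  by rewrite /rnorm /= expr0n expr1n /= add0r sqrtr1.
move=> [a b]; exists a, b; split.
- by apply/eqP; rewrite eq_complex /=; apply/andP; split; apply/eqP; ring.
- by rewrite /rnorm /= -sqrtr_sqr ler_wsqrtr// lerDl sqr_ge0.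
- by rewrite /rnorm /= -sqrtr_sqr ler_wsqrtr// lerDr sqr_ge0.
Qed.

(** The coefficient vectors, normalised in l1, form a totally bounded set, so
    finitely many Hahn-Banach functionals norm all the combinations. *)
Lemma finite_norming (R : realType) (s : scalars) (F : normedModType (field_of R s))
    (J : finType) (y : J -> F) (d : R) : 0 < d ->
  exists (I : finType) (v : I -> F -> R), (forall i, real_contraction (v i)) /\
  forall c : J -> field_of R s, exists i,
    rnorm (\sum_j c j *: y j) <=
    `|v i (\sum_j c j *: y j)| + d * \sum_j rnorm (c j).
Proof.
move=> d0; have [ii [ii1 coord]] := scalar_coordinates R s.
pose y' (p : J * bool) := if p.2 then ii *: y p.1 else y p.1.
have d20 : 0 < d / 2 by rewrite divr_gt0.
have [I [v [vc vP]]] := finite_norming_real y' d20.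
exists I, v; split => // c.
have /choice[a aP] : forall j, exists a b : R,
    [/\ c j = of_real a + of_real b * ii, `|a| <= rnorm (c j) & `|b| <= rnorm (c j)].
  by move=> j; exact: coord.
have /choice[b ab] := aP.
pose a' (p : J * bool) := if p.2 then b p.1 else a p.1.
have [i0] := vP a'.
have pairE (V : zmodType) (h : J * bool -> V) :
    \sum_p h p = \sum_j (h (j, true) + h (j, false)).
  rewrite (eq_bigr (fun p => h (p.1, p.2))); last by case.
  rewrite -(pair_bigA _ (fun j k => h (j, k))) /=.
  by apply: eq_bigr => j _; rewrite big_bool.
have -> : \sum_p of_real (a' p) *: y' p = \sum_j c j *: y j.
  rewrite pairE; apply: eq_bigr => j _; rewrite /a' /y' /=.
  by rewrite scalerA -scalerDl; rewrite addrC; case: (ab j) => <-.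
move=> h; exists i0; apply: (le_trans h); rewrite lerD2l.
rewrite pairE -mulrA; apply: ler_wpM2l; first exact: ltW.
rewrite mulrC ler_pdivrMr// mulr_suml.
apply: ler_sum => j _; rewrite /a' /=; case: (ab j) => _.
by have := rnorm_ge0 (c j); lra.
Qed.

(** * Nuclear measures on the tree have vanishing oscillation *)

Section nuclear_oscillation.
Context {R : realType} {s : scalars} {F : normedModType (field_of R s)}.
Local Notation K := (field_of R s).

(** For a tree measure [M] with reference measure [P], the total variation, over
    the [j]-th generation below the [k]-th, of the difference between [M] and
    its density frozen at the [k]-th generation. *)
Definition oscillation (M : seq bool -> F) (P : seq bool -> R) (k j : nat) : R :=
  \sum_(x <- words k [::]) \sum_(y <- words j x)
    rnorm (M y - of_real (P y / P x) *: M x).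

Variables (M : seq bool -> F) (P : seq bool -> R).
Variables (c : nat -> seq bool -> K) (y : nat -> F) (C : nat -> R).
Hypotheses (Ps : splits P) (P0 : forall b, 0 <= P b).
Hypothesis Mc : forall b, (\sum_(n < N) c n b *: y n) @[N --> \oo] --> M b.
Hypothesis cC : forall n k, \sum_(b <- words k [::]) rnorm (c n b) <= C n.
Hypothesis Cy : cvgn (series (fun n => C n * rnorm (y n))).
Hypothesis Mv : forall v, real_contraction v -> forall e : R, 0 < e ->
  exists k0, forall k j, (k0 <= k)%N ->
  \sum_(x <- words k [::]) \sum_(y <- words j x)
    `|v (M y - of_real (P y / P x) *: M x)| <= e.

Let d n x b : K := c n b - of_real (P b / P x) * c n x.

Let sum_d n k j :
  \sum_(x <- words k [::]) \sum_(b <- words j x) rnorm (d n x b) <= 2 * C n.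
Proof.
apply: (@le_trans _ _ (\sum_(x <- words k [::]) \sum_(b <- words j x)
    (rnorm (c n b) + P b / P x * rnorm (c n x)))).
  do 2![apply: ler_sum => ? _]; apply: (le_trans (ler_rnormB _ _)).
  by rewrite lerD2l rnormM rnorm_of_real ger0_norm// divr_ge0.
under eq_bigr do rewrite big_split /= -!mulr_suml (sum_words _ _ Ps).
rewrite big_split /= sum_wordsD mulr_natl mulr2n; apply: lerD; first exact: cC.
apply: le_trans (cC n k); apply: ler_sum => x _.
have [->|Px] := eqVneq (P x) 0; first by rewrite !mul0r rnorm_ge0.
by rewrite divff// mul1r.
Qed.

(** Beyond some [N] the series contributes at most [e / 4] to the oscillation.
    The first [N] terms are normed, up to a small multiple of their coefficients, by
    finitely many functionals [v]; the value of [v] on them differs from its value on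
    the full increment by at most the tail, and the oscillation of [v] of [M] vanishes. *)
Lemma nuclear_oscillation (e : R) : 0 < e ->
  exists k0, forall k j, (k0 <= k)%N -> oscillation M P k j <= e.
Proof.
move=> e0; pose u := series (fun n => C n * rnorm (y n)).
have C0 n : 0 <= C n by apply: le_trans (cC n 0); exact: sumr_ge0 (fun _ _ => rnorm_ge0 _).
have u_nd : nondecreasing_seq u.
  by apply/nondecreasing_seqP => n; rewrite /u seriesSr lerDl mulr_ge0// rnorm_ge0.
have ulim n : u n <= limn u by exact: nondecreasing_cvgn_le.
have e80 : 0 < e / 8 by rewrite divr_gt0.
have [N uN] : exists N, limn u - u N <= e / 8.
  have /cvgrPdist_le/(_ _ e80)[N _ /(_ N (leqnn N)) h] := Cy.
  by exists N; apply: le_trans h; exact: ler_norm.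
pose S x b : F := \sum_(n < N) d n x b *: y n.
pose W x b : F := M b - of_real (P b / P x) *: M x.
have Wlim x b : (\sum_(n < i) d n x b *: y n) @[i --> \oo] --> W x b.
  have -> : (fun i => \sum_(n < i) d n x b *: y n) = (fun i =>
      \sum_(n < i) c n b *: y n - of_real (P b / P x) *: \sum_(n < i) c n x *: y n).
    apply/funext => i; rewrite scaler_sumr -sumrB; apply: eq_bigr => n _.
    by rewrite /d scalerBl scalerA.
  by apply: cvgB; [exact: Mc|apply: cvgZl_tmp; exact: Mc].
have tail k j :
    \sum_(x <- words k [::]) \sum_(b <- words j x) rnorm (W x b - S x b) <= e / 4.
  have lim_tail : (\sum_(x <- words k [::]) \sum_(b <- words j x)
      rnorm (\sum_(n < i) d n x b *: y n - S x b)) @[i --> \oo] -->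
      \sum_(x <- words k [::]) \sum_(b <- words j x) rnorm (W x b - S x b).
    apply: cvg_big => [|x _]; first exact: add_continuous.
    apply: cvg_big => [|b _]; first exact: add_continuous.
    apply: continuous_cvg; first exact: rnorm_continuous.
    by apply: cvgB; [exact: Wlim|exact: cvg_cst].
  apply: (cvgr_to_le lim_tail); exists N => // i /= Ni.
  have SE x b : \sum_(n < i) d n x b *: y n - S x b =
      \sum_(N <= n < i) d n x b *: y n.
    rewrite /S -!(big_mkord xpredT (fun n => d n x b *: y n)).
    by rewrite (big_cat_nat (n := N))//= addrAC subrr add0r.
  apply: (@le_trans _ _ (\sum_(x <- words k [::]) \sum_(b <- words j x)
      \sum_(N <= n < i) rnorm (d n x b) * rnorm (y n))).
    do 2![apply: ler_sum => ? _]; rewrite SE; apply: (le_trans (ler_rnorm_sum _ _ _)).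
    by apply: ler_sum => n _; rewrite rnormZ.
  under eq_bigr do rewrite exchange_big.
  rewrite exchange_big /=.
  apply: (@le_trans _ _ (\sum_(N <= n < i) 2 * (C n * rnorm (y n)))).
    apply: ler_sum => n _; rewrite mulrA.
    under eq_bigr do rewrite -mulr_suml.
    by rewrite -mulr_suml ler_wpM2r ?rnorm_ge0// sum_d.
  rewrite -mulr_sumr -sub_series_geq// -/u.
  by have := ulim i; move: uN; lra.
pose B := \sum_(n < N) C n.
have B0 : 0 <= B by exact: sumr_ge0.
pose de := e / (8 * (B + 1)).
have de0 : 0 < de by rewrite /de divr_gt0// mulr_gt0// ltr_wpDl.
have deB : de * (2 * B) <= e / 4.
  have -> : de * (2 * B) = e / 4 * (B / (B + 1)).
    by rewrite /de; field; rewrite gt_eqF// ltr_wpDl.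
  have e4 : 0 <= e / 4 by rewrite divr_ge0// ltW.
  by rewrite -[leRHS]mulr1 ler_wpM2l// ler_pdivrMr ?ltr_wpDl// mul1r lerDl.
have [I [v [vc vP]]] := finite_norming (fun n : 'I_N => y n) de0.
pose ei := e / (4 * (#|I|%:R + 1)).
have ei0 : 0 < ei by rewrite /ei divr_gt0// mulr_gt0// ltr_wpDl.
have eiI : ei * #|I|%:R <= e / 4.
  have -> : ei * #|I|%:R = e / 4 * (#|I|%:R / (#|I|%:R + 1)).
    by rewrite /ei; field; rewrite gt_eqF// ltr_wpDl.
  have e4 : 0 <= e / 4 by rewrite divr_ge0// ltW.
  by rewrite -[leRHS]mulr1 ler_wpM2l// ler_pdivrMr ?ltr_wpDl// mul1r lerDl.
have /choice[kv kvP] : forall i, exists k0, forall k j, (k0 <= k)%N ->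
    \sum_(x <- words k [::]) \sum_(b <- words j x) `|v i (W x b)| <= ei.
  by move=> i; exact: Mv.
exists (\max_i kv i)%N => k j kk.
apply: (@le_trans _ _ (\sum_(x <- words k [::]) \sum_(b <- words j x)
    (2 * rnorm (W x b - S x b) + \sum_i `|v i (W x b)| +
     de * \sum_(n < N) rnorm (d n x b)))).
  apply: ler_sum => x _; apply: ler_sum => b _; rewrite -/(W x b).
  have [i0] := vP (fun n : 'I_N => d n x b); rewrite -/(S x b) => h.
  have h1 : rnorm (W x b) <= rnorm (W x b - S x b) + rnorm (S x b).
    by rewrite -{1}(subrK (S x b) (W x b)) ler_rnormD.
  have h2 : `|v i0 (S x b)| <= `|v i0 (W x b)| + rnorm (W x b - S x b).
    have -> : S x b = W x b - (W x b - S x b) by rewrite subKr.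
    rewrite (real_contractionB _ _ (vc i0)); apply: (le_trans (ler_normB _ _)).
    by rewrite subKr lerD2l; case: (vc i0).
  have h3 : `|v i0 (W x b)| <= \sum_i `|v i (W x b)|.
    by rewrite (bigD1 i0)//= lerDl sumr_ge0.
  by lra.
under eq_bigr do rewrite !big_split /= -!mulr_sumr.
rewrite !big_split /= -!mulr_sumr.
have h1 := tail k j.
have h2 : \sum_(x <- words k [::]) \sum_(b <- words j x) \sum_i `|v i (W x b)| <= e / 4.
  under eq_bigr do rewrite exchange_big.
  rewrite exchange_big /=; apply: le_trans eiI.
  rewrite mulr_natr -sumr_const; apply: ler_sum => i _; apply: kvP.
  by apply: leq_trans kk; exact: leq_bigmax.
have h3 : de * (\sum_(x <- words k [::]) \sum_(b <- words j x)
    \sum_(n < N) rnorm (d n x b)) <= e / 4.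
  apply: le_trans deB; rewrite ler_wpM2l//; first exact: ltW.
  under eq_bigr do rewrite exchange_big.
  by rewrite exchange_big mulr_sumr; apply: ler_sum => n _; exact: sum_d.
by lra.
Qed.

End nuclear_oscillation.

(** * The variation of a vector measure *)

Section vector_measure.
Context {R : realType} {S : Type} {V : zmodType}.
Variables (Sigma : set (set S)) (N : V -> \bar R) (m : set S -> V).
Hypothesis Sigma0 : Sigma set0.
Hypothesis N_ge0 : forall x, (0 <= N x)%E.
Hypothesis ND : forall x y, (N (x + y)%R <= N x + N y)%E.
Hypothesis NN : forall x, N (- x) = N x.
Hypothesis N_eq0 : forall x, (N x <= 0)%E -> x = 0.
Hypothesis mca : countably_additive Sigma N m.

(** Two consecutive partial sums of the constant sequence [set0] differ by
    [m set0]. *)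
Lemma countably_additive0 : m set0 = 0.
Proof.
apply: N_eq0.
have triv0 : trivIset [set: nat] (fun=> set0 : set S).
  by apply/trivIsetP => i j _ _ _; rewrite setI0.
have := mca (fun=> Sigma0) triv0; rewrite bigcup0// => h.
have h1 : (fun n => N (m set0 - \sum_(k < n.+1) m set0)%R) @ \oo --> (0 : \bar R)%E.
  by have := h; rewrite -(cvg_shiftS _).
have h2 := @cvgeD _ _ _ _ _ _ _ _ _ h h1; rewrite adde0 in h2.
apply: (cvge_to_ge (h2 _ isT)); apply: nearW => n.
rewrite big_ord_recr /=; set s := (X in m set0 - X).
have {1}-> : m set0 = (m set0 - s) - (m set0 - (s + m set0)).
  by rewrite opprB addrK subrK.
by apply: le_trans (ND _ _) _; rewrite NN.
Qed.

(** Pad the two sets with empty ones. *)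
Lemma countably_additiveU A B : Sigma A -> Sigma B -> A `&` B = set0 ->
  m (A `|` B) = m A + m B.
Proof.
move=> SA SB AB; apply/subr0_eq/N_eq0.
have SAB n : Sigma (bigcup2 A B n) by case: n => [|[|n]].
have tAB : trivIset setT (bigcup2 A B).
  by apply/trivIsetP => -[|[|i]] [|[|j]] //= _ _ _; rewrite ?setI0 ?set0I// setIC.
have := mca SAB tAB; rewrite bigcup2E => h.
apply: (cvge_to_ge h); near=> n.
have n2 : (1 < n)%N by near: n; exists 2%N.
rewrite -(big_mkord xpredT (fun k => m (bigcup2 A B k))).
rewrite big_ltn ?(ltn_trans _ n2)// big_ltn//= big_nat big1 ?addr0//.
by move=> [|[|k]] // _; exact: countably_additive0.
Unshelve. all: by end_near. Qed.

Local Notation var := (vector_variation Sigma N m).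

Lemma le_vector_variation A : Sigma A -> (N (m A) <= var A)%E.
Proof.
move=> SA; apply: ereal_sup_ubound; exists 1%N, (fun=> A); split => //.
- by apply/trivIsetP => i j _ _; rewrite (ord1 i) (ord1 j) eqxx.
- by apply/seteqP; split => [t [] //|t At]; exists ord0.
- by rewrite big_ord1.
Qed.

Lemma vector_variation_ge0 A : Sigma A -> (0 <= var A)%E.
Proof. by move=> SA; apply: le_trans (le_vector_variation SA). Qed.

(** Partitions of [A] and of [B] concatenate to one of the union.  A set without
    partition has variation [-oo], whence the case analysis. *)
Lemma vector_variation_superadd A B : A `&` B = set0 ->
  (var A + var B <= var (A `|` B))%E.
Proof.
move=> AB.
have key n (P : 'I_n -> set S) k (Q : 'I_k -> set S) :
    (forall i, Sigma (P i)) -> trivIset setT P -> \bigcup_i P i = A ->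
    (forall i, Sigma (Q i)) -> trivIset setT Q -> \bigcup_i Q i = B ->
    (\sum_(i < n) N (m (P i)) + \sum_(i < k) N (m (Q i)) <= var (A `|` B))%E.
  move=> SP tP PA SQ tQ QB; apply: ereal_sup_ubound.
  pose W (i : 'I_(n + k)) := match fintype.split i with inl j => P j | inr j => Q j end.
  have WL j : W (lshift k j) = P j by rewrite /W (fintype.unsplitK (inl j)).
  have WR j : W (rshift n j) = Q j by rewrite /W (fintype.unsplitK (inr j)).
  have PQ i j : P i `&` Q j = set0.
    by apply/disj_set2P/disj_setPS; rewrite -AB -PA -QB; apply: setISS => t ?; [exists i|exists j].
  exists (n + k)%N, W; split.
  - by move=> i; rewrite /W; case: fintype.split.
  - apply/trivIsetP => i j _ _ ij; rewrite -(fintype.splitK i) -(fintype.splitK j) in ij *.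
    case: (fintype.split i) (fintype.split j) ij => i' [] j' /= ij; rewrite ?WL ?WR ?PQ// 1?setIC ?PQ//.
    + by rewrite setIC; move/trivIsetP : tP; apply => //; apply: contra ij => /eqP ->.
    + by rewrite setIC; move/trivIsetP : tQ; apply => //; apply: contra ij => /eqP ->.
  - apply/seteqP; split=> [t [i _]|t].
      by rewrite /W -PA -QB; case: fintype.split => j ?; [left|right]; exists j.
    rewrite -PA -QB => -[[j _ ?]|[j _ ?]].
      by exists (lshift k j) => //; rewrite WL.
    by exists (rshift n j) => //; rewrite WR.
  - rewrite big_split_ord /=; congr (_ + _)%E; apply: eq_bigr => i _.
      by rewrite WL.
    by rewrite WR.
have [->|vy] := eqVneq (var (A `|` B)) +oo%E; first exact: leey.
have [->|vA] := eqVneq (var A) -oo%E; first by rewrite leNye.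
have [->|vB] := eqVneq (var B) -oo%E; first by rewrite addeC leNye.
have fin n (P : 'I_n -> set S) : (\sum_(i < n) N (m (P i)) <= var (A `|` B))%E ->
    (\sum_(i < n) N (m (P i)))%E \is a fin_num.
  move=> h; rewrite ge0_fin_numE; last exact: sume_ge0.
  by apply: (le_lt_trans h); rewrite ltey.
have step k (Q : 'I_k -> set S) :
    (forall i, Sigma (Q i)) -> trivIset setT Q -> \bigcup_i Q i = B ->
    (var A + \sum_(i < k) N (m (Q i)) <= var (A `|` B))%E.
  move=> SQ tQ QB.
  have [n [P [SP tP PA]]] : exists n (P : 'I_n -> set S),
      [/\ forall i, Sigma (P i), trivIset setT P & \bigcup_i P i = A].
    apply: contrapT => h; move/eqP : vA; apply; apply/ereal_sup_ninfty.
    by move=> z [n [P [SP tP PA _]]]; exfalso; apply: h; exists n, P.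
  have Qf : (\sum_(i < k) N (m (Q i)))%E \is a fin_num.
    apply: fin; apply: le_trans (key _ _ _ _ SP tP PA SQ tQ QB).
    by rewrite leeDr// sume_ge0.
  rewrite -leeBrDr//; apply: ge_ereal_sup => _ [n' [P' [SP' tP' PA' ->]]].
  by rewrite leeBrDr//; exact: key.
have Af : var A \is a fin_num.
  rewrite fin_numE vA /=; apply: contra vy => /eqP vA'.
  have [k [Q [SQ tQ QB]]] : exists n (P : 'I_n -> set S),
      [/\ forall i, Sigma (P i), trivIset setT P & \bigcup_i P i = B].
    apply: contrapT => h; move/eqP : vB; apply; apply/ereal_sup_ninfty.
    by move=> z [n [P [SP tP PA _]]]; exfalso; apply: h; exists n, P.
  have Q0 : (\sum_(i < k) N (m (Q i)) != -oo)%E.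
    by rewrite -ltNye; apply: lt_le_trans (sume_ge0 _ _).
  by have := step _ _ SQ tQ QB; rewrite vA' addye// leye_eq.
rewrite addeC -leeBrDr//; apply: ge_ereal_sup => _ [k [Q [SQ tQ QB ->]]].
by rewrite leeBrDr// addeC; exact: step.
Qed.

Hypothesis Sigma_setD : forall A B, Sigma A -> Sigma B -> Sigma (B `\` A).

Lemma le_vector_variation_sub A B : Sigma A -> Sigma B -> A `<=` B ->
  (var A <= var B)%E.
Proof.
move=> SA SB AB; rewrite -(setDUK AB).
apply: le_trans (vector_variation_superadd _); last by rewrite setDIK.
by rewrite leeDl// vector_variation_ge0//; exact: Sigma_setD.
Qed.


End vector_measure.

Section enorm.
Context {R : realType} {s : scalars} {V : normedModType (field_of R s)}.
Local Open Scope ereal_scope.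

Lemma enorm_ge0 (x : V) : 0 <= enorm x.
Proof. by rewrite lee_fin rnorm_ge0. Qed.

Lemma enormD (x y : V) : enorm (x + y)%R <= enorm x + enorm y.
Proof. by rewrite lee_fin ler_rnormD. Qed.

Lemma enormN (x : V) : enorm (- x)%R = enorm x.
Proof. by rewrite /enorm rnormN. Qed.

Lemma enorm_eq0 (x : V) : enorm x <= 0 -> x = 0%R.
Proof.
by rewrite lee_fin => x0; apply/rnorm_eq0/eqP; rewrite eq_le x0 rnorm_ge0.
Qed.

Lemma enorm_sum (I : Type) (r : seq I) (x : I -> V) :
  enorm (\sum_(i <- r) x i)%R <= \sum_(i <- r) enorm (x i).
Proof. by rewrite sumEFin lee_fin ler_rnorm_sum. Qed.

End enorm.

Section variation_measure.
Context {R : realType} {s : scalars} {F : normedModType (field_of R s)}.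
Context {d : measure_display} {S : measurableType d}.
Variable m : set S -> F.
Hypothesis mca : countably_additive (@measurable d S) enorm m.
Hypothesis mbv : has_bounded_variation (@measurable d S) enorm m.
Local Open Scope ereal_scope.
Local Notation var := (vector_variation (@measurable d S) enorm m).

(** The supremum is [-oo] on the sets which have no measurable partition, hence
    the truncation at [0]. *)
Definition variation (A : set S) : \bar R := maxe 0 (var A).

Lemma variationE A : measurable A -> variation A = var A.
Proof.
move=> mA; apply/max_idPr/vector_variation_ge0 => //; exact: enorm_ge0.
Qed.

Lemma variation_ge0 A : 0 <= variation A.
Proof. by rewrite le_max lexx. Qed.

Lemma le_variation A : measurable A -> enorm (m A) <= variation A.
Proof. by move=> mA; rewrite variationE//; exact: le_vector_variation. Qed.

Lemma variation0 : variation set0 = 0.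
Proof.
have m0 : m set0 = 0%R.
  exact: countably_additive0 measurable0 enormD enormN enorm_eq0 mca.
apply/eqP; rewrite eq_le variation_ge0 andbT ge_max lexx /=.
apply: ge_ereal_sup => _ [n [P [_ _ P0 ->]]]; rewrite big1// => i _.
suff -> : P i = set0 by rewrite m0 /enorm rnorm0.
by apply/seteqP; split => // t Pt; rewrite -P0; exists i.
Qed.

Lemma variationU A B : measurable A -> measurable B -> A `&` B = set0 ->
  variation A + variation B <= variation (A `|` B).
Proof.
move=> mA mB AB; rewrite !variationE//; last exact: measurableU.
by apply: vector_variation_superadd => // x; exact: enorm_ge0.
Qed.

Lemma le_variation_sub A B : measurable A -> measurable B -> A `<=` B ->
  variation A <= variation B.
Proof.
move=> mA mB AB; rewrite -(setDUK AB).
apply: le_trans (variationU _ _ _); rewrite ?setDIK//; last exact: measurableD.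
by rewrite leeDl// variation_ge0.
Qed.

Let enorm_bigcup (B : nat -> set S) : (forall k, measurable (B k)) ->
  trivIset setT B -> enorm (m (\bigcup_k B k)) <= \sum_(k <oo) enorm (m (B k)).
Proof.
move=> mB tB; set C := \sum_(k <oo) _.
have [->|Cy] := eqVneq C +oo; first exact: leey.
have C0 : 0 <= C by apply: nneseries_ge0 => k _ _; exact: enorm_ge0.
have Cf : C \is a fin_num by rewrite ge0_fin_numE// ltey.
have h : enorm (m (\bigcup_k B k) - \sum_(k < n) m (B k))%R + C @[n --> \oo] --> 0 + C.
  apply: cvgeD; [|exact: mca|exact: cvg_cst].
  by rewrite ge0_adde_def ?inE.
rewrite add0e in h; apply: (cvge_to_ge h); apply: nearW => n.
rewrite -{1}(subrK (\sum_(k < n) m (B k))%R (m (\bigcup_k B k))).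
apply: (le_trans (enormD _ _)); rewrite leeD2l//; apply: (le_trans (enorm_sum _ _)).
rewrite -(big_mkord xpredT (fun k => enorm (m (B k)))).
by apply: nneseries_lim_ge => k _ _; exact: enorm_ge0.
Qed.

(** Superadditivity bounds the partial sums.  Conversely a partition of the union
    is cut by the [B k]: countable additivity bounds each piece by a series, and the
    two sums are exchanged. *)
Lemma variation_sigma_additive : semi_sigma_additive variation.
Proof.
move=> B mB tB mUB.
have fin_le n : \sum_(0 <= k < n) variation (B k) <= variation (\bigcup_k B k).
  apply: (@le_trans _ _ (variation (\bigcup_(k < n) B k))).
    elim: n => [|n IH]; first by rewrite big_geq// variation_ge0.
    rewrite big_nat_recr//= bigcup_mkord big_ord_recr /= -bigcup_mkord.
    apply: le_trans (variationU _ _ _) => //; first by rewrite leeD2r.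
      by apply: bigcup_measurable => k _.
    rewrite setI_bigcupl bigcup0// => k /= kn.
    by move/trivIsetP : tB; apply => //; rewrite ltn_eqF.
  apply: le_variation_sub => //; last exact: bigcup_sub (fun k _ => bigcup_sup _).
  by apply: bigcup_measurable => k _.
suff -> : variation (\bigcup_k B k) = \sum_(k <oo) variation (B k).
  by apply: is_cvg_nneseries => k _ _; exact: variation_ge0.
apply/eqP; rewrite eq_le; apply/andP; split; last first.
  apply: lime_le; last exact: nearW.
  by apply: is_cvg_nneseries => k _ _; exact: variation_ge0.
rewrite variationE//; apply: ge_ereal_sup => _ [n [P [mP tP PB ->]]].
apply: (@le_trans _ _ (\sum_(i < n) \sum_(k <oo) enorm (m (P i `&` B k)))).
  apply: lee_sum => i _.
  have {1}-> : P i = \bigcup_k (P i `&` B k).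
    by rewrite -setI_bigcupr -PB; apply/esym/setIidPl => t Pt; exists i.
  apply: enorm_bigcup; first by move=> k; exact: measurableI.
  exact: trivIset_setIl.
rewrite -nneseries_sum; last by move=> *; exact: enorm_ge0.
apply: lee_nneseries => [k _ _|k _]; first by apply: sume_ge0 => ? _; exact: enorm_ge0.
rewrite variationE//; apply: ereal_sup_ubound; exists n, (fun i => P i `&` B k); split => //.
- by move=> i; exact: measurableI.
- exact: trivIset_setIr.
- rewrite -setI_bigcupl PB; apply/setIidPr => t Bt.
  by exists k.
Qed.

HB.instance Definition _ := isMeasure.Build d S R variation
  variation0 variation_ge0 variation_sigma_additive.

Let variation_finite : fin_num_fun variation.
Proof.
move=> A mA; rewrite ge0_fin_numE ?variation_ge0//.
apply: le_lt_trans (le_variation_sub mA measurableT (@subsetT _ _)) _.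
by rewrite variationE.
Qed.

HB.instance Definition _ := Measure_isFinite.Build d S R variation variation_finite.

Lemma variation_dominates : exists nu : {finite_measure set S -> \bar R},
  (forall A, measurable A -> enorm (m A) <= nu A) /\
  (forall (mu : {finite_measure set S -> \bar R}),
     (forall A, measurable A -> mu A = 0 -> m A = 0%R) ->
     forall A, measurable A -> mu A = 0 -> nu A = 0).
Proof.
exists variation; split; first exact: le_variation.
move=> mu ac A mA A0; apply/eqP; rewrite eq_le variation_ge0 andbT /=.
rewrite variationE//; apply: ge_ereal_sup => _ [n [P [mP tP PA ->]]].
rewrite big1// => i _; rewrite ac// /enorm ?rnorm0//.
apply: (subset_measure0 (mP i) mA _ A0) => t Pt; rewrite -PA.
by exists i.
Qed.

End variation_measure.

(** * Partitions generated by finite lists of sets *)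

Section cells.
Context {S : Type}.
Implicit Types (A B : set S) (r t : seq (set S)).

(** The atoms cut out of [A] by the sets of [r], kept as a list so that refining
    a partition is concatenating lists; empty atoms occur and are harmless. *)
Fixpoint cells r A : seq (set S) :=
  if r is B :: r' then cells r' (A `&` B) ++ cells r' (A `\` B) else [:: A].

Lemma cellsI r A B : cells r (A `&` B) = [seq A `&` C | C <- cells r B].
Proof.
elim: r B => //= C r IH B.
by rewrite map_cat -!IH setIA -setIDA.
Qed.

Lemma cellsE r A : cells r A = [seq A `&` C | C <- cells r setT].
Proof. by rewrite -cellsI setIT. Qed.

End cells.

Section measurable_cells.
Context {d : measure_display} {S : measurableType d}.
Implicit Types (A B : set S) (r t : seq (set S)).

Definition measurable_list r : Prop := forall B, B \in r -> measurable B.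

Lemma measurable_list_cons B r :
  measurable_list (B :: r) -> measurable B /\ measurable_list r.
Proof.
move=> mr; split; first by apply: mr; rewrite mem_head.
by move=> C Cr; apply: mr; rewrite in_cons Cr orbT.
Qed.

Lemma measurable_list_cat r t :
  measurable_list r -> measurable_list t -> measurable_list (r ++ t).
Proof. by move=> mr mt B; rewrite mem_cat => /orP[/mr|/mt]. Qed.

Lemma measurable_cells r A x :
  measurable_list r -> measurable A -> x \in cells r A -> measurable x.
Proof.
elim: r A => [|B r IH] A /=; first by move=> _ mA; rewrite inE => /eqP ->.
move=> /measurable_list_cons[mB mr] mA; rewrite mem_cat => /orP[|]; apply: IH => //.
  exact: measurableI.
exact: measurableD.
Qed.

Lemma sum_cells (V : nmodType) (G : set S -> V) r A :
  (forall A B, measurable A -> measurable B -> G A = G (A `&` B) + G (A `\` B)) ->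
  measurable_list r -> measurable A -> \sum_(x <- cells r A) G x = G A.
Proof.
move=> Ga; elim: r A => [|B r IH] A /=; first by rewrite big_seq1.
move=> /measurable_list_cons[mB mr] mA; rewrite big_cat /= !IH//.
- by rewrite -Ga.
- exact: measurableD.
- exact: measurableI.
Qed.

Lemma le_sum_cells (R : numDomainType) (G H : set S -> R) r A :
  (forall x, measurable x -> G x <= H x) ->
  measurable_list r -> measurable A ->
  \sum_(x <- cells r A) G x <= \sum_(x <- cells r A) H x.
Proof.
move=> GH mr mA; rewrite big_seq [leRHS]big_seq; apply: ler_sum => x xr.
exact/GH/(measurable_cells mr mA xr).
Qed.

End measurable_cells.

(** * Densities from approximate densities *)

Section additive.
Context {d : measure_display} {S : measurableType d}.

Definition additive_set (V : nmodType) (m : set S -> V) : Prop :=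
  forall A B, measurable A -> measurable B -> m A = m (A `&` B) + m (A `\` B).

End additive.

Section step_functions.
Context {R : realType} {s : scalars} {F : normedModType (field_of R s)}.
Context {d : measure_display} {S : measurableType d}.
Variable mu : {finite_measure set S -> \bar R}.

Definition mass (A : set S) : R := fine (mu A).

Lemma mass_ge0 A : 0 <= mass A. Proof. by rewrite fine_ge0. Qed.

Lemma massE A : measurable A -> (mass A)%:E = mu A.
Proof. by move=> mA; rewrite fineK// fin_num_measure. Qed.

Lemma additive_mass : additive_set mass.
Proof.
move=> A B mA mB; apply: EFin_inj; rewrite EFinD !massE//.
- rewrite addeC; apply: (@measureDI _ _ _ mu) => //.
- exact: measurableD.
- exact: measurableI.
Qed.

Lemma le_mass A B : measurable A -> measurable B -> A `<=` B -> mass A <= mass B.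
Proof.
by move=> mA mB AB; rewrite -lee_fin !massE// le_measure ?inE.
Qed.

Definition cell_oscillation (m : set S -> F) (r t : seq (set S)) : R :=
  \sum_(x <- cells r setT) \sum_(y <- cells t x)
    rnorm (m y - of_real (mass y / mass x) *: m x).

(** Step functions as lists, which can be concatenated and subtracted; the sets
    may overlap. *)
Definition step := seq (set S * F).

Definition step_fun (f : step) (t : S) : F := \sum_(p <- f | t \in p.1) p.2.

Definition step_integral (f : step) (A : set S) : F :=
  \sum_(p <- f) of_real (mass (A `&` p.1)) *: p.2.

Definition measurable_step (f : step) := measurable_list (unzip1 f).

(** The density frozen on the cells of [r]. *)
Definition averages (m : set S -> F) (r : seq (set S)) : step :=
  [seq (x, of_real (mass x)^-1 *: m x) | x <- cells r setT].

(** Both sides are sums over the common refinement of [r] and [t]; the left-hand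
    one takes norms after grouping the cells of [r]. *)
Lemma averages_error (m : set S -> F) r t :
  additive_set m -> measurable_list r -> measurable_list t ->
  \sum_(z <- cells t setT) rnorm (m z - step_integral (averages m r) z) <=
  cell_oscillation m r t.
Proof.
move=> ma mr mt.
apply: (@le_trans _ _ (\sum_(z <- cells t setT) \sum_(x <- cells r setT)
    rnorm (m (x `&` z) - of_real (mass (x `&` z) / mass x) *: m x))).
  apply: le_sum_cells => // z mz.
  have -> : m z = \sum_(x <- cells r setT) m (x `&` z).
    rewrite -{1}(setTI z) -(sum_cells (G := fun x => m (x `&` z)) (r := r))//.
    move=> A B mA mB; rewrite (ma (A `&` z) B)//; last exact: measurableI.
    by congr (m _ + m _); rewrite ?setDE setIAC.
  rewrite /step_integral /averages big_map -sumrB.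
  apply: le_trans (ler_rnorm_sum _ _ _) _; apply: ler_sum => x _ /=.
  by rewrite scalerA -of_realM [z `&` x]setIC.
rewrite exchange_big /=; apply: ler_sum => x _.
by rewrite (cellsE t x) big_map.
Qed.

Lemma step_fun_cons B v (f : step) t :
  step_fun ((B, v) :: f) t = (if t \in B then v else 0) + step_fun f t.
Proof. by rewrite /step_fun big_cons /=; case: ifP => //; rewrite add0r. Qed.

(** Cutting [A] by the first set of the list absorbs the first value into the
    constant [x]. *)
Lemma integral_step (f : step) A x : measurable_step f -> measurable A ->
  measurable_fun A (fun t => enorm (x + step_fun f t)) /\
  (\int[mu]_(t in A) enorm (x + step_fun f t) =
   \sum_(z <- cells (unzip1 f) A)
     (rnorm (of_real (mass z) *: x + step_integral f z))%:E)%E.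
Proof.
elim: f A x => [|[B v] f IH] A x.
  move=> _ mA; have e : (fun t : S => enorm (x + step_fun [::] t)) = cst (enorm x).
    by apply/funext => t; rewrite /step_fun big_nil addr0.
  rewrite e; split; first exact: measurable_cst.
  rewrite integral_cst//= big_seq1 /step_integral big_nil addr0 rnormZ_real.
  by rewrite ger0_norm ?mass_ge0// mulrC EFinM massE.
move=> /measurable_list_cons[/= mB mf] mA.
have mAB : measurable (A `&` B) by exact: measurableI.
have mADB : measurable (A `\` B) by exact: measurableD.
have [m1 i1] := IH _ (x + v) mf mAB.
have [m2 i2] := IH _ x mf mADB.
have e1 : {in A `&` B, (fun t => enorm (x + v + step_fun f t)) =1
    (fun t => enorm (x + step_fun ((B, v) :: f) t))}.
  move=> t; rewrite inE => -[At Bt].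
  by rewrite step_fun_cons mem_set// addrA.
have e2 : {in A `\` B, (fun t => enorm (x + step_fun f t)) =1
    (fun t => enorm (x + step_fun ((B, v) :: f) t))}.
  move=> t; rewrite inE => -[At Bt].
  by rewrite step_fun_cons memNset// add0r.
have {}m1 := eq_measurable_fun _ e1 m1.
have {}m2 := eq_measurable_fun _ e2 m2.
have AE : A = (A `&` B) `|` (A `\` B) by rewrite setUIDK.
have mA' : measurable_fun A (fun t => enorm (x + step_fun ((B, v) :: f) t)).
  by rewrite AE; apply/measurable_funU.
split => //; rewrite {1}AE ge0_integral_setU//; last 3 first.
- by rewrite -AE.
- by move=> t _; exact: enorm_ge0.
- by apply/disj_set2P; rewrite setDE setIACA setICr setI0.
rewrite -(eq_integral _ _ e1) -(eq_integral _ _ e2) i1 i2 /= big_cat /=.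
congr (_ + _)%E; rewrite cellsE !big_map; apply: eq_bigr => z _; congr (rnorm _)%:E.
  rewrite /step_integral big_cons /= scalerDr -addrA; congr (_ + (_ *: _ + _)).
  congr (of_real (mass _)); apply/esym/setIidl => t [[]] //.
rewrite /step_integral big_cons /=.
have -> : (A `\` B) `&` z `&` B = set0 by apply/seteqP; split => // t [[[_ nBt] _] Bt].
by rewrite /mass measure0 /= of_real0 scale0r add0r.
Qed.

End step_functions.

(** The integral of a non-negative function is a supremum over the simple
    functions below it, so it is monotone without measurability. *)
Lemma ge0_le_integral_nonmeasurable (R : realType) (d : measure_display)
    (S : measurableType d) (mu : {measure set S -> \bar R}) (f g : S -> \bar R) :
  (forall t, 0 <= f t)%E -> (forall t, f t <= g t)%E ->
  (\int[mu]_t f t <= \int[mu]_t g t)%E.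
Proof.
move=> f0 fg; rewrite !ge0_integralTE//; last by move=> t; exact: le_trans (fg t).
apply: ereal_sup_le => _ [h hf <-]; exists h => // t.
exact: le_trans (fg t).
Qed.

Lemma cvge0_small (R : realType) (f : nat -> \bar R) : f @ \oo --> 0%E ->
  forall e : R, 0 < e -> exists N, forall n, (N <= n)%N -> (f n <= e%:E)%E.
Proof.
move=> /fine_cvgP[[N1 _ h1] h e e0].
have /cvgrPdist_le/(_ _ e0)[N2 _ h2] := h.
exists (maxn N1 N2) => n; rewrite geq_max => /andP[n1 n2].
rewrite -(fineK (h1 _ n1)) lee_fin.
by have := h2 _ n2; rewrite /= sub0r normrN; apply: le_trans; exact: ler_norm.
Qed.

Section density.
Context {R : realType} {s : scalars} {F : completeNormedModType (field_of R s)}.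
Context {d : measure_display} {S : measurableType d}.
Variable mu : {finite_measure set S -> \bar R}.
Local Notation simple := (simple_function (@measurable d S) F).

Lemma step_set_measurable (f : step) : measurable_step f ->
  forall i, measurable (tnth (in_tuple f) i : set S * F).1.
Proof. by move=> mf i; apply: mf; apply/map_f/mem_tnth. Qed.

Definition simple_of_step (f : step) (mf : measurable_step f) : simple :=
  Simple (fun i => (tnth (in_tuple f) i).2) (step_set_measurable mf).

Lemma simple_of_stepE (f : step) (mf : measurable_step f) t :
  simple_fun (simple_of_step mf) t = step_fun f t.
Proof. by rewrite /step_fun big_tnth. Qed.

Lemma simple_of_step_integral (f : step) (mf : measurable_step f) A :
  simple_integral (fun B (y : F) => of_real (fine (mu (A `&` B))) *: y)
    (simple_of_step mf) = step_integral mu f A.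
Proof. by rewrite /step_integral big_tnth. Qed.

Lemma step_diff (f g : @step R s F d S) : measurable_step f -> measurable_step g ->
  exists h : step, [/\ measurable_step h,
    forall t, step_fun h t = step_fun g t - step_fun f t &
    forall A, step_integral mu h A = step_integral mu g A - step_integral mu f A].
Proof.
move=> mf mg; exists (g ++ [seq (p.1, - p.2) | p <- f]); split.
- rewrite /measurable_step /unzip1 map_cat -map_comp; exact: measurable_list_cat.
- by move=> t; rewrite /step_fun big_cat big_map /= sumrN.
- move=> A; rewrite /step_integral big_cat big_map /= -sumrN; congr (_ + _).
  by apply: eq_bigr => p _; rewrite scalerN.
Qed.

Variables (m : set S -> F) (f : nat -> @step R s F d S).
Hypothesis mf : forall n, measurable_step (f n).
Hypothesis fm : forall n t, measurable_list t ->
  \sum_(z <- cells t setT) rnorm (m z - step_integral mu (f n) z) <= (2 ^+ n.+1)^-1.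

Local Open Scope ereal_scope.

Let a n t : \bar R := enorm (step_fun (f n.+1) t - step_fun (f n) t)%R.

Let a_ge0 n t : 0 <= a n t. Proof. exact: enorm_ge0. Qed.

Let a_int n : measurable_fun setT (a n) /\
  \int[mu]_t a n t <= (2 / 2 ^+ n.+1)%:E.
Proof.
have [h [mh hE hI]] := step_diff (@mf n) (@mf n.+1).
have aE : a n = (fun t => enorm (0 + step_fun h t)%R).
  by apply/funext => t; rewrite /a hE add0r.
have [ma ia] := integral_step mu 0%R mh measurableT.
split; rewrite aE// ia sumEFin lee_fin.
apply: (@le_trans _ _ ((2 ^+ n.+2)^-1 + (2 ^+ n.+1)^-1)%R); last first.
  have p : (0 < (2 ^+ n.+1)^-1 :> R)%R by rewrite invr_gt0 exprn_gt0.
  by rewrite [in X in (X + _)%R]exprS invfM; lra.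
apply: le_trans (lerD (fm n.+1 mh) (fm n mh)).
rewrite -big_split /=; apply: ler_sum => z _.
rewrite scaler0 add0r hI.
set u := step_integral _ _ _; set v := step_integral _ _ _.
rewrite [X in (rnorm X <= _)%R](_ : _ = - (m z - u) + (m z - v))%R; last first.
  by rewrite opprB addrA subrK.
by apply: le_trans (ler_rnormD _ _) _; rewrite rnormN.
Qed.

Let h n t := \sum_(n <= k <oo) a k t.

Let hE n t : h n t = \sum_(k <oo) a (k + n)%N t.
Proof. by rewrite /h -(@nneseries_addn _ (fun k => a k t)). Qed.

Let h_ge0 n t : 0 <= h n t. Proof. exact: nneseries_ge0. Qed.

Let mh n : measurable_fun setT (h n).
Proof.
rewrite (_ : h n = fun t => \sum_(k <oo | k \in predT) a (k + n)%N t); last first.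
  by apply/funext => t; rewrite hE.
apply: ge0_emeasurable_sum => [k x _ _|k _]; first exact: a_ge0.
by have [] := a_int (k + n)%N.
Qed.

Let h_int n : \int[mu]_t h n t <= (2 * (2^-1) ^+ n)%:E.
Proof.
under eq_integral do rewrite hE.
rewrite integral_nneseries//; last by move=> k; have [] := a_int (k + n)%N.
have e0 : (0 <= 2 * 2^-1 ^+ n :> R)%R by rewrite mulr_ge0// exprn_ge0// invr_ge0.
apply: le_trans (epsilon_trick0 xpredT e0).
apply: lee_nneseries => [k _ _|k _]; first by apply: integral_ge0.
have [_] := a_int (k + n)%N; move/le_trans; apply.
rewrite lee_fin -addSn exprD natrX exprVn.
set u := (2 ^+ k.+1)%R; set v := (2 ^+ n)%R.
have u0 : u != 0%R by rewrite /u expf_neq0.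
have v0 : v != 0%R by rewrite /v expf_neq0.
by rewrite (_ : 2 * v^-1 / u = 2 / (u * v))%R //; field; rewrite u0 v0.
Qed.

Let h_ae : {ae mu, forall t, h 0%N t < +oo}.
Proof.
have : mu.-integrable setT (h 0%N).
  apply/integrableP; split; first exact: mh.
  under eq_integral do rewrite gee0_abs//.
  by apply: le_lt_trans (h_int 0) _; rewrite ltry.
move=> /(integrable_ae measurableT); apply: filterS => t /(_ I).
by rewrite ge0_fin_numE.
Qed.

Let telescope n k t : (n <= k)%N ->
  enorm (step_fun (f k) t - step_fun (f n) t)%R <= h n t.
Proof.
move=> nk; apply: (@le_trans _ _ (\sum_(n <= i < k) a i t)); last first.
  exact: nneseries_lim_ge.
move: nk => /subnK <-; elim: (k - n)%N => [|j IH].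
  by rewrite add0n subrr /enorm rnorm0 big_geq.
rewrite addSn big_nat_recr ?leq_addl//= addeC; apply: le_trans (leeD2l _ IH).
rewrite /a -(subrKA (step_fun (f (j + n)%N) t)); exact: enormD.
Qed.

Let h_small t : h 0%N t < +oo -> forall e : R, (0 < e)%R ->
  exists N, forall n, (N <= n)%N -> h n t <= e%:E.
Proof.
move=> ht e e0.
by apply: cvge0_small e0; exact: nneseries_tail_cvg.
Qed.

Let g t : F := if h 0%N t < +oo then limn (fun n => step_fun (f n) t) else 0%R.

Let g_lim t : h 0%N t < +oo -> step_fun (f n) t @[n --> \oo] --> g t.
Proof.
move=> ht; rewrite /g ht; apply: rnorm_cauchy_cvgn => e e0.
have [N hN] := h_small ht e0; exists N => n Nn.
by rewrite -lee_fin; exact: le_trans (telescope t Nn) (hN _ (leqnn N)).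
Qed.

Let g_le n t : enorm (g t - step_fun (f n) t)%R <= h n t.
Proof.
have [ht|ht] := boolP (h 0%N t < +oo); last first.
  suff -> : h n t = +oo by exact: leey.
  have fin : \sum_(0 <= k < n) a k t < +oo.
    by rewrite lte_sum_pinfty// => k _; rewrite ltry.
  apply/eqP; rewrite -leye_eq leNgt; apply: contra ht => hn.
  rewrite /h (nneseries_split 0 n)// add0n; exact: lte_add_pinfty.
have [->|hy] := eqVneq (h n t) +oo; first exact: leey.
have hf : h n t \is a fin_num by rewrite ge0_fin_numE// ltey.
rewrite -(fineK hf) lee_fin.
have lim : rnorm (step_fun (f k) t - step_fun (f n) t)%R @[k --> \oo] -->
    rnorm (g t - step_fun (f n) t)%R.
  apply: continuous_cvg; first exact: rnorm_continuous.
  by apply: cvgB; [exact: g_lim|exact: cvg_cst].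
apply: (cvgr_to_le lim); exists n => // k /= nk.
by rewrite -lee_fin fineK//; exact: telescope.
Qed.

Let approx : bochner_approximation mu (fun n => simple_of_step (@mf n)) g.
Proof.
split.
  apply: filterS h_ae => t ht.
  by under eq_fun do rewrite simple_of_stepE; exact: g_lim.
apply: (@squeeze_cvge _ _ _ _ (cst 0) _ (fun n => (2 * 2^-1 ^+ n)%:E)).
- apply: nearW => n; rewrite integral_ge0 => [/=|t _]; last exact: enorm_ge0.
  apply: le_trans (h_int n); apply: ge0_le_integral_nonmeasurable => t.
    exact: enorm_ge0.
  by rewrite simple_of_stepE.
- exact: cvg_cst.
- apply: cvg_EFin; first exact: nearW.
  rewrite -[X in _ --> X](mulr0 2%R); apply: cvgMr.
  by apply: cvg_expr; rewrite ger0_norm ?invr_ge0// invf_lt1// ltr1n.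
Qed.

(** Consecutive step functions are at most [2 / 2 ^+ n.+1] apart in mean, so their
    increments are summable almost everywhere; the sum [h n] of the increments after
    [n] dominates the distance from the [n]-th function to the limit. *)
Lemma density_of_approximations :
  exists g : S -> F, [/\ strongly_measurable mu g, bochner_integrable mu g
    & forall A, measurable A -> is_bochner_integral mu A g (m A)].
Proof.
exists g; split.
- by exists (fun n => simple_of_step (@mf n)); case: approx.
- by exists (fun n => simple_of_step (@mf n)).
move=> A mA; exists (fun n => simple_of_step (@mf n)); split => //.
apply/cvgn_rnormP => e e0.
have : (2^-1 ^+ n : R)%R @[n --> \oo] --> (0 : R)%R.
  by apply: cvg_expr; rewrite ger0_norm ?invr_ge0// invf_lt1// ltr1n.
move=> /cvgrPdist_le/(_ _ e0)[N _ hN]; exists N => n Nn.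
rewrite simple_of_step_integral.
have mA1 : measurable_list [:: A] by move=> B; rewrite inE => /eqP ->.
have := fm n mA1; rewrite /= big_cons big_seq1 setTI => h1.
have := hN _ Nn; rewrite /= sub0r normrN ger0_norm ?exprn_ge0 ?invr_ge0// => h2.
apply: le_trans h2; apply: (@le_trans _ _ ((2 ^+ n.+1)^-1)%R).
  by apply: le_trans h1; rewrite lerDl rnorm_ge0.
rewrite exprVn exprS invfM ler_piMl ?invr_ge0 ?exprn_ge0//.
by rewrite invf_le1 ?ler1n.
Qed.

End density.

(** * A measure without density oscillates along a sequence of sets *)

Section cell.
Context {S : Type} (A : nat -> set S).

(** The node [b] of the tree: the bits of [b], read from the last one, choose
    between the sets [A 0], [A 1], ... and their complements. *)
Fixpoint cell (b : seq bool) : set S :=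
  if b is c :: b' then
    if c then cell b' `&` A (size b') else cell b' `\` A (size b')
  else setT.

Lemma cells_words j b :
  cells [seq A i | i <- iota (size b) j] (cell b) = [seq cell y | y <- words j b].
Proof.
elim: j b => //= j IH b; rewrite map_cat.
by rewrite -(IH (true :: b)) -(IH (false :: b)).
Qed.

Lemma size_words j b y : y \in words j b -> size y = (size b + j)%N.
Proof.
elim: j b => [|j IH] b /=; first by rewrite inE addn0 => /eqP ->.
by rewrite mem_cat => /orP[/IH|/IH] ->; rewrite addnS.
Qed.

End cell.

Section oscillating_sequence.
Context {R : realType} {s : scalars} {F : completeNormedModType (field_of R s)}.
Context {d : measure_display} {S : measurableType d}.
Variables (mu : {finite_measure set S -> \bar R}) (m : set S -> F).
Hypothesis mca : countably_additive (@measurable d S) enorm m.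
Hypothesis mac : forall A, measurable A -> mu A = 0%E -> m A = 0.

Lemma additive_of_countably_additive : additive_set m.
Proof.
move=> A B mA mB; rewrite -[X in m X = _](setUIDK A B).
apply: (countably_additiveU measurable0 enormD enormN enorm_eq0 mca).
- exact: measurableI.
- exact: measurableD.
- by rewrite setDE setIACA setICr setI0.
Qed.

Lemma mass_eq0 A : measurable A -> mass mu A = 0 -> m A = 0.
Proof. by move=> mA A0; apply: mac => //; rewrite -massE// A0. Qed.

(** Otherwise the averages over partitions with oscillation at most [1 / 2 ^+ n.+1]
    would produce a density. *)
Lemma no_density_oscillation :
  ~ (exists g : S -> F, [/\ strongly_measurable mu g, bochner_integrable mu g
    & forall A, measurable A -> is_bochner_integral mu A g (m A)]) ->
  exists e : R, 0 < e /\ forall r, measurable_list r ->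
    exists t, measurable_list t /\ e < cell_oscillation mu m r t.
Proof.
move=> nog; apply: contrapT => h; apply: nog.
have : forall n, exists r, measurable_list r /\ forall t, measurable_list t ->
    cell_oscillation mu m r t <= (2 ^+ n.+1)^-1.
  move=> n; apply: contrapT => hn; apply: h; exists (2 ^+ n.+1)^-1; split.
    by rewrite invr_gt0 exprn_gt0.
  move=> r mr; apply: contrapT => hr; apply: hn; exists r; split => // t mt.
  by rewrite leNgt; apply/negP => ht; apply: hr; exists t.
move=> /choice[r rP].
apply: (@density_of_approximations _ _ _ _ _ _ _ (fun n => averages mu m (r n))).
  move=> n B; rewrite /unzip1 -map_comp map_id; apply: measurable_cells measurableT.
  by case: (rP n).
move=> n t mt; have [mr rt] := rP n; apply: le_trans (rt t mt).
exact: averages_error additive_of_countably_additive mr mt.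
Qed.

Lemma cell_oscillation_nil r : measurable_list r -> cell_oscillation mu m r [::] = 0.
Proof.
move=> mr; rewrite /cell_oscillation big_seq big1// => x xr; rewrite /= big_seq1.
have mx := measurable_cells mr measurableT xr.
have [x0|x0] := eqVneq (mass mu x) 0.
  by rewrite (mass_eq0 mx x0) scaler0 subr0 rnorm0.
by rewrite divff// of_real1 scale1r subrr rnorm0.
Qed.

Lemma measurable_cell (A : nat -> set S) b :
  (forall k, measurable (A k)) -> measurable (cell A b).
Proof.
move=> mA; elim: b => [|[] b IH] /=; first exact: measurableT.
- exact: measurableI.
- exact: measurableD.
Qed.

(** Starting from the empty list, a refinement that exhibits the oscillation is
    appended again and again; the sets [A k] are the entries of the resulting infinite
    list. *)
Lemma oscillating_sequence (e : R) : 0 < e ->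
  (forall r, measurable_list r ->
    exists t, measurable_list t /\ e < cell_oscillation mu m r t) ->
  exists A : nat -> set S, (forall k, measurable (A k)) /\
    forall k0, exists k j, (k0 <= k)%N /\
      e < oscillation (fun b => m (cell A b)) (fun b => mass mu (cell A b)) k j.
Proof.
move=> e0 h.
have /choice[T TP] : forall r : seq (set S), exists t, measurable_list r ->
    measurable_list t /\ e < cell_oscillation mu m r t.
  move=> r; have [mr|nr] := pselect (measurable_list r); last by exists [::].
  by have [t tP] := h r mr; exists t.
pose u n := iter n (fun r => r ++ T r) [::].
have mu_ n : measurable_list (u n).
  elim: n => [|n IH] /=; first by move=> B.
  by apply: measurable_list_cat => //; case: (TP _ IH).
have sT n : (0 < size (T (u n)))%N.
  rewrite lt0n size_eq0; apply/eqP => T0; have [_] := TP _ (mu_ n).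
  by rewrite T0 cell_oscillation_nil// ltNge ltW.
have su n : (n <= size (u n))%N.
  elim: n => //= n IH; rewrite size_cat -addn1.
  exact: leq_add.
have pre n k : exists w, u (n + k)%N = u n ++ w.
  elim: k => [|k [w IH]]; first by exists [::]; rewrite addn0 cats0.
  by exists (w ++ T (u (n + k)%N)); rewrite addnS /= IH catA.
pose A i := nth setT (u i.+1) i.
have uA n : u n = [seq A i | i <- iota 0 (size (u n))].
  apply: (@eq_from_nth _ setT); first by rewrite size_map size_iota.
  move=> i i_n; rewrite (nth_map 0%N) ?size_iota// nth_iota// add0n /A.
  have [ni|ni] := leqP n i.+1.
    by have [w] := pre n (i.+1 - n)%N; rewrite subnKC// => ->; rewrite nth_cat i_n.
  have [w] := pre i.+1 (n - i.+1)%N; rewrite subnKC ?(ltnW ni)// => ->.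
  by rewrite nth_cat su.
exists A; split.
  move=> k; apply: mu_ (k.+1) _ _; apply: mem_nth; exact: su.
move=> k0; exists (size (u k0)), (size (T (u k0))); split; first exact: su.
have [_] := TP _ (mu_ k0); congr (_ < _).
have TA : T (u k0) = [seq A i | i <- iota (size (u k0)) (size (T (u k0)))].
  have := uA k0.+1; rewrite /= size_cat iotaD map_cat -uA add0n.
  by move/eqP; rewrite eqseq_cat// => /andP[_ /eqP].
rewrite /cell_oscillation /oscillation.
have := cells_words A (size (u k0)) [::]; rewrite -uA => ->.
rewrite big_map big_seq [RHS]big_seq; apply: eq_bigr => x xw.
have := size_words xw; rewrite add0n => sx.
have := cells_words A (size (T (u k0))) x; rewrite sx -TA => ->.
by rewrite big_map.
Qed.

End oscillating_sequence.

Section weak_oscillation.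
Context {R : realType} {s : scalars} {F : normedModType (field_of R s)}.
Context {d : measure_display} {S : measurableType d}.
Variables (mu nu : {finite_measure set S -> \bar R}) (m : set S -> F).
Hypothesis ma : additive_set m.
Hypothesis mnu : forall A, measurable A -> (enorm (m A) <= nu A)%E.
Hypothesis numu : forall A, measurable A -> mu A = 0%E -> nu A = 0%E.

(** [H] is a sublevel set of the Radon-Nikodym density of [nu] with respect to
    [mu]; the superlevel sets shrink to a null set. *)
Lemma bounded_density (e : R) : 0 < e ->
  exists (c : R) (H : set S), [/\ 0 <= c, measurable H, (nu (~` H) <= e%:E)%E &
    forall A, measurable A -> A `<=` H -> mass nu A <= c * mass mu A].
Proof.
move=> e0.
have ac : nu `<< mu by apply/null_content_dominatesP => A mA /(numu mA).
have [h [h0 hfin hint hnu]] := radon_nikodym_sigma_finite ac.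
have mh : measurable_fun setT h by case/integrableP : hint.
pose H n := [set t | (h t <= n%:R%:E)%E].
have mH n : measurable (H n).
  by rewrite -[H n]setTI; exact: emeasurable_fun_infty_c.
have : nu (~` H n) @[n --> \oo] --> nu (\bigcap_n ~` H n).
  apply: nonincreasing_cvg_mu.
  - by rewrite ltey_eq fin_num_measure//; exact: measurableC.
  - by move=> n; exact: measurableC.
  - by apply: bigcapT_measurable => n; exact: measurableC.
  - move=> i j ij; apply/subsetPset => t; apply: contra_not => /=.
    by move=> /le_trans; apply; rewrite lee_fin ler_nat.
have -> : \bigcap_n ~` H n = set0.
  apply/seteqP; split => // t /= hH; apply: (hH (Num.truncn (fine (h t))).+1) => //.
  by rewrite /H /= -(fineK (hfin t)) lee_fin ltW// real_truncnS_gt// num_real.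
rewrite measure0 => /cvge0_small/(_ _ e0)[N hN].
exists N%:R, (H N); split => //; first exact: hN.
move=> A mA AH; rewrite -lee_fin EFinM !massE// hnu//.
apply: (@le_trans _ _ (\int[mu]_(x in A) (cst N%:R%:E x))%E); last first.
  by rewrite integral_cst.
apply: ge0_le_integral => //.
exact: measurable_funTS.
Qed.

(** On [H] the measure [v] of [m] is bounded by a multiple of [mu], so its
    martingale has vanishing oscillation; off [H] its total mass is at most [e / 4],
    counted once at each of the two generations. *)
Lemma weak_oscillation (A : nat -> set S) (v : F -> R) :
  (forall k, measurable (A k)) -> real_contraction v -> forall e : R, 0 < e ->
  exists k0, forall k j, (k0 <= k)%N ->
  \sum_(x <- words k [::]) \sum_(y <- words j x)
    `|v (m (cell A y) -
         of_real (mass mu (cell A y) / mass mu (cell A x)) *: m (cell A x))| <= e.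
Proof.
move=> mA rv e e0; have e40 : 0 < e / 4 by rewrite divr_gt0.
have [c [H [c0 mH Hc hH]]] := bounded_density e40.
have [vD vZ vle] := rv.
pose P b := mass mu (cell A b).
have mcell b : measurable (cell A b) by exact: measurable_cell.
have mC : measurable (~` H) by exact: measurableC.
have splitG (V : nmodType) (G : set S -> V) : additive_set G ->
    splits (fun b => G (cell A b)).
  by move=> Ga b /=; exact: Ga.
have splitI (V : nmodType) (G : set S -> V) B : measurable B -> additive_set G ->
    splits (fun b => G (cell A b `&` B)).
  move=> mB Ga; apply: (splitG _ (fun x => G (x `&` B))) => X Y mX mY.
  rewrite (Ga (X `&` B) Y) ?measurableI//; last exact: measurableI.
  by congr (G _ + G _); rewrite ?setDE setIAC.
have nuA : additive_set (mass nu) by exact: additive_mass.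
have vm B : measurable B -> `|v (m B)| <= mass nu B.
  by move=> mB; apply: le_trans (vle _) _; rewrite -lee_fin massE// mnu.
have vma : additive_set (v \o m) by move=> X Y mX mY /=; rewrite (ma mX mY) vD.
pose L b := v (m (cell A b `&` H)); pose L' b := v (m (cell A b `&` ~` H)).
have Ls : splits L by exact: (splitI _ (v \o m)).
have Ps : splits P by exact: splitG (additive_mass mu).
have P0 b : 0 <= P b by exact: mass_ge0.
have LP b : `|L b| <= c * P b.
  have mI : measurable (cell A b `&` H) by exact: measurableI.
  apply: le_trans (vm _ mI) _; apply: le_trans (hH _ mI (@subIsetr _ _ _)) _.
  by apply: ler_wpM2l => //; exact: le_mass.
have e20 : 0 < e / 2 by rewrite divr_gt0.
have [k0 hk0] := scalar_oscillation Ls Ps P0 LP e20.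
exists k0 => k j k0k; have := hk0 k j k0k => {hk0} hL.
have sumL' i : \sum_(y <- words i [::]) `|L' y| <= e / 4.
  apply: (@le_trans _ _ (\sum_(y <- words i [::]) mass nu (cell A y `&` ~` H))).
    by apply: ler_sum => y _; apply: vm; exact: measurableI.
  by rewrite (sum_words _ _ (splitI _ _ _ mC nuA)) /= setTI -lee_fin massE.
have vE y : v (m (cell A y)) = L y + L' y.
  by rewrite /L /L' (ma (mcell y) mH) vD setDE.
apply: (@le_trans _ _ (\sum_(x <- words k [::]) \sum_(y <- words j x)
    (`|L y - P y / P x * L x| + (`|L' y| + P y / P x * `|L' x|)))).
  do 2![apply: ler_sum => ? _]; rewrite (real_contractionB _ _ rv) vZ !vE.
  set r := _ / _; rewrite mulrDr opprD addrACA.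
  apply: (le_trans (ler_normD _ _)); rewrite lerD2l.
  apply: (le_trans (ler_normB _ _)); rewrite lerD2l normrM ger0_norm//.
  by apply: divr_ge0; exact: mass_ge0.
under eq_bigr do rewrite big_split /= big_split /= -!mulr_suml (sum_words _ _ Ps).
rewrite big_split /= big_split /= sum_wordsD.
have h1 := sumL' (k + j)%N.
have h2 : \sum_(x <- words k [::]) P x / P x * `|L' x| <= e / 4.
  apply: le_trans (sumL' k); apply: ler_sum => x _.
  have [->|Px] := eqVneq (P x) 0; first by rewrite !mul0r.
  by rewrite divff// mul1r.
by lra.
Qed.

End weak_oscillation.

(** * Coding a sequence of sets by a map to the unit interval *)

Section unit_interval.
Context {R : realType}.
Local Notation Omega := (unit_interval R).

Definition ival (t : Omega) : R := set_val t.

Lemma ival_ge0 t : 0 <= ival t.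
Proof. by have := set_valP t; rewrite /= in_itv /= => /andP[]. Qed.

Lemma ival_le1 t : ival t <= 1.
Proof. by have := set_valP t; rewrite /= in_itv /= => /andP[]. Qed.

Lemma ival_continuous : continuous ival.
Proof. exact: initial_continuous. Qed.

Definition to_unit (x : R) (x01 : 0 <= x <= 1) : Omega :=
  exist _ x (mem_set (x01 : (`[0, 1]%classic : set R) x)).

Lemma ival_ball t e t' : ball t e t' = (`|ival t - ival t'| < e) :> Prop.
Proof. by []. Qed.

(** The covering form of compactness, with the mesh [1 / n.+1] as a parameter. *)
Lemma uniform_continuity {s : scalars} (V : normedModType (field_of R s))
    (f : Omega -> V) (e : R) : continuous f -> 0 < e ->
  exists N, forall n t t', (N <= n)%N -> `|ival t - ival t'| <= n.+1%:R^-1 ->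
    rnorm (f t - f t') <= e.
Proof.
move=> cf e0.
have := @unit_interval_compact R; rewrite compact_near_coveringP => cov.
pose P n t := forall t',
  `|ival t - ival t'| <= n.+1%:R^-1 -> rnorm (f t - f t') <= e.
suff cP x : [set: Omega] x -> \forall x' \near x & n \near \oo, P n x'.
  have [N _ hN] := cov nat \oo P _ cP.
  by exists N => n t t' Nn; exact: (hN n Nn t I).
move=> _.
have e20 : 0 < e / 2 by rewrite divr_gt0.
have : \forall t \near x, rnorm (f x - f t) <= e / 2.
  have e2K : 0 < (of_real (e / 2) : field_of R s) by rewrite of_real_gt0.
  have /cvgrPdist_le/(_ _ e2K) := cf x.
  by apply: filterS => t; rewrite -of_real_rnorm ler_of_real.
move=> /nbhs_ballP[r /= r0 rx].
exists ([set t | ball x (r / 2) t], [set n : nat | n.+1%:R^-1 < r / 2]).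
  split; first by apply: nbhsx_ballx; rewrite divr_gt0.
  have r20 : 0 < r / 2 by rewrite divr_gt0.
  exists (Num.truncn (r / 2)^-1) => // n /= hn.
  rewrite invf_plt ?posrE//.
  apply: lt_le_trans (real_truncnS_gt _) _; first exact: num_real.
  by rewrite ler_nat ltnS.
move=> [t n] [/= xt nr] t' tt'.
have xt' : ball x r t'.
  move: xt; rewrite !ival_ball => xt.
  rewrite -(subrKA (ival t)); apply: (le_lt_trans (ler_normD _ _)).
  by move: nr tt' xt; move: (n.+1%:R^-1 : R) => u; lra.
have xtr : ball x r t by move: xt; rewrite !ival_ball; lra.
rewrite -(subrKA (f x)) [f t - f x + _]addrC.
apply: (le_trans (ler_rnormD _ _)); have := rx _ xt'; have := rx _ xtr.
by rewrite [rnorm (f t - f x)]rnormB /=; lra.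
Qed.

End unit_interval.

Section coding.
Context {R : realType} {d : measure_display} {S : measurableType d}.
Variable A : nat -> set S.
Hypothesis mA : forall k, measurable (A k).
Local Notation Omega := (unit_interval R).

Let bit k x : R := (x \in A k)%:R.

(** Base-4 digits restricted to [0] and [2]: the gaps make each digit a
    continuous function of the number on the range of the coding. *)
Definition digits k n x : R := \sum_(j < n) 2 * bit (k + j) x / 4 ^+ j.+1.

Lemma digits_le k n x : digits k n x <= 2 / 3 * (1 - 4^-1 ^+ n).
Proof.
elim: n => [|n IH]; first by rewrite /digits big_ord0 expr0 subrr mulr0.
rewrite /digits big_ord_recr /= -/(digits k n x) exprVn.
have b1 : bit (k + n) x <= 1 by rewrite /bit; case: (_ \in _).
rewrite exprVn exprS invfM in IH *.
have p : 0 < (4 ^+ n)^-1 :> R by rewrite invr_gt0 exprn_gt0.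
have : bit (k + n) x * (4 ^+ n)^-1 <= (4 ^+ n)^-1.
  by rewrite -[leRHS]mul1r ler_wpM2r// ltW.
by set u := (4 ^+ n)^-1 in p IH *; lra.
Qed.

Lemma digits_nd k x : nondecreasing_seq (digits k ^~ x).
Proof.
apply/nondecreasing_seqP => n; rewrite /digits big_ord_recr /= lerDl.
by rewrite divr_ge0 ?exprn_ge0// mulr_ge0.
Qed.

Definition code k x : R := limn (digits k ^~ x).

Lemma code_cvg k x : digits k n x @[n --> \oo] --> code k x.
Proof.
apply: nondecreasing_is_cvgn; first exact: digits_nd.
exists (2 / 3) => _ [n _ <-]; apply: le_trans (digits_le k n x) _.
by rewrite ler_piMr// gerBl exprn_ge0.
Qed.

Lemma code_ge0 k x : 0 <= code k x.
Proof.
apply: (cvgr_to_ge (@code_cvg k x)); apply: nearW => n.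
by apply: sumr_ge0 => j _; rewrite divr_ge0 ?exprn_ge0// mulr_ge0.
Qed.

Lemma code_le k x : code k x <= 2 / 3.
Proof.
apply: (cvgr_to_le (@code_cvg k x)); apply: nearW => n.
apply: le_trans (digits_le k n x) _.
by rewrite ler_piMr// gerBl exprn_ge0.
Qed.

Lemma codeS k x : code k x = (2 * bit k x + code k.+1 x) / 4.
Proof.
have h : digits k n.+1 x @[n --> \oo] --> code k x.
  by rewrite (cvg_shiftS (digits k ^~ x)); exact: code_cvg.
apply: (cvg_unique _ h) => //.
have -> : (fun n => digits k n.+1 x) = (fun n => (2 * bit k x + digits k.+1 n x) / 4).
  apply/funext => n; rewrite /digits big_ord_recl /= addn0 expr1.
  rewrite (mulrDl (2 * bit k x)); congr (_ + _).
  rewrite mulr_suml; apply: eq_bigr => j _.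
  by rewrite /bump leq0n add1n addnS addSn [4 ^+ j.+2]exprSr invfM mulrA.
by apply: cvgMl; apply: cvgD; [exact: cvg_cst|exact: code_cvg].
Qed.

Lemma code01 x : 0 <= code 0 x <= 1.
Proof. by rewrite code_ge0 (le_trans (code_le _ _))// ler_pdivrMr// mul1r ler_nat. Qed.

Definition coding x : Omega := to_unit (code01 x).

(** A continuous function which is [0] up to [1 / 6] and [1] from [1 / 2] on: the
    codes with leading digit [0] lie below [1 / 6], those with leading digit [2] above
    [1 / 2]. *)
Definition clamp (t : R) : R := Num.max 0 (Num.min 1 (3 * t - 2^-1)).

Lemma clamp_continuous : continuous clamp.
Proof.
move=> t; rewrite /clamp.
have -> : (fun t : R => Num.max 0 (Num.min 1 (3 * t - 2^-1))) =
    (cst 0 : R -> R^o) \max ((cst 1 : R -> R^o) \min (fun t : R => 3 * t - 2^-1)) by [].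
apply: continuous_max; first exact: cvg_cst.
apply: continuous_min; first exact: cvg_cst.
by apply: cvgB; [apply: cvgMr; exact: cvg_id|exact: cvg_cst].
Qed.

Lemma clamp01 t : 0 <= clamp t <= 1.
Proof. by rewrite /clamp le_max lexx ge_max ler01 ge_min lexx. Qed.

Lemma clamp1 t : 2^-1 <= t -> clamp t = 1.
Proof.
move=> t2; rewrite /clamp; have /min_idPl -> : 1 <= 3 * t - 2^-1 by lra.
exact/max_idPr.
Qed.

Lemma clamp0 t : t <= 6^-1 -> clamp t = 0.
Proof.
move=> t6; rewrite /clamp; apply/max_idPl; rewrite ge_min; apply/orP; right.
by lra.
Qed.

(** The [k]-fold shift of the base-4 expansion; each step removes the leading
    digit. *)
Fixpoint remainder k (t : R) : R :=
  if k is k'.+1 then 4 * remainder k' t - 2 * clamp (remainder k' t) else t.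

Definition digit k (t : R) : R := clamp (remainder k t).

Lemma remainder_continuous k : continuous (remainder k).
Proof.
elim: k => [|k IH] t /=; first exact: cvg_id.
apply: cvgB; apply: cvgMr; first exact: IH.
by apply: (@continuous_comp _ _ _ (remainder k) clamp); [exact: IH|exact: clamp_continuous].
Qed.

Lemma digit_continuous k : continuous (digit k).
Proof.
move=> t; apply: (@continuous_comp _ _ _ (remainder k) clamp).
  exact: remainder_continuous.
exact: clamp_continuous.
Qed.

Lemma clamp_code k x : clamp (code k x) = bit k x.
Proof.
have := codeS k x; have := code_ge0 k.+1 x; have := code_le k.+1 x.
rewrite /bit; case: (x \in A k) => h1 h2 h3.
- by apply: clamp1; rewrite h3 ?mulr1 ?mulr0; lra.
- by apply: clamp0; rewrite h3 ?mulr1 ?mulr0; lra.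
Qed.

Lemma digit_code k x : digit k (code 0 x) = (x \in A k)%:R.
Proof.
rewrite /digit; suff -> : remainder k (code 0 x) = code k x by exact: clamp_code.
by elim: k => //= k ->; rewrite clamp_code; have := codeS k x; lra.
Qed.

Lemma measurable_code k : measurable_fun setT (code k).
Proof.
apply/measurable_EFinP.
apply: (emeasurable_fun_cvg (fun n x => (digits k n x)%:E)).
  move=> n; apply/measurable_EFinP; apply: measurable_sum => j.
  apply: measurable_funM; last exact: measurable_cst.
  apply: measurable_funM; first exact: measurable_cst.
  exact: measurable_indic.
by move=> x _; apply: cvg_EFin; [exact: nearW|exact: code_cvg].
Qed.

(** The sets with measurable preimage form a sigma-algebra containing the open
    sets. *)
Lemma measurable_coding B : borel B -> measurable (coding @^-1` B).
Proof.
move=> bB; apply: (bB [set B | measurable (coding @^-1` B)]); split.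
  split.
  - by rewrite /= preimage_set0.
  - move=> C /= mC; rewrite setTD -preimage_setC; exact: measurableC.
  - by move=> C mC /=; rewrite preimage_bigcup; exact: bigcupT_measurable.
move=> U /= [W oW <-]; rewrite -comp_preimage.
have := @measurable_code 0 measurableT W (open_measurable oW).
by rewrite setTI.
Qed.

End coding.

(** * Integration of simple functions *)

Section borel.
Context {T : topologicalType}.

Lemma borel_open (U : set T) : open U -> borel U.
Proof. by move=> oU; exact: sub_gen_smallest. Qed.

Lemma borel0 : borel (@set0 T).
Proof. by have [] := @smallest_sigma_algebra T setT [set U | open U]. Qed.

Lemma borelC (B : set T) : borel B -> borel (~` B).
Proof.
have [_ h _] := @smallest_sigma_algebra T setT [set U | open U].
by move=> /h; rewrite setTD.
Qed.

Lemma borel_bigcup (B : nat -> set T) :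
  (forall n, borel (B n)) -> borel (\bigcup_n B n).
Proof. by have [_ _] := @smallest_sigma_algebra T setT [set U | open U]; exact. Qed.

Lemma borelT : borel [set: T].
Proof. by rewrite -setC0; apply: borelC; exact: borel0. Qed.

Lemma borelU (B C : set T) : borel B -> borel C -> borel (B `|` C).
Proof.
move=> bB bC; rewrite -bigcup2E; apply: borel_bigcup => -[|[|n]] //=.
exact: borel0.
Qed.

Lemma borelI (B C : set T) : borel B -> borel C -> borel (B `&` C).
Proof.
by move=> bB bC; rewrite -(setCK (B `&` C)) setCI; apply: borelC; apply: borelU; exact: borelC.
Qed.

Lemma borelD (B C : set T) : borel B -> borel C -> borel (B `\` C).
Proof. by move=> bB bC; rewrite setDE; apply: borelI => //; exact: borelC. Qed.

Lemma borel_closed (C : set T) : closed C -> borel C.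
Proof. by move=> cC; rewrite -(setCK C); apply: borelC; apply: borel_open; exact: closed_openC. Qed.

End borel.

Section partition_of_unity.
Context {R : realType}.
Local Notation Omega := (unit_interval R).

(** The continuous partition of unity of the generation [size b], made of products
    of digits and of complements of digits. *)
Fixpoint pou (b : seq bool) (t : Omega) : R :=
  if b is c :: b' then
    pou b' t * (if c then digit (size b') (ival t) else 1 - digit (size b') (ival t))
  else 1.

Lemma digit01 k (t : R) : 0 <= digit k t <= 1.
Proof. exact: clamp01. Qed.

Lemma pou_ge0 b t : 0 <= pou b t.
Proof.
elim: b => //= c b IH; apply: mulr_ge0 => //.
by case: c; have /andP[] := digit01 (size b) (ival t); rewrite ?subr_ge0.
Qed.

Lemma pou_splits t : splits (pou ^~ t).
Proof. by move=> b /=; rewrite -mulrDr addrC subrK mulr1. Qed.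

Lemma pou_continuous b : continuous (pou b).
Proof.
elim: b => [|c b IH]; first exact: (@cst_continuous Omega R 1).
have cd : continuous (digit (size b) \o ival : Omega -> R).
  by move=> t; apply: continuous_comp; [exact: ival_continuous|exact: digit_continuous].
move=> t; apply: (@continuousM R Omega (pou b)
  (fun t => if c then digit (size b) (ival t) else 1 - digit (size b) (ival t))).
  exact: IH.
case: c; first exact: cd.
by apply: (@continuousB R R Omega (cst 1)); [exact: cst_continuous|exact: cd].
Qed.

Lemma pou_coding (d : measure_display) (S : measurableType d) (A : nat -> set S) b x :
  pou b (coding A x : Omega) = (x \in cell A b)%:R.
Proof.
elim: b => [|c b IH] /=; first by rewrite in_setT.
rewrite IH digit_code; case: c.
  by rewrite in_setI; case: (_ \in cell A b); rewrite ?mul0r ?mul1r.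
rewrite in_setD; case: (_ \in cell A b); rewrite ?mul0r ?mul1r//.
by case: (_ \in A _); rewrite /= ?subrr ?subr0.
Qed.

End partition_of_unity.

Section step_estimate.
Context {R : realType} {s : scalars} {T : Type} (Sigma : set (set T)).
Context {X Y : normedModType (field_of R s)}.
Variables (l : set T -> X -> Y) (nu : set T -> R).
Hypothesis ST : Sigma setT.
Hypothesis SI : forall A B, Sigma A -> Sigma B -> Sigma (A `&` B).
Hypothesis SD : forall A B, Sigma A -> Sigma B -> Sigma (A `\` B).
Hypothesis lA : forall A B x, Sigma A -> Sigma B ->
  l A x = l (A `&` B) x + l (A `\` B) x.
Hypothesis lD : forall A x y, Sigma A -> l A (x + y) = l A x + l A y.
Hypothesis lnu : forall A x, Sigma A -> rnorm (l A x) <= nu A * rnorm x.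
Hypothesis nu_ge0 : forall A, Sigma A -> 0 <= nu A.
Hypothesis nuA : forall A B, Sigma A -> Sigma B ->
  nu (A `&` B) + nu (A `\` B) <= nu A.

Let S0 : Sigma set0. Proof. by rewrite -(setDv setT); exact: SD. Qed.

Let l0 x : l set0 x = 0.
Proof.
by apply: (addrI (l set0 x)); rewrite addr0 [RHS](lA x S0 S0) setI0 set0D.
Qed.

Let nu0 : nu set0 = 0.
Proof.
apply/eqP; rewrite eq_le nu_ge0// andbT.
by have := nuA S0 S0; rewrite setI0 set0D; lra.
Qed.

Let lN A x : Sigma A -> l A (- x) = - l A x.
Proof.
move=> SA; have l00 : l A 0 = 0.
  by apply: (addrI (l A 0)); rewrite -lD// !addr0.
by apply/eqP; rewrite -subr_eq0 opprK -lD// addNr l00.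
Qed.

(** Induction on [f], cutting [A] by its first set: on each half the list is
    shorter, and [x] accumulates the values of the sets already met.  At the end [A] is
    an atom on which the step function is the constant [x]. *)
Lemma step_estimate (f : seq (set T * X)) A x (c : R) :
  {in f, forall p, Sigma p.1} -> Sigma A ->
  (forall t, A t -> rnorm (x + \sum_(p <- f | t \in p.1) p.2) <= c) ->
  rnorm (l A x + \sum_(p <- f) l (A `&` p.1) p.2) <= c * nu A.
Proof.
elim: f A x => [|[B v] f IH] A x Sf SA Ac.
  rewrite big_nil addr0; have [->|/set0P[t At]] := eqVneq A set0.
    by rewrite l0 rnorm0 nu0 mulr0.
  apply: le_trans (lnu x SA) _; rewrite mulrC ler_wpM2r ?nu_ge0//.
  by have := Ac t At; rewrite big_nil addr0.
have SB : Sigma B by apply: (Sf (B, v)); rewrite mem_head.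
have {}Sf : {in f, forall p, Sigma p.1}.
  by move=> p pf; apply: Sf; rewrite in_cons pf orbT.
have SAB := SI SA SB; have SADB := SD SA SB.
have h1 : rnorm (l (A `&` B) (x + v) +
    \sum_(p <- f) l (A `&` B `&` p.1) p.2) <= c * nu (A `&` B).
  apply: IH => // t [At Bt]; have := Ac t At.
  by rewrite big_cons /= mem_set// addrA.
have h2 : rnorm (l (A `\` B) x +
    \sum_(p <- f) l ((A `\` B) `&` p.1) p.2) <= c * nu (A `\` B).
  apply: IH => // t [At Bt]; have := Ac t At.
  by rewrite big_cons /= memNset.
have [A0|/set0P[t At]] := eqVneq A set0.
  rewrite A0 l0 nu0 mulr0 big1 ?addr0 ?rnorm0// => p _.
  by rewrite set0I l0.
have c0 : 0 <= c by apply: le_trans (Ac t At); exact: rnorm_ge0.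
apply: le_trans (_ : c * (nu (A `&` B) + nu (A `\` B)) <= _); last first.
  by rewrite ler_wpM2l// nuA.
rewrite mulrDr; apply: le_trans (lerD h1 h2); apply: le_trans (ler_rnormD _ _).
rewrite le_eqVlt; apply/orP; left; apply/eqP; congr rnorm.
rewrite big_cons /= (lA x SA SB) (lD _ _ SAB).
have -> : \sum_(p <- f) l (A `&` p.1) p.2 = \sum_(p <- f) l (A `&` B `&` p.1) p.2 +
    \sum_(p <- f) l ((A `\` B) `&` p.1) p.2.
  rewrite -big_split /= big_seq [RHS]big_seq; apply: eq_bigr => p pf.
  rewrite (lA p.2 (SI SA (Sf p pf)) SB); congr (l _ _ + l _ _).
    by rewrite setIAC.
  by rewrite !setDE setIAC.
rewrite -!addrA; congr (_ + _); rewrite [LHS]addrCA; congr (_ + _).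
by rewrite addrCA.
Qed.

Let terms (h : simple_function Sigma X) : seq (set T * X) :=
  [seq (simple_set h i, simple_val h i) | i <- index_enum 'I_(simple_size h)].

Lemma simple_integral_dist (h h' : simple_function Sigma X) (D : set T) (c c' : R) :
  Sigma D ->
  (forall t, D t -> rnorm (simple_fun h t - simple_fun h' t) <= c) ->
  (forall t, ~ D t -> rnorm (simple_fun h t - simple_fun h' t) <= c') ->
  rnorm (simple_integral l h - simple_integral l h') <= c * nu D + c' * nu (~` D).
Proof.
move=> SDD Dc Dc'; have SDC : Sigma (~` D) by rewrite -setTD; exact: SD.
pose f := terms h ++ [seq (p.1, - p.2) | p <- terms h'].
have Sf : {in f, forall p, Sigma p.1}.
  move=> p; rewrite mem_cat => /orP[/mapP[i _ ->]|/mapP[_ /mapP[i _ ->] ->]] /=;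
    exact: simple_setP.
have fE t : \sum_(p <- f | t \in p.1) p.2 = simple_fun h t - simple_fun h' t.
  by rewrite big_cat !big_map /= sumrN.
have IE : simple_integral l h - simple_integral l h' = \sum_(p <- f) l p.1 p.2.
  rewrite /f big_cat !big_map /= -sumrN; congr (_ + _); apply: eq_bigr => i _.
  by rewrite lN//; exact: simple_setP.
have split_f : \sum_(p <- f) l p.1 p.2 =
    (l D 0 + \sum_(p <- f) l (D `&` p.1) p.2) +
    (l (~` D) 0 + \sum_(p <- f) l (~` D `&` p.1) p.2).
  have lz A : Sigma A -> l A 0 = 0.
    by move=> SA; apply: (addrI (l A 0)); rewrite -lD// !addr0.
  rewrite !lz// !add0r -big_split /= big_seq [RHS]big_seq; apply: eq_bigr => p pf.
  by rewrite (lA p.2 (Sf p pf) SDD) setIC setDE [_ `&` ~` _]setIC.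
rewrite IE split_f; apply: (le_trans (ler_rnormD _ _)); apply: lerD.
  by apply: step_estimate => // t Dt; rewrite add0r fE; exact: Dc.
by apply: step_estimate => // t Dt; rewrite add0r fE; exact: Dc'.
Qed.

End step_estimate.

(** * Riemann sums *)

Section riemann.
Context {R : realType}.
Local Notation Omega := (unit_interval R).

Definition cut (n i : nat) : set Omega :=
  [set t | i%:R / n.+1%:R <= ival t < i.+1%:R / n.+1%:R].

Lemma borel_cut n i : borel (cut n i).
Proof.
have lt_borel (a : R) : borel [set t : Omega | ival t < a].
  apply: borel_open; apply: (@open_comp _ _ ival [set x | x < a]); last exact: open_lt.
  by move=> t _; exact: ival_continuous.
have -> : cut n i = [set t | ival t < i.+1%:R / n.+1%:R] `\`
    [set t | ival t < i%:R / n.+1%:R].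
  apply/seteqP; split => t /=.
    by rewrite /cut /= => /andP[h1 h2]; split => //; rewrite ltNge h1.
  by move=> [h1 h2]; rewrite /cut /= h1 andbT leNgt; apply/negP.
exact: borelD.
Qed.

Lemma node01 (n : nat) (i : 'I_n.+2) : 0 <= (i%:R / n.+1%:R : R) <= 1.
Proof.
rewrite divr_ge0//= ler_pdivrMr ?ltr0n// mul1r ler_nat -ltnS; exact: ltn_ord.
Qed.

Definition node n (i : 'I_n.+2) : Omega := to_unit (node01 i).

Definition riemann (V : Type) (n : nat) (f : Omega -> V) : simple_function (@borel Omega) V :=
  Simple (fun i => f (node i)) (fun i : 'I_n.+2 => borel_cut n i).

(** The sample point [t'] depends on [n] and [t] only, so one point serves all
    functions [f]. *)
Lemma simple_fun_riemann n t : exists t', `|ival t - ival t'| <= n.+1%:R^-1 /\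
  forall (V : zmodType) (f : Omega -> V), simple_fun (riemann n f) t = f t'.
Proof.
have n0 : 0 < n.+1%:R :> R by rewrite ltr0n.
pose k := Num.truncn (ival t * n.+1%:R).
have tn0 : 0 <= ival t * n.+1%:R by rewrite mulr_ge0// ival_ge0.
have kn : (k < n.+2)%N.
  rewrite ltnS real_truncn_le_nat ?num_real//.
  apply: le_lt_trans (_ : n.+1%:R < _); last by rewrite ltr_nat.
  by rewrite ler_piMl// ival_le1.
have /andP[k1 k2] := truncn_itv tn0; rewrite -/k in k1 k2.
have cutE (i : 'I_n.+2) : (t \in cut n i) = (i == Ordinal kn).
  rewrite -val_eqE /=; apply/idP/eqP => [|->].
    rewrite inE /cut /= => /andP[]; rewrite ler_pdivrMr// ltr_pdivlMr// => h1 h2.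
    by apply/esym/truncn_def; rewrite h1.
  by rewrite inE /cut /= ler_pdivrMr// ltr_pdivlMr// k1.
exists (node (Ordinal kn)); split; last first.
  by move=> V f; rewrite /simple_fun /= (eq_bigl _ _ cutE) big_pred1_eq.
rewrite /ival /= set_valE /= -/(ival t).
have -> : ival t - k%:R / n.+1%:R = (ival t * n.+1%:R - k%:R) / n.+1%:R.
  by rewrite mulrBl mulfK// gt_eqF.
rewrite normrM normfV (gtr0_norm n0) ler_piMl ?invr_ge0 ?ltW//.
by rewrite ger0_norm ?subr_ge0//; rewrite -natr1 in k2; lra.
Qed.

Lemma riemann_uniform {s : scalars} (V : normedModType (field_of R s)) (f : Omega -> V)
    (e : R) : continuous f -> 0 < e ->
  exists N, forall n t, (N <= n)%N -> rnorm (simple_fun (riemann n f) t - f t) <= e.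
Proof.
move=> cf e0; have [N hN] := uniform_continuity cf e0.
exists N => n t Nn; have [t' [tt' ->]] := simple_fun_riemann n t.
by apply: (hN n) => //; rewrite distrC.
Qed.

End riemann.

Section bounded_op.
Context {K : numFieldType} {X Y : normedModType K}.
Implicit Type f : bounded_op X Y.

Lemma bounded_opD f x y : f (x + y) = f x + f y.
Proof. by have := bounded_op_linear f 1 x y; rewrite !scale1r. Qed.

Lemma bounded_op0 f : f 0 = 0.
Proof. by apply: (addrI (f 0)); rewrite -bounded_opD !addr0. Qed.

Lemma bounded_opZ f a x : f (a *: x) = a *: f x.
Proof. by have := bounded_op_linear f a x 0; rewrite bounded_op0 !addr0. Qed.

Lemma bounded_opN f x : f (- x) = - f x.
Proof. by rewrite -scaleN1r bounded_opZ scaleN1r. Qed.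

Lemma bounded_op_sum f (I : Type) (r : seq I) (x : I -> X) :
  f (\sum_(i <- r) x i) = \sum_(i <- r) f (x i).
Proof. by apply: (big_morph f (bounded_opD f)); exact: bounded_op0. Qed.

End bounded_op.

(** * The operator attached to a measure *)

Section integral_operator.
Context {R : realType} {s : scalars}.
Context {E : normedModType (field_of R s)} {F : completeNormedModType (field_of R s)}.
Context {d : measure_display} {S : measurableType d}.
Local Notation K := (field_of R s).
Local Notation Omega := (unit_interval R).
Variables (m : set S -> F) (nu : {finite_measure set S -> \bar R}).
Variables (kappa : S -> Omega) (h : dual_space E).
Hypothesis ma : additive_set m.
Hypothesis mnu : forall A, measurable A -> (enorm (m A) <= nu A)%E.
Hypothesis mkappa : forall B, borel B -> measurable (kappa @^-1` B).
Hypothesis h_le : forall e, rnorm (h e : K) <= 2 * rnorm e.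

Definition image_measure (B : set Omega) : F := m (kappa @^-1` B).

Definition rank_one_fun (B : set Omega) (e : E) : F := (h e : K) *: image_measure B.

Lemma rank_one_bounded B : rank_one_fun B \in is_bounded_op.
Proof.
apply/asboolP; split.
  by move=> a x y; rewrite /rank_one_fun bounded_op_linear scalerDl scalerA.
apply: (linear_lipschitz_continuous (c := 2 * rnorm (image_measure B))).
  by move=> a x y; rewrite /rank_one_fun bounded_op_linear scalerDl scalerA.
move=> x; rewrite /rank_one_fun rnormZ mulrAC ler_wpM2r ?rnorm_ge0//.
Qed.

Definition rank_one (B : set Omega) : bounded_op E F := BoundedOp (rank_one_bounded B).

Definition image_mass (B : set Omega) : R := mass nu (kappa @^-1` B).

Lemma image_mass_ge0 B : 0 <= image_mass B. Proof. exact: mass_ge0. Qed.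

Lemma image_mass_additive A B : borel A -> borel B ->
  image_mass A = image_mass (A `&` B) + image_mass (A `\` B).
Proof. by move=> bA bB; rewrite /image_mass (additive_mass nu (mkappa bA) (mkappa bB)). Qed.

Lemma image_measure_additive A B : borel A -> borel B ->
  image_measure A = image_measure (A `&` B) + image_measure (A `\` B).
Proof. by move=> bA bB; rewrite /image_measure (ma (mkappa bA) (mkappa bB)). Qed.

Lemma image_measure_le B : borel B -> rnorm (image_measure B) <= image_mass B.
Proof. by move=> bB; rewrite -lee_fin massE ?mnu//; exact: mkappa. Qed.

Local Notation l := (fun B e => rank_one B e).

Lemma rank_one_le B e : borel B -> rnorm (rank_one B e) <= 2 * image_mass B * rnorm e.
Proof.
move=> bB; rewrite /= /rank_one_fun rnormZ mulrAC.
by apply: ler_pM; rewrite ?rnorm_ge0// image_measure_le.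
Qed.

Lemma rank_one_dist (f g : simple_function (@borel Omega) E) D (c c' : R) : borel D ->
  (forall t, D t -> rnorm (simple_fun f t - simple_fun g t) <= c) ->
  (forall t, ~ D t -> rnorm (simple_fun f t - simple_fun g t) <= c') ->
  rnorm (simple_integral l f - simple_integral l g) <=
  c * (2 * image_mass D) + c' * (2 * image_mass (~` D)).
Proof.
move=> bD hc hc'; apply: (simple_integral_dist (Sigma := @borel Omega)
    (nu := fun B => 2 * image_mass B)) bD hc hc'.
- exact: borelT.
- exact: borelI.
- exact: borelD.
- move=> A B x bA bB; rewrite /= /rank_one_fun (image_measure_additive bA bB).
  by rewrite scalerDr.
- by move=> A x y _; have := bounded_op_linear (rank_one A) 1 x y; rewrite !scale1r.
- by move=> A x bA; exact: rank_one_le.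
- by move=> A _; rewrite mulr_ge0// image_mass_ge0.
- by move=> A B bA bB; rewrite -mulrDr -image_mass_additive.
Qed.

Definition riemann_sum n (f : Omega -> E) : F := simple_integral l (riemann n f).

Definition integral_fun (f : C01 E) : F := limn (riemann_sum ^~ f).

Lemma riemann_sum_cvg (f : C01 E) : riemann_sum n f @[n --> \oo] --> integral_fun f.
Proof.
apply: rnorm_cauchy_cvgn => e e0.
have p : 0 < 4 * image_mass setT + 1 by rewrite ltr_wpDl// mulr_ge0// image_mass_ge0.
have e'0 : 0 < e / (4 * image_mass setT + 1) by rewrite divr_gt0.
have [N hN] := riemann_uniform (@C01_continuous _ _ _ f) e'0.
set e' := e / _ in e'0 hN.
exists N => n Nn; rewrite /riemann_sum.
have := @rank_one_dist (riemann n f) (riemann N f) setT (2 * e') 0 borelT.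
rewrite mul0r addr0 => h1; apply: le_trans (h1 _ _) _ => [t _|t /(_ I)//|].
  rewrite -(subrKA (f t)); apply: (le_trans (ler_rnormD _ _)).
  by rewrite [X in _ + X]rnormB mulr_natl mulr2n; apply: lerD; exact: hN.
have : e' * (4 * image_mass setT + 1) = e by rewrite /e' divfK// gt_eqF.
by lra.
Qed.

(** Compare the Riemann sum of [f] with the one of [0]. *)
Lemma integral_fun_le f : rnorm (integral_fun f) <= 2 * image_mass setT * sup_norm f.
Proof.
have lim : rnorm (riemann_sum n f) @[n --> \oo] --> rnorm (integral_fun f).
  by apply: continuous_cvg; [exact: rnorm_continuous|exact: riemann_sum_cvg].
apply: (cvgr_to_le lim); apply: nearW => n.
have := @rank_one_dist (riemann n f) (riemann n (fun=> 0)) setT (sup_norm f) 0 borelT.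
rewrite mul0r addr0 => h1.
have r0 : simple_integral l (riemann n (fun=> 0)) = 0.
  by apply: big1 => i _; exact: (bounded_op0 (rank_one _)).
rewrite r0 subr0 in h1; rewrite [leRHS]mulrC; apply: h1 => [t _|t /(_ I)//].
have [t1 [_ ->]] := simple_fun_riemann n t.
have [t2 [_ ->]] := simple_fun_riemann n t.
by rewrite subr0; exact: le_sup_norm.
Qed.

Lemma integral_fun_linear : linear integral_fun.
Proof.
move=> a f g.
have lim : a *: riemann_sum n f + riemann_sum n g @[n --> \oo] -->
    a *: integral_fun f + integral_fun g.
  by apply: cvgD; [apply: cvgZl_tmp|]; exact: riemann_sum_cvg.
apply: (cvg_unique _ _ lim) => //.
have -> : (fun n => a *: riemann_sum n f + riemann_sum n g) =
    (fun n => riemann_sum n (a *: f + g : C01 E)); last exact: riemann_sum_cvg.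
apply/funext => n; rewrite /riemann_sum /simple_integral scaler_sumr -big_split /=.
by apply: eq_bigr => i _; exact/esym/(bounded_op_linear (rank_one (cut n i))).
Qed.

Lemma integral_bounded : integral_fun \in is_bounded_op.
Proof.
apply/asboolP; split; first exact: integral_fun_linear.
apply: (linear_lipschitz_continuous (c := 2 * image_mass setT)).
  exact: integral_fun_linear.
move=> f; apply: le_trans (integral_fun_le f) _.
by rewrite [rnorm f](_ : _ = sup_norm f)// /rnorm /Num.norm /= /C01_norm of_realK.
Qed.

Definition integral_op : bounded_op (C01 E) F := BoundedOp integral_bounded.

End integral_operator.

Section integral_of_pou.
Context {R : realType} {s : scalars}.
Context {E : normedModType (field_of R s)} {F : completeNormedModType (field_of R s)}.
Context {d : measure_display} {S : measurableType d}.
Local Notation K := (field_of R s).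
Local Notation Omega := (unit_interval R).
Variables (m : set S -> F) (nu : {finite_measure set S -> \bar R}).
Variables (A : nat -> set S) (h : dual_space E).
Hypothesis ma : additive_set m.
Hypothesis mnu : forall A, measurable A -> (enorm (m A) <= nu A)%E.
Hypothesis mA : forall k, measurable (A k).
Hypothesis h_le : forall e, rnorm (h e : K) <= 2 * rnorm e.

Lemma tensor_continuous (w : Omega -> R) (e : E) : continuous w ->
  continuous (fun t : Omega => of_real (w t) *: e).
Proof.
move=> cw t; apply/(@cvgrPdist_le K E Omega (nbhs (t : Omega)) _ _ _).2 => c c0.
have p : 0 < rnorm e + 1 by rewrite ltr_wpDl// rnorm_ge0.
have c'0 : 0 < to_real c / (rnorm e + 1) by rewrite divr_gt0// to_real_gt0.
have : \forall u \near t, `|w t - w u| <= to_real c / (rnorm e + 1).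
  by have /cvgrPdist_le/(_ _ c'0) := cw t.
apply: filterS => u tu.
rewrite -scalerBl -of_realB -of_real_rnorm rnormZ_real -(to_realK (ltW c0)) ler_of_real.
apply: le_trans (_ : to_real c / (rnorm e + 1) * (rnorm e + 1) <= _); last first.
  by rewrite divfK// gt_eqF.
by apply: ler_pM; rewrite ?rnorm_ge0// lerDl.
Qed.

Lemma is_continuous_tensor (w : Omega -> R) (e : E) : continuous w ->
  (fun t : Omega => of_real (w t) *: e) \in is_continuous.
Proof. by move=> cw; apply/asboolP; exact: tensor_continuous. Qed.

Definition tensor (w : Omega -> R) (cw : continuous w) (e : E) : C01 E :=
  MkC01 (is_continuous_tensor e cw).

Definition pou_tensor (b : seq bool) (e : E) : C01 E :=
  tensor (@pou_continuous R b) e.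

(** The coding takes its values in the set [D] where the function is [0] or [1].
    There it is the indicator of the level set at [1], whose preimage is the node [b],
    and the complement of [D] has image mass [0]. *)
Lemma integral_pou b e :
  integral_fun m (coding A) h_le (pou_tensor b e) = (h e : K) *: m (cell A b).
Proof.
pose D := [set t : Omega | pou b t = 0 \/ pou b t = 1].
pose B := [set t : Omega | pou b t = 1].
have closed_level (a : R) : closed [set t : Omega | pou b t = a].
  apply: (@closed_comp _ _ (pou b) [set a]); last exact: closed_eq.
  by move=> t _; exact: pou_continuous.
have bB : borel B by apply: borel_closed; exact: closed_level.
have bD : borel D by apply: borelU => //; apply: borel_closed; exact: closed_level.
have mco := measurable_coding mA (R := R).
have DT : image_mass nu (coding A) (~` D) = 0.
  rewrite /image_mass [X in mass _ X](_ : _ = set0) ?/mass ?measure0//.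
  apply/seteqP; split => // x; apply; rewrite /D /= pou_coding.
  by case: (_ \in _); [right|left].
have mB : image_measure m (coding A) B = m (cell A b).
  congr (m _); apply/seteqP; split => x; rewrite /B /= pou_coding.
    by case: (boolP (x \in cell A b)) => [/set_mem//|_ /eqP]; rewrite eq_sym oner_eq0.
  by move=> /mem_set ->.
pose ind : simple_function (@borel Omega) E :=
  Simple (fun _ : 'I_1 => e) (fun _ : 'I_1 => bB).
have indE t : simple_fun ind t = if t \in B then e else 0.
  by rewrite /simple_fun /= big_mkcond big_ord1.
have := @riemann_sum_cvg _ _ _ _ _ _ m nu (coding A) h ma mnu mco h_le (pou_tensor b e).
move=> lim; apply: (cvg_unique _ lim) => //.
apply/cvgn_rnormP => c c0.
pose M := 2 * image_mass nu (coding A) D + 1.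
have p : 0 < M by rewrite /M ltr_wpDl// mulr_ge0// image_mass_ge0.
have c'0 : 0 < c / M by rewrite divr_gt0.
have [N hN] := riemann_uniform (@C01_continuous _ _ _ (pou_tensor b e)) c'0.
exists N => n Nn; rewrite rnormB -mB.
have -> : (h e : K) *: image_measure m (coding A) B =
    simple_integral (fun B e => rank_one m (coding A) h_le B e) ind.
  by rewrite /simple_integral big_ord1.
have := @rank_one_dist _ _ _ _ _ _ m nu (coding A) h ma mnu mco h_le
  (riemann n (pou_tensor b e)) ind D (c / M)
  (c / M + sup_norm (pou_tensor b e) + rnorm e) bD.
rewrite DT !mulr0 addr0 => h1; apply: le_trans (h1 _ _) _ => [t Dt|t _|].
- have -> : simple_fun ind t = pou_tensor b e t; last exact: hN.
  rewrite indE /=; case: Dt => w.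
    rewrite memNset ?w ?of_real0 ?scale0r// /B /= w => /eqP.
    by rewrite eq_sym oner_eq0.
  by rewrite mem_set// w of_real1 scale1r.
- rewrite -(subrKA (pou_tensor b e t)) -[leRHS]addrA.
  apply: (le_trans (ler_rnormD _ _)); apply: lerD; first exact: hN.
  apply: (le_trans (ler_rnormB _ _)); apply: lerD; first exact: le_sup_norm.
  by rewrite indE; case: ifP => // _; rewrite rnorm0 rnorm_ge0.
- have : c / M * M = c by rewrite divfK// gt_eqF.
  by rewrite /M; lra.
Qed.

End integral_of_pou.

(** * Operator norms and uniform convergence *)

Section operator_norm.
Context {R : realType} {s : scalars}.
Context {X Y : normedModType (field_of R s)}.
Local Notation K := (field_of R s).
Implicit Types f g : bounded_op X Y.
Local Open Scope ereal_scope.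

Lemma opnorm_ge0 f : 0 <= opnorm f.
Proof.
apply: le_trans (_ : enorm (f 0%R) <= _); first exact: enorm_ge0.
by apply: ereal_sup_ubound; exists 0%R => //=; rewrite rnorm0.
Qed.

Lemma opnorm_le f (c : R) : (0 <= c)%R ->
  (forall x, rnorm (f x) <= c * rnorm x)%R -> opnorm f <= c%:E.
Proof.
move=> c0 fc; apply: ge_ereal_sup => _ [x /= x1 <-].
rewrite lee_fin; apply: le_trans (fc x) _.
by rewrite -[leRHS]mulr1 ler_wpM2l.
Qed.

Lemma enorm_le_opnorm f x : enorm (f x) <= opnorm f * enorm x.
Proof.
have [->|x0] := eqVneq x 0%R.
  by rewrite bounded_op0 /enorm !rnorm0 mule0.
have r0 : (0 < rnorm x)%R.
  by rewrite lt_def rnorm_ge0 andbT; apply: contra x0 => /eqP/rnorm_eq0 ->.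
pose x' := of_real (rnorm x)^-1 *: x.
have x'1 : rnorm x' = 1%R.
  by rewrite rnormZ_real ger0_norm ?invr_ge0 ?rnorm_ge0// mulVf// gt_eqF.
have -> : enorm (f x) = enorm (f x') * enorm x.
  rewrite /enorm -EFinM; congr (_%:E); rewrite bounded_opZ rnormZ_real.
  rewrite ger0_norm ?invr_ge0 ?rnorm_ge0// mulrAC mulVf ?mul1r//.
  by rewrite gt_eqF.
apply: lee_wpmul2r; first exact: enorm_ge0.
by apply: ereal_sup_ubound; exists x' => //=; rewrite x'1.
Qed.

Lemma opnorm_eq0 f : opnorm f <= 0 -> f = 0%R.
Proof.
move=> f0; apply/val_inj/funext => x /=; apply/enorm_eq0.
apply: le_trans (enorm_le_opnorm f x) _.
by apply: mule_le0_ge0 => //; exact: enorm_ge0.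
Qed.

(** Continuity at [0] bounds [f] on a ball; rescale. *)
Lemma bounded_op_lipschitz f :
  exists c : R, (0 <= c)%R /\ forall x, (rnorm (f x) <= c * rnorm x)%R.
Proof.
have e1 : (0 < (1 : K))%R by [].
have /cvgrPdist_le/(_ _ e1) := @bounded_op_continuous _ _ _ f 0%R.
move=> /nbhs_ballP[r /= r0 hr].
have r0' : (0 < to_real r / 2)%R by rewrite divr_gt0// to_real_gt0.
exists ((to_real r / 2)^-1)%R; split; first by rewrite invr_ge0 ltW.
move=> x; have [->|x0] := eqVneq x 0%R.
  by rewrite bounded_op0 !rnorm0 mulr0.
have n0 : (0 < rnorm x)%R.
  by rewrite lt_def rnorm_ge0 andbT; apply: contra x0 => /eqP/rnorm_eq0 ->.
pose c := (to_real r / 2 / rnorm x)%R.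
have c0 : (0 < c)%R by rewrite divr_gt0.
have /hr /= : ball (0%R : X) r (of_real c *: x).
  rewrite -ball_normE /= sub0r normrN -of_real_rnorm -(to_realK (ltW r0)).
  rewrite lt_neqAle ler_of_real (inj_eq (can_inj (@of_realK R s))) -lt_neqAle.
  rewrite rnormZ_real gtr0_norm// /c divfK ?gt_eqF//.
  by rewrite ltr_pdivrMr// ltr_pMr ?to_real_gt0// ltr1n.
rewrite bounded_op0 sub0r normrN -of_real_rnorm -(@of_real1 R s) ler_of_real.
rewrite bounded_opZ rnormZ_real gtr0_norm// /c => h.
rewrite -(ler_pM2l c0) /c; apply: (le_trans h).
move: r0' n0; set a := (to_real r / 2)%R; set n := rnorm x => a0 n0.
suff -> : (a / n * (a^-1 * n) = 1)%R by [].
by rewrite mulrACA divff ?gt_eqF// mulVf ?gt_eqF// mulr1.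
Qed.


Lemma opnormD f g : opnorm (f + g)%R <= opnorm f + opnorm g.
Proof.
apply: ge_ereal_sup => _ [x /= x1 <-]; apply: le_trans (enormD _ _) _.
by apply: leeD; apply: ereal_sup_ubound; exists x.
Qed.

Lemma opnormN f : opnorm (- f)%R = opnorm f.
Proof.
by congr ereal_sup; apply: eq_imagel => x _; exact: enormN.
Qed.

Lemma opnorm_lty f : opnorm f < +oo.
Proof.
have [c [c0 fc]] := bounded_op_lipschitz f.
by apply: le_lt_trans (opnorm_le c0 fc) _; rewrite ltry.
Qed.

End operator_norm.

Lemma uniform_rnormP (R : realType) (s : scalars) (T : choiceType)
    (V : normedModType (field_of R s)) (f : nat -> T -> V) (g : T -> V) :
  {uniform, f @ \oo --> g} <->
  forall e : R, 0 < e -> exists N, forall n t, (N <= n)%N -> rnorm (f n t - g t) <= e.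
Proof.
split=> [fg e e0|h].
  have eK : 0 < (of_real e : field_of R s) by rewrite of_real_gt0.
  have [|N _ hN] := fg [set u : T -> V | forall t, rnorm (u t - g t) <= e].
    apply/uniform_nbhs; exists [set p | ball p.1 (of_real e) p.2]; split.
      exact: entourage_ball (PosNum eK).
    move=> u /= hu t; have := hu t I; rewrite -ball_normE /= => /ltW.
    by rewrite -of_real_rnorm ler_of_real rnormB.
  by exists N => n t Nn; exact: hN.
move=> P /uniform_nbhs[A [+ AP]]; rewrite -entourage_from_ballE => -[e /= e0 eA].
have e20 : 0 < to_real e / 2 by rewrite divr_gt0// to_real_gt0.
have [N hN] := h _ e20; exists N => // n Nn; apply: AP => t _ /=.
apply: eA => /=; rewrite -ball_normE /= -of_real_rnorm rnormB -(to_realK (ltW e0)).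
rewrite lt_neqAle ler_of_real (inj_eq (can_inj (@of_realK R s))) -lt_neqAle.
apply: le_lt_trans (hN n t Nn) _; rewrite ltr_pdivrMr// ltr_pMr ?to_real_gt0//.
by rewrite ltr1n.
Qed.

Section rank_one_nuclear.
Context {R : realType} {s : scalars} {X Y : normedModType (field_of R s)}.
Local Notation K := (field_of R s).
Local Open Scope ereal_scope.
Variables (f : bounded_op X Y) (h : dual_space X) (y : Y).
Hypothesis fE : forall x, f x = (h x : K) *: y.

Let u n : dual_space X := if n is 0%N then h else 0%R.
Let v n : Y := if n is 0%N then y else 0%R.

Let norms : \sum_(0 <= n <oo) opnorm (u n) * enorm (v n) = opnorm h * enorm y.
Proof.
rewrite (nneseries_split 0 1)//; last first.
  by move=> k _; apply: mule_ge0; [exact: opnorm_ge0|exact: enorm_ge0].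
rewrite big_nat1 eseries0 ?adde0// => -[|k]// _ _.
by rewrite /v /enorm rnorm0 mule0.
Qed.

Lemma rank_one_representation : nuclear_representation f u v.
Proof.
split.
  rewrite norms lte_mul_pinfty//; [exact: opnorm_ge0| |by rewrite ltry].
  by rewrite ge0_fin_numE ?opnorm_lty//; exact: opnorm_ge0.
move=> x; apply: cvg_near_cst; exists 1%N => // n /= n1.
rewrite /series /= big_ltn//= fE big_nat big1 ?addr0// => -[|k] // _.
by rewrite scaler0.
Qed.

Lemma rank_one_nuclear : nuclear f.
Proof. by exists u, v; exact: rank_one_representation. Qed.

Lemma rank_one_nuclear_norm : nuclear_norm f <= opnorm h * enorm y.
Proof.
rewrite -norms; apply: ereal_inf_lbound; exists (u, v) => //=.
exact: rank_one_representation.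
Qed.

Lemma nuclear_norm_ge0 (g : bounded_op X Y) : 0 <= nuclear_norm g.
Proof.
apply: le_ereal_inf_tmp => _ [uy _ <-]; apply: nneseries_ge0 => n _ _.
by apply: mule_ge0; [exact: opnorm_ge0|exact: enorm_ge0].
Qed.

End rank_one_nuclear.

(** * Regularity of image measures *)

Section regularity.
Context {R : realType} {d : measure_display} {S : measurableType d}.
Local Notation Omega := (unit_interval R).
Variables (nu : {finite_measure set S -> \bar R}) (kappa : S -> Omega).
Hypothesis mkappa : forall B, borel B -> measurable (kappa @^-1` B).
Local Notation mu B := (nu (kappa @^-1` B)).

Definition inner_outer (B : set Omega) (e : R) (C U : set Omega) : Prop :=
  [/\ closed C, open U, C `<=` B, B `<=` U & (mu (U `\` C) < e%:E)%E].

Lemma image_decreasing (V : nat -> set Omega) : (forall n, borel (V n)) ->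
  (forall i j, (i <= j)%N -> V j `<=` V i) ->
  mu (V n) @[n --> \oo] --> mu (\bigcap_n V n).
Proof.
move=> bV Vd; rewrite preimage_bigcap.
apply: (nonincreasing_cvg_mu (mu := nu) (F := fun n => kappa @^-1` V n)).
- by rewrite ltey_eq fin_num_measure//; exact: mkappa.
- by move=> n; exact: mkappa.
- by apply: bigcapT_measurable => n; exact: mkappa.
- by move=> i j ij; apply/subsetPset => x; exact: (Vd i j ij).
Qed.

Lemma open_ball_unit (t : Omega) (r : R) : open (ball t r).
Proof.
have -> : ball t r = ival @^-1` [set x | `|ival t - x| < r] by [].
apply: open_comp => [u _|]; first exact: ival_continuous.
have -> : [set x | `|ival t - x| < r] = ball (ival t) r by [].
exact: ball_open.
Qed.

(** The complement of the balls of radius [1 / n.+1] centred off [U] is closed,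
    and these sets increase to [U]. *)
Lemma regular_open (U : set Omega) (e : R) : open U -> 0 < e ->
  exists C V, inner_outer U e C V.
Proof.
move=> oU e0; pose W n := \bigcup_(y in ~` U) ball y (n.+1%:R^-1 : R).
have oW n : open (W n) by apply: bigcup_open => y _; exact: open_ball_unit.
have lim : mu (U `&` W n) @[n --> \oo] --> mu (\bigcap_n (U `&` W n)).
  apply: image_decreasing.
    by move=> n; apply: borelI; exact: borel_open.
  move=> i j ij t [Ut [y nUy yt]]; split => //; exists y => //.
  by apply: le_ball yt; rewrite lef_pV2 ?posrE// ler_nat.
have W0 : \bigcap_n (U `&` W n) = set0.
  apply/seteqP; split => // t h; have [Ut _] := h 0%N I.
  have /nbhs_ballP[r /= r0 rU] : nbhs t U by exact: open_nbhs_nbhs.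
  have [_ [y nUy yt]] := h (Num.truncn r^-1) I.
  apply: nUy; apply: rU; apply: ball_sym; apply: le_ball yt.
  by rewrite invf_ple ?posrE// ltW// real_truncnS_gt// num_real.
rewrite W0 preimage_set0 measure0 in lim.
have e20 : 0 < e / 2 by rewrite divr_gt0.
have [N hN] := cvge0_small lim e20.
exists (~` W N), U; split => //.
- exact: open_closedC.
- move=> t nWt; apply: contrapT => nUt; apply: nWt; exists t => //.
  by apply: ballxx.
- rewrite setDE setCK; apply: le_lt_trans (hN N (leqnn N)) _.
  by rewrite lte_fin; lra.
Qed.

(** The sets approximable from both sides form a sigma-algebra; for a countable
    union, the union of finitely many of the inner sets is closed, and finitely many
    are enough by continuity from above. *)
Lemma image_regular (B : set Omega) : borel B -> forall e : R, 0 < e ->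
  exists C U, inner_outer B e C U.
Proof.
move=> bB; suff [] : borel B /\ forall e, 0 < e -> exists C U, inner_outer B e C U by [].
apply: (bB [set B | borel B /\ forall e, 0 < e -> exists C U, inner_outer B e C U]).
split; last by move=> U /= oU; split; [exact: borel_open|move=> e; exact: regular_open].
split => /=.
- split; first exact: borel0.
  move=> e e0; exists set0, set0; split => //; [exact: closed0|exact: open0|].
  by rewrite setD0 preimage_set0 measure0.
- move=> D [bD hD]; rewrite setTD; split; first exact: borelC.
  move=> e /hD[C [U [cC oU CD DU eUC]]]; exists (~` U), (~` C); split.
  + exact: open_closedC.
  + exact: closed_openC.
  + exact: subsetC.
  + exact: subsetC.
  + by rewrite setDE setCK setIC -setDE.
move=> D hD; have bD n : borel (D n) by case: (hD n).
split; first exact: borel_bigcup.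
move=> e e0.
have e20 : 0 < e / 2 by rewrite divr_gt0.
have : forall n, exists CU : set Omega * set Omega,
    inner_outer (D n) (e / 2 / (2 ^ n.+1)%:R) CU.1 CU.2.
  move=> n; have [_ h] := hD n.
  have en : 0 < e / 2 / (2 ^ n.+1)%:R by rewrite divr_gt0// ltr0n expn_gt0.
  by have [C [U CU]] := h _ en; exists (C, U).
move=> /choice[g gP].
pose C n := (g n).1; pose U n := (g n).2.
have cC n : closed (C n) by case: (gP n).
have oU n : open (U n) by case: (gP n).
pose V := \bigcup_n U n.
pose Cn n := \bigcup_(k < n) C k.
have cCn n : closed (Cn n).
  by rewrite /Cn bigcup_mkord; apply: closed_bigsetU => k _.
have oV : open V by exact: bigcup_open.
have bUC n : borel (U n `\` C n) by apply: borelD; [exact: borel_open|exact: borel_closed].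
have lim : mu (V `\` Cn n) @[n --> \oo] --> mu (\bigcap_n (V `\` Cn n)).
  apply: image_decreasing.
    by move=> n; apply: borelD; [exact: borel_open|exact: borel_closed].
  move=> i j ij t [Vt nCt]; split => //; apply: contra_not nCt => -[k ki Ck].
  by exists k => //=; exact: leq_trans ki ij.
have le2 : (mu (\bigcap_n (V `\` Cn n)) <= (e / 2)%:E)%E.
  apply: (@le_trans _ _ (\sum_(0 <= n <oo) mu (U n `\` C n))%E).
    apply: measure_sigma_subadditive.
    - by move=> n; exact: mkappa.
    - apply: mkappa; rewrite -[X in borel X]setCK setC_bigcap; apply: borelC.
      apply: borel_bigcup => n; apply: borelC.
      by apply: borelD; [exact: borel_open|exact: borel_closed].
    - move=> x /= hx; have [[k _ Ukx] _] := hx 0%N I.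
      exists k => //; split => // Ckx; have [_] := hx k.+1 I; apply.
      by exists k => /=.
  apply: le_trans (epsilon_trick0 xpredT (ltW e20)).
  apply: lee_nneseries => [n _ _|n _]; first exact: measure_ge0.
  by apply: ltW; case: (gP n).
have [n hn] : exists n, (mu (V `\` Cn n) < e%:E)%E.
  apply: contrapT => hno.
  have : (e%:E <= mu (\bigcap_n (V `\` Cn n)))%E.
    apply: (cvge_to_ge lim); apply: nearW => n; rewrite leNgt; apply/negP => hn.
    by apply: hno; exists n.
  by move=> /le_trans/(_ le2); rewrite lee_fin; lra.
exists (Cn n), V; split => //.
- by move=> t [k _ Ckt]; exists k => //; case: (gP k) => _ _ h _ _; exact: h.
- by move=> t [k _ Dkt]; exists k => //; case: (gP k) => _ _ _ h _; exact: h.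
Qed.

End regularity.

(** * The representing measure *)

Lemma dual_sub_sumE (K : numFieldType) (X Y : normedModType K) (f : bounded_op X Y)
    (I : Type) (r : seq I) (g : I -> bounded_op X Y) x :
  (f - \sum_(i <- r) g i) x = f x - \sum_(i <- r) g i x.
Proof.
by congr (_ - _); elim/big_ind2 : _ => // a a' b b' <- <-.
Qed.

Lemma trivIset_preimage (T U I : Type) (f : T -> U) (B : I -> set U) :
  trivIset setT B -> trivIset setT (fun i => f @^-1` B i).
Proof. by move=> tB i j _ _ [x [Bi Bj]]; apply: tB => //; exists (f x). Qed.

Section representing.
Context {R : realType} {s : scalars}.
Context {E : normedModType (field_of R s)} {F : completeNormedModType (field_of R s)}.
Context {d : measure_display} {S : measurableType d}.
Local Notation K := (field_of R s).
Local Notation Omega := (unit_interval R).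
Variables (m : set S -> F) (nu : {finite_measure set S -> \bar R}).
Variables (kappa : S -> Omega) (h : dual_space E).
Hypothesis mca : countably_additive (@measurable d S) enorm m.
Hypothesis mnu : forall A, measurable A -> (enorm (m A) <= nu A)%E.
Hypothesis mkappa : forall B, borel B -> measurable (kappa @^-1` B).
Hypothesis h_le : forall e, rnorm (h e : K) <= 2 * rnorm e.
Local Notation G := (rank_one m kappa h_le).
Local Notation im := (image_measure m kappa).

Let ma : additive_set m. Proof. exact: additive_of_countably_additive. Qed.

Lemma image_measure_ca (B : nat -> set Omega) : (forall n, borel (B n)) ->
  trivIset setT B ->
  enorm (im (\bigcup_k B k) - \sum_(k < n) im (B k)) @[n --> \oo] --> 0%E.
Proof.
move=> bB tB; rewrite /image_measure preimage_bigcup.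
apply: (mca (B := fun k => kappa @^-1` B k)); first by move=> n; exact: mkappa.
exact: trivIset_preimage.
Qed.

Lemma rank_one_sum (B : nat -> set Omega) n e :
  (G (\bigcup_k B k) - \sum_(k < n) G (B k)) e =
  (h e : K) *: (im (\bigcup_k B k) - \sum_(k < n) im (B k)).
Proof. by rewrite dual_sub_sumE scalerBr scaler_sumr. Qed.

Lemma cvge0_dominated (f g : nat -> \bar R) (c : R) : 0 <= c ->
  (forall n, 0 <= f n)%E -> (forall n, f n <= c%:E * g n)%E ->
  g n @[n --> \oo] --> 0%E -> f n @[n --> \oo] --> 0%E.
Proof.
move=> c0 f0 fg g0; apply: (@squeeze_cvge _ _ _ _ (cst 0%E) _ (fun n => c%:E * g n)%E).
- by apply: nearW => n; rewrite f0 fg.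
- exact: cvg_cst.
- by rewrite -[X in _ --> X](mule0 c%:E); apply: cvgeZl.
Qed.

Let opnorm_h : (opnorm h <= 2%:E)%E.
Proof. exact: opnorm_le. Qed.

Lemma rank_one_ca : countably_additive (@borel Omega) nuclear_norm G.
Proof.
move=> B bB tB; apply: (cvge0_dominated (c := 2)) (image_measure_ca bB tB) => // n.
  exact: nuclear_norm_ge0.
apply: le_trans (rank_one_nuclear_norm (rank_one_sum B n)) _.
by apply: lee_wpmul2r => //; exact: enorm_ge0.
Qed.

Lemma vector_variation_le (V : zmodType) (N : V -> \bar R) (l : set Omega -> V) (c : R) :
  0 <= c -> (forall B, borel B -> (N (l B) <= (c * image_mass nu kappa B)%:E)%E) ->
  forall A, borel A -> (vector_variation (@borel Omega) N l A <=
    (c * image_mass nu kappa A)%:E)%E.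
Proof.
move=> c0 lc A bA; apply: ge_ereal_sup => _ [n [P [bP tP PA ->]]].
apply: (@le_trans _ _ (\sum_(i < n) (c * image_mass nu kappa (P i))%:E)%E).
  by apply: lee_sum => i _; exact: lc.
rewrite sumEFin -mulr_sumr lee_fin ler_wpM2l// -lee_fin -sumEFin.
have mP i : measurable (kappa @^-1` P i) by exact: mkappa.
rewrite (eq_bigr (fun i => nu (kappa @^-1` P i))); last first.
  by move=> i _; rewrite massE.
rewrite -(measure_bigsetU_ord nu xpredT mP (trivIset_preimage tP)) massE; last exact: mkappa.
apply: le_measure; rewrite ?inE; [exact: bigsetU_measurable|exact: mkappa|].
elim/big_ind : _ => //; first by move=> X Y XA YA t [/XA|/YA].
by move=> i _ t Pt; rewrite /preimage /= -PA; exists i.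
Qed.

Lemma rank_one_bv : has_bounded_variation (@borel Omega) nuclear_norm G.
Proof.
have le B : borel B -> (nuclear_norm (G B) <= (2 * image_mass nu kappa B)%:E)%E.
  move=> bB; apply: le_trans (@rank_one_nuclear_norm _ _ _ _ (G B) h (im B) _) _ => //.
  rewrite EFinM; apply: lee_pmul => //; [exact: opnorm_ge0|exact: enorm_ge0|].
  by rewrite lee_fin; exact: (image_measure_le mnu mkappa).
have c2 : 0 <= 2 :> R by [].
by apply: le_lt_trans (vector_variation_le c2 le borelT) _; rewrite ltry.
Qed.

Section functional.
Variable u : dual_space F.

Definition scalar_measure (B : set Omega) : dual_space E := adjoint (G B) u.

Let scalar_le (D : dual_space E) (y : F) (c : R) : 0 <= c ->
  (forall x, rnorm (u x : K) <= c * rnorm x) ->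
  (forall e, D e = u ((h e : K) *: y)) -> (opnorm D <= (2 * c)%:E * enorm y)%E.
Proof.
move=> c0 uc DE; rewrite /enorm -EFinM; apply: opnorm_le.
  by rewrite !mulr_ge0// rnorm_ge0.
move=> e; rewrite DE; apply: le_trans (uc _) _; rewrite rnormZ.
rewrite [leRHS](_ : _ = c * (2 * rnorm e * rnorm y)); last by ring.
by rewrite ler_wpM2l// ler_wpM2r ?rnorm_ge0.
Qed.

(** Everything is dominated by the image mass, which is regular. *)
Lemma scalar_measure_dual : dual_measure scalar_measure.
Proof.
have [c [c0 uc]] := bounded_op_lipschitz u.
have c2 : 0 <= 2 * c by rewrite mulr_ge0.
have le B : borel B -> (opnorm (scalar_measure B) <=
    (2 * c * image_mass nu kappa B)%:E)%E.
  move=> bB; apply: le_trans (scalar_le (y := im B) c0 uc _) _ => //.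
  rewrite /enorm -EFinM lee_fin ler_wpM2l//.
  exact: (image_measure_le mnu mkappa).
split.
- move=> B bB tB; apply: (cvge0_dominated c2) (image_measure_ca bB tB) => n.
    exact: opnorm_ge0.
  apply: (scalar_le c0 uc) => e.
  rewrite (@dual_sub_sumE K E K^o) /= -(rank_one_sum B n e) dual_sub_sumE.
  by rewrite bounded_opD bounded_opN bounded_op_sum.
- by apply: le_lt_trans (vector_variation_le c2 le borelT) _; rewrite ltry.
- move=> B e bB e0.
  have e'0 : 0 < e / (2 * c + 1) by rewrite divr_gt0// ltr_wpDl.
  have [C [U [cC oU CB BU hUC]]] := image_regular nu mkappa bB e'0.
  exists C, U; split => //.
    exact: subclosed_compact cC (@unit_interval_compact R) _.
  have bUC : borel (U `\` C) by apply: borelD; [exact: borel_open|exact: borel_closed].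
  apply: le_lt_trans (vector_variation_le c2 le bUC) _; rewrite lte_fin.
  have hlt : image_mass nu kappa (U `\` C) < e / (2 * c + 1).
    by rewrite -lte_fin massE//; exact: mkappa.
  have h0 := image_mass_ge0 nu kappa (U `\` C).
  have : image_mass nu kappa (U `\` C) * (2 * c + 1) < e.
    by rewrite -ltr_pdivlMr// ltr_wpDl.
  by lra.
Qed.

Lemma scalar_measure_integral (f : C01 E) :
  is_integral scalar_measure f (adjoint (integral_op ma mnu mkappa h_le) u f).
Proof.
exists (fun n => riemann n f); split.
  by apply/uniform_rnormP => e e0; apply: riemann_uniform => //; exact: C01_continuous.
have lim := @riemann_sum_cvg _ _ _ _ _ _ m nu kappa h ma mnu mkappa h_le f.
have -> : (fun n => simple_integral (fun B e => scalar_measure B e : K) (riemann n f)) =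
    u \o (fun n => riemann_sum m kappa h_le n f).
  apply/funext => n; rewrite /riemann_sum /simple_integral /= bounded_op_sum.
  by apply: eq_bigr.
by apply: continuous_cvg => //; exact: bounded_op_continuous.
Qed.

End functional.

End representing.

Section uniqueness.
Context {R : realType} {s : scalars} {E : normedModType (field_of R s)}.
Local Notation K := (field_of R s).
Local Notation Omega := (unit_interval R).

Lemma unit_interval_hausdorff : hausdorff_space Omega.
Proof.
rewrite (@ball_hausdorff R Omega) => a b ab.
have d0 : 0 < `|ival a - ival b| / 2.
  rewrite divr_gt0// normr_gt0 subr_eq0; apply: contra ab => /eqP e.
  by apply/eqP/val_inj.
exists (PosNum d0, PosNum d0) => /=; apply/eqP/seteqP; split => // t [].
rewrite !ival_ball [`|ival b - _|]distrC => h1 h2.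
have : `|ival a - ival b| <= `|ival a - ival t| + `|ival t - ival b|.
  by rewrite -{1}(subrKA (ival t)) ler_normD.
by lra.
Qed.

Lemma urysohn_unit (C U : set Omega) : closed C -> open U -> C `<=` U ->
  exists w : Omega -> R, [/\ continuous w, forall t, 0 <= w t <= 1,
    forall t, C t -> w t = 1 & forall t, ~ U t -> w t = 0].
Proof.
move=> cC oU CU.
have disj : ~` U `&` C = set0.
  by apply/seteqP; split => // t [nUt /CU].
have := @pseudometric_normal R Omega.
move=> /(@normal_separatorP R)/(_ _ _ (open_closedC oU) cC disj).
move=> /(@uniform_separatorP _ R)[w [cw w01 w0 w1]].
exists w; split => // t.
- by have := w01 (w t) (imageT _ _); rewrite /= in_itv.
- by move=> Ct; apply: w1; exists t.
- by move=> nUt; apply: w0; exists t.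
Qed.

Section estimate.
Variable l : set Omega -> dual_space E.
Hypothesis dl : dual_measure l.
Local Notation var := (vector_variation (@borel Omega) opnorm l).

Let lca : countably_additive (@borel Omega) opnorm l. Proof. by case: dl. Qed.

Let var_fin B : borel B -> var B \is a fin_num.
Proof.
move=> bB; have [_ bv _] := dl.
have v0 : (0 <= var B)%E.
  by apply: vector_variation_ge0 => // x; exact: opnorm_ge0.
rewrite ge0_fin_numE//; apply: le_lt_trans bv.
apply: le_vector_variation_sub => //.
- by move=> x; exact: opnorm_ge0.
- by move=> A C bA bC; exact: borelD.
- exact: borelT.
Qed.

Let nu B : R := fine (var B).

Let nuE B : borel B -> (nu B)%:E = var B.
Proof. by move=> bB; rewrite fineK// var_fin. Qed.

Let nu_ge0 B : borel B -> 0 <= nu B.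
Proof.
move=> bB; rewrite fine_ge0//.
by apply: vector_variation_ge0 => // x; exact: opnorm_ge0.
Qed.

Let l_split A B (x : E) : borel A -> borel B ->
  (l A x : K^o) = l (A `&` B) x + l (A `\` B) x.
Proof.
move=> bA bB; rewrite -[in LHS](setUIDK A B).
have -> : l ((A `&` B) `|` (A `\` B)) = l (A `&` B) + l (A `\` B); last by [].
apply: (countably_additiveU (Sigma := @borel Omega) (N := opnorm)) => //.
- exact: borel0.
- exact: opnormD.
- exact: opnormN.
- exact: opnorm_eq0.
- exact: borelI.
- exact: borelD.
- by rewrite setDE setIACA setICr setI0.
Qed.

Let l_le A (x : E) : borel A -> rnorm (l A x : K^o) <= nu A * rnorm x.
Proof.
move=> bA; rewrite -lee_fin EFinM nuE//.
apply: le_trans (enorm_le_opnorm (l A) x) _.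
apply: lee_wpmul2r; first exact: enorm_ge0.
exact: le_vector_variation.
Qed.

Let nu_super A B : borel A -> borel B -> nu (A `&` B) + nu (A `\` B) <= nu A.
Proof.
move=> bA bB; have bI := borelI bA bB; have bD := borelD bA bB.
rewrite -lee_fin EFinD !nuE// -[X in (_ <= var X)%E](setUIDK A B).
apply: vector_variation_superadd => [x|]; first exact: opnorm_ge0.
by rewrite setDE setIACA setICr setI0.
Qed.

Let integral_dist (f g : simple_function (@borel Omega) E) D (c c' : R) : borel D ->
  (forall t, D t -> rnorm (simple_fun f t - simple_fun g t) <= c) ->
  (forall t, ~ D t -> rnorm (simple_fun f t - simple_fun g t) <= c') ->
  rnorm (simple_integral (fun B e => l B e : K^o) f -
         simple_integral (fun B e => l B e : K^o) g) <= c * nu D + c' * nu (~` D).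
Proof.
move=> bD hc hc'; apply: (simple_integral_dist (Sigma := @borel Omega)) bD hc hc' => //.
- exact: borelT.
- exact: borelI.
- exact: borelD.
- by move=> A x y _; exact: bounded_opD.
Qed.

(** A Urysohn function between a compact subset and an open superset of [B]
    differs from the indicator of [B] only on a set of small variation. *)
Lemma measure_from_integral B (e : E) (eps : R) : borel B -> 0 < eps ->
  exists C U, [/\ closed C, open U, C `<=` B, B `<=` U &
    forall (w : Omega -> R) (cw : continuous w), (forall t, 0 <= w t <= 1) ->
    (forall t, C t -> w t = 1) -> (forall t, ~ U t -> w t = 0) ->
    forall c : K, is_integral l (tensor cw e) c -> rnorm (c - l B e : K) <= eps].
Proof.
move=> bB eps0; have [_ _ reg] := dl.
pose r := rnorm e; have r0 : 0 <= r by exact: rnorm_ge0.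
(* The error [eps] is spent as [eps / 4] on the limit of the integrals, [eps / 4]
   on the uniform approximation, and [2 * r * de] on the gap between [C] and [U]. *)
pose de := eps / (4 * (r + 1)).
have de0 : 0 < de by rewrite /de divr_gt0// mulr_gt0// ltr_wpDl.
have rde : 2 * r * de <= eps / 2.
  have -> : 2 * r * de = eps / 2 * (r / (r + 1)) by rewrite /de; field; rewrite gt_eqF// ltr_wpDl.
  by rewrite -[leRHS]mulr1 ler_wpM2l ?(ltW (divr_gt0 _ _))// ler_pdivrMr ?ltr_wpDl// mul1r lerDl.
have [C [U [kC oU CB BU hUC]]] := reg B de bB de0.
have cC : closed C by exact: compact_closed unit_interval_hausdorff kC.
exists C, U; split => // w cw w01 w1 w0 c [g [gu gc]].
have bUC : borel (U `\` C) by apply: borelD; [exact: borel_open|exact: borel_closed].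
pose D := ~` (U `\` C).
have bD : borel D by exact: borelC.
pose M := nu D + nu (~` D) + 1.
have M0 : 0 < M by rewrite /M ltr_wpDl// addr_ge0// nu_ge0//; exact: borelC.
have e'0 : 0 < eps / 4 / M by rewrite !divr_gt0.
have [N1 hN1] := (uniform_rnormP _ _).1 gu _ e'0.
have eps40 : 0 < eps / 4 by rewrite divr_gt0.
have [N2 hN2] := (cvgn_rnormP _ _).1 gc _ eps40.
pose n := maxn N1 N2.
have {}hN1 := hN1 n _ (leq_maxl _ _); have {}hN2 := hN2 n (leq_maxr _ _).
pose ind : simple_function (@borel Omega) E :=
  Simple (fun _ : 'I_1 => e) (fun _ : 'I_1 => bB).
have indE t : simple_fun ind t = if t \in B then e else 0.
  by rewrite /simple_fun /= big_mkcond big_ord1.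
have indI : simple_integral (fun B e => l B e : K^o) ind = l B e.
  by rewrite /simple_integral big_ord1.
have wle t : rnorm (tensor cw e t) <= r.
  rewrite /= rnormZ_real; have /andP[w0' w1'] := w01 t.
  by rewrite ger0_norm// ler_piMl.
have dist := @integral_dist (g n) ind D (eps / 4 / M) (eps / 4 / M + 2 * r) bD.
have {}dist : rnorm (simple_integral (fun B e => l B e : K^o) (g n) - l B e) <=
    eps / 4 / M * nu D + (eps / 4 / M + 2 * r) * nu (~` D).
  rewrite -indI; apply: dist => t Dt.
    have -> : simple_fun ind t = tensor cw e t; last exact: hN1.
    rewrite indE /=; have [Ut|nUt] := pselect (U t).
      have Ct : C t by apply: contrapT => nCt; apply: Dt.
      by rewrite w1// of_real1 scale1r mem_set//; exact: CB.
    by rewrite w0// of_real0 scale0r memNset// => /BU.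
  rewrite -(subrKA (tensor cw e t)).
  apply: (le_trans (ler_rnormD _ _)); apply: lerD; first exact: hN1.
  apply: (le_trans (ler_rnormB _ _)); rewrite mulr_natl mulr2n; apply: lerD => //.
  by rewrite indE; case: ifP => // _; rewrite rnorm0.
have nuUC : nu (~` D) < de by rewrite -lte_fin nuE ?setCK//; exact: borelC.
have nuUC0 : 0 <= nu (~` D) by apply: nu_ge0; exact: borelC.
have nuD0 : 0 <= nu D by exact: nu_ge0.
have rn : 2 * r * nu (~` D) <= eps / 2.
  by apply: le_trans rde; rewrite ler_wpM2l ?mulr_ge0// ltW.
have eM : eps / 4 / M * M = eps / 4 by rewrite divfK// gt_eqF.
rewrite -(subrKA (simple_integral (fun B e => l B e : K^o) (g n))).
apply: (le_trans (ler_rnormD _ _)); move: dist hN2.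
have : eps / 4 / M * (nu D + nu (~` D)) <= eps / 4.
  by rewrite -[leRHS]eM ler_wpM2l// ?ltW// /M ltrDl.
by lra.
Qed.

End estimate.

(** Intersecting the open sets and joining the closed ones of two approximations
    gives a single Urysohn function that is good for both measures. *)
Lemma dual_measure_unique (l1 l2 : set Omega -> dual_space E)
    (psi : dual_space (C01 E)) : dual_measure l1 -> dual_measure l2 ->
  (forall f : C01 E, is_integral l1 f (psi f)) ->
  (forall f : C01 E, is_integral l2 f (psi f)) ->
  forall B e, borel B -> (l1 B e : K) = l2 B e.
Proof.
move=> d1 d2 i1 i2 B e bB; apply/subr0_eq/rnorm_eq0/eqP.
rewrite eq_le rnorm_ge0 andbT; apply/ler_addgt0Pr => eps eps0; rewrite add0r.
have e20 : 0 < eps / 2 by rewrite divr_gt0.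
have [C1 [U1 [cC1 oU1 CB1 BU1 h1]]] := measure_from_integral d1 e bB e20.
have [C2 [U2 [cC2 oU2 CB2 BU2 h2]]] := measure_from_integral d2 e bB e20.
have CU : C1 `|` C2 `<=` U1 `&` U2.
  by move=> t [/CB1|/CB2] Bt; split; [exact: BU1|exact: BU2|exact: BU1|exact: BU2].
have [w [cw w01 w1 w0]] := urysohn_unit (closedU cC1 cC2) (openI oU1 oU2) CU.
have k1 := h1 w cw w01 (fun t Ct => w1 t (or_introl Ct))
  (fun t nU => w0 t (fun UU => nU UU.1)) _ (i1 _).
have k2 := h2 w cw w01 (fun t Ct => w1 t (or_intror Ct))
  (fun t nU => w0 t (fun UU => nU UU.2)) _ (i2 _).
rewrite -(subrKA (psi (tensor cw e) : K)).
apply: (le_trans (ler_rnormD _ _)); rewrite rnormB.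
by move: k1 k2; lra.
Qed.

End uniqueness.

(** * The operator is not nuclear *)

Section level_sums.
Context {R : realType} {s : scalars} {E : normedModType (field_of R s)}.
Local Notation K := (field_of R s).
Local Notation Omega := (unit_interval R).

Lemma rnorm_le_opnorm (X Y : normedModType K) (f : bounded_op X Y) x :
  rnorm (f x) <= fine (opnorm f) * rnorm x.
Proof.
rewrite -lee_fin EFinM fineK; first exact: enorm_le_opnorm.
by rewrite ge0_fin_numE ?opnorm_lty//; exact: opnorm_ge0.
Qed.

Lemma C01_sumE (I : Type) (r : seq I) (f : I -> C01 E) t :
  (\sum_(i <- r) f i) t = \sum_(i <- r) f i t.
Proof. by elim/big_ind2 : _ => // a a' b b' <- <-. Qed.

Lemma rnorm_C01 (f : C01 E) : rnorm f = sup_norm f.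
Proof. by rewrite /rnorm /Num.norm /= /C01_norm of_realK. Qed.

Lemma exists_phase (z : K) : exists a : K, rnorm a <= 1 /\ a * z = of_real (rnorm z).
Proof.
have [->|z0] := eqVneq z 0.
  by exists 0; rewrite rnorm0 ler01 mulr0 of_real0.
exists (of_real (rnorm z) / z); split; last by rewrite divfK.
have rz : rnorm z != 0 by apply: contra z0 => /eqP/rnorm_eq0 ->.
have h : rnorm (of_real (rnorm z) / z) * rnorm z = rnorm z.
  by rewrite -rnormM divfK// rnorm_of_real ger0_norm// rnorm_ge0.
by rewrite -(mulfK rz (rnorm (_ / _))) h divff.
Qed.

(** The functions of one generation form a partition of unity, so multiplying
    them by phases keeps their sum in the ball of radius [rnorm e]. *)
Lemma sum_level_le (u : dual_space (C01 E)) (e : E) k :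
  \sum_(b <- words k [::]) rnorm (u (pou_tensor b e) : K) <=
  fine (opnorm u) * rnorm e.
Proof.
have /choice[a aP] : forall b, exists a : K, rnorm a <= 1 /\
    a * (u (pou_tensor b e) : K) = of_real (rnorm (u (pou_tensor b e) : K)).
  by move=> b; exact: exists_phase.
pose f : C01 E := \sum_(b <- words k [::]) a b *: pou_tensor b e.
have uf : (u f : K) = of_real (\sum_(b <- words k [::]) rnorm (u (pou_tensor b e) : K)).
  rewrite bounded_op_sum (big_morph _ (@of_realD R s) (@of_real0 R s)).
  by apply: eq_bigr => b _; rewrite bounded_opZ; case: (aP b) => _ <-.
have S0 : 0 <= \sum_(b <- words k [::]) rnorm (u (pou_tensor b e) : K).
  by apply: sumr_ge0 => b _; exact: rnorm_ge0.
have fe : rnorm f <= rnorm e.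
  rewrite rnorm_C01; apply: sup_norm_le => t.
  rewrite /f C01_sumE; apply: le_trans (ler_rnorm_sum _ _ _) _.
  apply: (@le_trans _ _ (\sum_(b <- words k [::]) pou b t * rnorm e)).
    apply: ler_sum => b _.
    rewrite [X in rnorm X](_ : _ = a b *: (of_real (pou b t) *: e))// rnormZ rnormZ_real.
    rewrite ger0_norm ?pou_ge0// ler_piMl ?mulr_ge0 ?pou_ge0 ?rnorm_ge0//.
    by case: (aP b).
  by rewrite -mulr_suml (sum_words _ _ (pou_splits t)) /= mul1r.
have := rnorm_le_opnorm u f; rewrite [rnorm (u f)](_ : _ = rnorm (u f : K))//.
rewrite uf rnorm_of_real ger0_norm// => h.
apply: (le_trans h); rewrite ler_wpM2l// fine_ge0//; exact: opnorm_ge0.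
Qed.

End level_sums.

Section not_nuclear.
Context {R : realType} {s : scalars}.
Context {E : normedModType (field_of R s)} {F : completeNormedModType (field_of R s)}.
Context {d : measure_display} {S : measurableType d}.
Local Notation K := (field_of R s).
Variables (mu nu : {finite_measure set S -> \bar R}) (m : set S -> F).
Variables (A : nat -> set S) (h : dual_space E) (e0 : E).
Hypothesis ma : additive_set m.
Hypothesis mnu : forall B, measurable B -> (enorm (m B) <= nu B)%E.
Hypothesis numu : forall B, measurable B -> mu B = 0%E -> nu B = 0%E.
Hypothesis mA : forall k, measurable (A k).
Hypothesis h_le : forall e, rnorm (h e : K) <= 2 * rnorm e.
Hypothesis he0 : h e0 = 1.

(** Evaluating a nuclear representation on the partitions of unity writes [m] on
    the tree as a series [\sum_n c_n y_n] with summable masses. *)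
Lemma nuclear_integral_oscillation :
  nuclear (integral_op ma mnu (measurable_coding mA (R := R)) h_le) ->
  forall e : R, 0 < e -> exists k0, forall k j, (k0 <= k)%N ->
    oscillation (fun b => m (cell A b)) (fun b => mass mu (cell A b)) k j <= e.
Proof.
move=> [u [y [sum_fin rep]]] e e_gt0.
have mcell b : measurable (cell A b) by exact: measurable_cell.
apply: (@nuclear_oscillation _ _ _ _ _ (fun n b => u n (pou_tensor b e0) : K) y
  (fun n => fine (opnorm (u n)) * rnorm e0)) => //.
- by move=> b /=; exact: additive_mass.
- by move=> b; exact: mass_ge0.
- move=> b; have := rep (pou_tensor b e0).
  rewrite [integral_op _ _ _ _ _](integral_pou ma mnu mA h_le b e0) he0 scale1r.
  rewrite [X in X @ _ --> _](_ : _ = fun N => \sum_(n < N) (u n (pou_tensor b e0) : K) *: y n)//.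
  by apply/funext => N; rewrite /series /= big_mkord.
- by move=> n k; exact: sum_level_le.
- pose t := (\sum_(0 <= n <oo) opnorm (u n) * enorm (y n))%E.
  have term0 n : (0 <= opnorm (u n) * enorm (y n))%E.
    by apply: mule_ge0; [exact: opnorm_ge0|exact: enorm_ge0].
  have tf : t \is a fin_num.
    by rewrite ge0_fin_numE//; exact: nneseries_ge0.
  apply: nondecreasing_is_cvgn.
    apply/nondecreasing_seqP => n; rewrite seriesSr lerDl !mulr_ge0 ?rnorm_ge0//.
    by rewrite fine_ge0// opnorm_ge0.
  exists (fine t * rnorm e0) => _ [n _ <-].
  rewrite /series /= (eq_bigr (fun k => fine (opnorm (u k) * enorm (y k))%E * rnorm e0)).
    rewrite -mulr_suml ler_wpM2r ?rnorm_ge0// -lee_fin fineK//.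
    rewrite -sumEFin (eq_bigr (fun k => opnorm (u k) * enorm (y k))%E).
      exact: nneseries_lim_ge.
    move=> k _; rewrite fineK// fin_numM// ge0_fin_numE ?opnorm_lty//; exact: opnorm_ge0.
  move=> k _; have uf : opnorm (u k) \is a fin_num.
    by rewrite ge0_fin_numE ?opnorm_lty//; exact: opnorm_ge0.
  by rewrite fineM//= mulrAC.
- by move=> v rv; exact: (weak_oscillation ma mnu numu mA rv).
Qed.

End not_nuclear.

Unset Implicit Arguments.

Theorem proposition2 (R : realType) (s : scalars)
    (F : completeNormedModType (field_of R s)) (hF : ~ RNP F)
    (E : completeNormedModType (field_of R s)) (hE : exists e : E, e <> 0) :
  exists T : bounded_op (C01 E) F,
    ~ nuclear T /\
    exists G : set (unit_interval R) -> bounded_op E F,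
      [/\ forall B, borel B -> forall e,
            representing_measure T B e = canonical_embedding (G B e),
          forall B, borel B -> nuclear (G B),
          countably_additive (@borel (unit_interval R)) nuclear_norm G
        & has_bounded_variation (@borel (unit_interval R)) nuclear_norm G].
Proof.
have [d [S [mu [m [mca mbv mac nog]]]]] : exists (d : measure_display)
    (S : measurableType d) (mu : {finite_measure set S -> \bar R}) (m : set S -> F),
    [/\ countably_additive (@measurable d S) enorm m,
        has_bounded_variation (@measurable d S) enorm m,
        (forall A, measurable A -> mu A = 0%E -> m A = 0)
      & ~ (exists g : S -> F, [/\ strongly_measurable mu g, bochner_integrable mu g
            & forall A, measurable A -> is_bochner_integral mu A g (m A)])].
  apply: contrapT => hno; apply: hF => d S mu m mca mbv mac.
  by apply: contrapT => nog; apply: hno; exists d, S, mu, m.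
have ma := additive_of_countably_additive mca.
have [nu [mnu numu]] := variation_dominates mca mbv.
have {}numu := numu mu mac.
have [e [e_gt0 bad]] := no_density_oscillation mca nog.
have [A [mA osc]] := oscillating_sequence mac e_gt0 bad.
have [e1 e1_neq0] := hE.
have [h [h_le he1]] := exists_bounded_functional e1_neq0.
have he0 : h ((h e1 : field_of R s)^-1 *: e1) = 1.
  by rewrite bounded_opZ; apply: mulVf; apply/eqP.
have mco := measurable_coding mA (R := R).
exists (integral_op ma mnu (measurable_coding mA (R := R)) h_le); split.
  move=> nucT.
  have [k0 hk0] := nuclear_integral_oscillation numu he0 nucT e_gt0.
  have [k [j [k0k]]] := osc k0.
  by rewrite ltNge hk0.
exists (rank_one m (coding A) h_le); split.
- move=> B bB e'; apply/funext => u.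
  rewrite /representing_measure /second_adjoint /phi /measure_of.
  set P := (X in xget _ X).
  have dsm : dual_measure (scalar_measure m (coding A) h_le u).
    exact: (scalar_measure_dual mca mnu mco).
  have ism f := scalar_measure_integral mca mnu mco h_le u f.
  have [dl il] : P (xget (fun=> 0) P).
    by apply: xgetPex; exists (scalar_measure m (coding A) h_le u).
  exact: (dual_measure_unique dl dsm il ism).
- by move=> B bB; apply: (@rank_one_nuclear _ _ _ _ _ h (image_measure m (coding A) B)).
- exact: (rank_one_ca mca mco).
- exact: (rank_one_bv mnu mco).
Qed.
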